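(* Let $k\in\{1,\dots,N\}$, $\mathcal{K}'=\{1,2,\dots,N\}\setminus\{k\}$, let $P_k\in\mathcal{RH}_\infty^{m\times m}$ be a given (nominal) system, and let $\beta_i\in[0,\frac{\pi}{2}]$, $\gamma_i>0$, $i\in\mathcal{K}'$, be given. Then the negative feedback interconnection of the cascade $P_1P_2\cdots P_N$ is stable for all $P_i\in\mathfrak{P}[\beta_i,\gamma_i]$, $i\in\mathcal{K}'$, if and only if there exists a function $\theta(\omega)\in\mathbb{R}$ such that $$-1\notin\mathrm{SRG}_{\theta(\omega)}(P_k(j\omega))\prod_{i\in\mathcal{K}'}\mathcal{R}[\beta_i,\gamma_i],\qquad\forall\omega\in[0,\infty].$$
   Context: $\mathcal{RH}_\infty^{m\times m}$ is the set of $m\times m$ real rational proper stable transfer matrices. The feedback interconnection of the cascade (the signal passes through $P_N,\dots,P_2,P_1$ in this order and the output of $P_1$ is fed back with a minus sign to the input of $P_N$; all $P_i\in\mathcal{RH}_\infty^{m\times m}$) is stable if and only if $(I+P_1P_2\cdots P_N)^{-1}\in\mathcal{RH}_\infty^{m\times m}$. $j$ is the imaginary unit, $\langle x,y\rangle=x^Hy$, $\|\cdot\|$ the Euclidean norm. For $x,y\in\mathbb{C}^m$ and $\theta\in\mathbb{R}$, $\angle_\theta(x,y)\in[0,\pi]$ is $\arccos\frac{\mathrm{Re}\langle x,e^{-j\theta}y\rangle}{\|x\|\|y\|}$ if $x\neq0,y\neq0$, and $0$ if $x=0$ or $y=0$. The $\theta$-symmetric scaled relative graph of $C\in\mathbb{C}^{m\times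 m}$ is $$\mathrm{SRG}_\theta(C)=\Big\{\tfrac{\|Cx\|}{\|x\|}\exp\{j(\theta\pm\angle_\theta(x,Cx))\}:0\neq x\in\mathbb{C}^m\Big\}$$ (both signs included), and $\mathrm{SRG}(C)=\mathrm{SRG}_0(C)$. For $\beta\in[0,\frac{\pi}{2}]$ and $\gamma>0$, $$\mathcal{R}[\beta,\gamma]=\Big\{re^{j\delta}\in\mathbb{C}:0\le r\le\tfrac{\gamma}{1+\sin\beta}\big(\cos\delta+\sqrt{\sin^2\beta-\sin^2\delta}\big),\ \delta\in[-\beta,\beta]\Big\},$$ $$\mathfrak{P}[\beta,\gamma]=\{P\in\mathcal{RH}_\infty^{m\times m}:\mathrm{SRG}(P(j\omega))\subset\mathcal{R}[\beta,\gamma],\ \forall\omega\in[0,\infty]\}.$$ Products of subsets of $\mathbb{C}$ are elementwise. The value of a transfer matrix at $\omega=\infty$ is its limit at infinity.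
   Formalization: The formal theorem assumes N ≥ 2, so that at least one uncertain system is present; for N = 1 (empty product {1}) the claim fails, e.g. m = 1, P_1 = -2/(s+1), θ(ω) = arg P_1(jω). *)

(* Defs.v *)
From HB Require Import structures.
From mathcomp Require Import all_boot all_order all_algebra generic_quotient.
From mathcomp Require Import complex.
From mathcomp Require Import all_classical all_reals all_analysis.

Set Implicit Arguments.
Unset Strict Implicit.
Unset Printing Implicit Defensive.

Import Order.TTheory GRing.Theory Num.Theory.
Import numFieldNormedType.Exports.

Local Open Scope quotient_scope.
Local Open Scope classical_set_scope.
Local Open Scope complex_scope.
Local Open Scope ring_scope.
Local Open Scope sesquilinear_scope.

Section TransferMatrices.
Variable R : realType.
Implicit Types (f : {fraction {poly R}}) (z : R[i]).

(* The pair [repr f] need not be in lowest terms, and a common root of its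
   components is not a pole of [f]. *)
Definition ratnum f : {poly R} :=
  let nd := fraction.frac (repr f) in nd.1 %/ gcdp nd.1 nd.2.
Definition ratden f : {poly R} :=
  let nd := fraction.frac (repr f) in nd.2 %/ gcdp nd.1 nd.2.

Lemma ratden_neq0 f : ratden f != 0.
Proof. by rewrite /ratden dvdp_div_eq0 ?dvdp_gcdr// denom_ratioP. Qed.

Lemma coprimep_ratnum_ratden f : coprimep (ratnum f) (ratden f).
Proof. by apply: coprimep_div_gcd; rewrite denom_ratioP orbT. Qed.

Lemma ratnum_div_ratden f :
  f = FracField.tofrac (ratnum f) / FracField.tofrac (ratden f).
Proof.
set x := repr f; set nd := fraction.frac x.
have d0 : nd.2 != 0 by rewrite denom_ratioP.
have g0 : gcdp nd.1 nd.2 != 0 by rewrite gcdp_eq0 (negPf d0) andbF.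
have fE : f = FracField.tofrac nd.1 / FracField.tofrac nd.2.
  have D0 : FracField.tofrac nd.2 != 0 by rewrite tofrac_eq0.
  apply: (mulIf D0); rewrite divfK//.
  have -> : f = \pi_(FracField.type {poly R}) x by rewrite reprK.
  rewrite -[LHS]/(FracField.mul _ _) !piE; apply/eqmodP.
  rewrite /= FracField.equivfE /FracField.mulf.
  rewrite !numden_Ratio ?mulf_neq0 ?oner_neq0 ?denom_ratioP//.
  by rewrite !mulr1 mulrC.
rewrite [LHS]fE -[in LHS](divpK (dvdp_gcdl nd.1 nd.2)).
rewrite -[X in _ / FracField.tofrac X](divpK (dvdp_gcdr nd.1 nd.2)).
by rewrite !tofracM invfM mulrACA divff ?mulr1// tofrac_eq0.
Qed.

Definition proper f := (size (ratnum f) <= size (ratden f))%N.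

Definition stable f := forall z, 0 <= complex.Re z ->
  ~~ root (map_poly (real_complex R) (ratden f)) z.

Definition rateval f z : R[i] :=
  (map_poly (real_complex R) (ratnum f)).[z]
  / (map_poly (real_complex R) (ratden f)).[z].

(* The cast to the regular algebra [R[i]^o] gives [R[i]] the topology of its
   modulus. *)
Definition rateval_infty f : R[i] :=
  lim ((rateval f (0 +i* w) : (R[i])^o) @[w --> +oo%R]).

Definition RHinf m (P : 'M[{fraction {poly R}}]_m) :=
  forall i j, proper (P i j) /\ stable (P i j).

(* The value P(jw), for w in [0, +oo]. *)
Definition freqresp m (P : 'M[{fraction {poly R}}]_m) (w : \bar R) :
    'M[R[i]]_m :=
  match w with
  | w%:E => map_mx (fun f => rateval f (0 +i* w)) P
  | _ => map_mx rateval_infty P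
  end.

(* [invmx S] is a junk value when [S] is singular. *)
Definition feedback_stable m N (P : 'I_N -> 'M[{fraction {poly R}}]_m) :=
  let S := 1%:M + \prod_(i < N) P i in S \in unitmx /\ RHinf (invmx S).

End TransferMatrices.

Section ScaledRelativeGraph.
Variable R : realType.

Definition expi (t : R) : R[i] := cos t +i* sin t.

Definition inner m (x y : 'cV[R[i]]_m) : R[i] := (x ^t* *m y) 0 0.

Definition enorm m (x : 'cV[R[i]]_m) : R := Num.sqrt (complex.Re (inner x x)).

Definition angle m (theta : R) (x y : 'cV[R[i]]_m) : R :=
  if (x == 0) || (y == 0) then 0
  else acos (complex.Re (inner x (expi (- theta) *: y)) / (enorm x * enorm y)).

Definition SRG m (theta : R) (C : 'M[R[i]]_m) : set R[i] :=
  [set z | exists2 x : 'cV[R[i]]_m, x != 0 &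
     let r := enorm (C *m x) / enorm x in
     let a := angle theta x (C *m x) in
     z = r%:C * expi (theta + a) \/ z = r%:C * expi (theta - a)].

Definition region (beta gamma : R) : set R[i] :=
  [set z | exists r delta : R,
     [/\ - beta <= delta <= beta,
         0 <= r <= gamma / (1 + sin beta)
                   * (cos delta + Num.sqrt (sin beta ^+ 2 - sin delta ^+ 2))
       & z = r%:C * expi delta]].

Definition uncertain_class m (beta gamma : R) :
    set 'M[{fraction {poly R}}]_m :=
  [set P | RHinf P /\ forall w : \bar R, (0 <= w)%E ->
     SRG 0 (freqresp P w) `<=` region beta gamma].

Definition mul_set (A B : set R[i]) : set R[i] :=
  [set a * b | a in A & b in B].

Definition prod_set N (D : pred 'I_N) (A : 'I_N -> set R[i]) : set R[i] :=
  [set \prod_(i | D i) z i |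
     z in [set z : 'I_N -> R[i] | forall i, D i -> A i (z i)]].

End ScaledRelativeGraph.

(* Main.v *)
(* Region: R[beta,gamma] is the union of the discs of centre u and radius u sin beta
   with 0 <= u <= gamma / (1 + sin beta), so SRG(C) lies in it as soon as
   |C x - u x| <= u sin beta |x| for all x and one such u.

   Sufficiency: a kernel vector of I + t P_1 ... P_N (jw), 0 <= t <= 1, gives a chain
   of vectors; the triangle inequality for angles turns it into a representation
   of -1 as an element of SRG_theta(P_k) times the product of the regions,
   whatever theta is. Hence det (I + t P_1 ... P_N) has no zero on the imaginary
   axis, infinity included, and none can enter the right half-plane while t grows
   from 0 to 1.

   Necessity: theta = 0 works. If -1 = q z_1 ... z_N with q in SRG(P_k(jw)) attained
   at x, the real span of x and P_k(jw) x is an isometric copy of the complex plane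
   in which P_k(jw) sends x to q x. Multiplication by z_i between two vectors of
   this plane is realized by u_i I + (rank one), whose entries are interpolated at
   w by all-pass functions; the resulting loop has a pole at jw. At w = 0 and
   w = infinity the values of the P_i are real. For m >= 2 a real x can be found, as
   a pair of real quadratic forms takes opposite values at two vectors of the real
   plane spanned by Re x and Im x. For m = 1 and P_k(jw) > 0 the factors z_i are
   genuinely complex, and a boundary version of the maximum principle shows that
   some interior frequency is destabilizing as well. *)

From HB Require Import structures.
Require Import Defs.
From mathcomp Require Import all_boot all_order all_algebra.
From mathcomp Require Import complex ring lra.
From mathcomp Require Import all_classical all_reals all_analysis.

Set Implicit Arguments.
Unset Strict Implicit.
Unset Printing Implicit Defensive.

Import Order.TTheory GRing.Theory Num.Theory.
Import Normc.
Import numFieldNormedType.Exports.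
Local Open Scope classical_set_scope.
Local Open Scope complex_scope.
Local Open Scope ring_scope.

(** * Hurwitz polynomials and the maximum principle *)

(** No winding number and no analytic function theory is involved. Over a common stable denominator
    D, det (I + t P_1 ... P_N) is a polynomial N_t divided by D; that it does not vanish at infinity
    says that N_t keeps the degree of D. Following the zeros thus reduces to Hurwitz polynomials of
    constant degree depending on t in a Lipschitz way, and the same homotopy also yields the maximum
    principle for rational functions.

    A perturbation has to take one prescribed value at a single frequency and yet stay in its class
    at all the others: the all-pass entries make the norm of the rank one term independent of the
    frequency.

    At 0 and infinity every perturbation is a real matrix, so the vectors of the plane have to be
    real as well. Replacing a point q of SRG(P_k) by another one q' is harmless when neither the
    modulus nor the angle decreases: -1/q' then has smaller modulus and argument than -1/q, and the
    product of the regions is closed under such a decrease. A 1 x 1 system has no second real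
    direction to rotate into. There the rotation has to come from P_k itself, at a frequency near
    the boundary one. *)

Section ComplexModulus.
Variable R : realType.
Implicit Types (x y : R) (z w : R[i]).

Lemma cReD z w : complex.Re (z + w) = complex.Re z + complex.Re w.
Proof. by case: z w => [a b] []. Qed.

Lemma cReN z : complex.Re (- z) = - complex.Re z.
Proof. by case: z. Qed.

Lemma cReB z w : complex.Re (z - w) = complex.Re z - complex.Re w.
Proof. by rewrite cReD cReN. Qed.

Lemma cReM z w : complex.Re (z * w)
  = complex.Re z * complex.Re w - complex.Im z * complex.Im w.
Proof. by case: z w => [a b] []. Qed.

Lemma cImM z w : complex.Im (z * w)
  = complex.Re z * complex.Im w + complex.Im z * complex.Re w.
Proof. by case: z w => [a b] [c d] /=. Qed.

Lemma cRe_sum (I : Type) (r : seq I) (P : pred I) (F : I -> R[i]) :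
  complex.Re (\sum_(i <- r | P i) F i) = \sum_(i <- r | P i) complex.Re (F i).
Proof. exact: (big_morph _ cReD (erefl _)). Qed.

Lemma cReMr x z : complex.Re (x%:C * z) = x * complex.Re z.
Proof. by rewrite cReM /= mul0r subr0. Qed.

Lemma sqr_normcE z : normc z ^+ 2 = complex.Re z ^+ 2 + complex.Im z ^+ 2.
Proof. by case: z => a b /=; rewrite sqr_sqrtr ?addr_ge0 ?sqr_ge0. Qed.

Lemma normc_ge0 z : 0 <= normc z.
Proof. by case: z => a b; rewrite sqrtr_ge0. Qed.

Lemma normc_eq0 z : (normc z == 0) = (z == 0).
Proof. by apply/eqP/eqP => [/eq0_normc //|->]; rewrite normc0. Qed.

Lemma normc_gt0 z : (0 < normc z) = (z != 0).
Proof. by rewrite lt_def normc_ge0 andbT normc_eq0. Qed.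

Lemma normc_real x : normc x%:C = `|x|.
Proof. by rewrite /= expr0n addr0 sqrtr_sqr. Qed.

Lemma normc_ge0_real x : 0 <= x -> normc x%:C = x.
Proof. by move=> x0; rewrite normc_real ger0_norm. Qed.

Lemma normc_Re z : `|complex.Re z| <= normc z.
Proof.
rewrite -(ler_pXn2r (n := 2)) ?nnegrE ?normc_ge0// sqr_normcE.
by rewrite real_normK ?num_real// lerDl sqr_ge0.
Qed.

Lemma normcX z n : normc (z ^+ n) = normc z ^+ n.
Proof. by elim: n => [|n IH]; rewrite ?expr0 ?normc1// !exprS normcM IH. Qed.

Lemma normc_prod (I : Type) (r : seq I) (P : pred I) (F : I -> R[i]) :
  normc (\prod_(i <- r | P i) F i) = \prod_(i <- r | P i) normc (F i).
Proof. exact: (big_morph _ (@normcM R) (normc1 R)). Qed.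

Lemma normc_sum (I : Type) (r : seq I) (P : pred I) (F : I -> R[i]) :
  normc (\sum_(i <- r | P i) F i) <= \sum_(i <- r | P i) normc (F i).
Proof.
elim/big_ind2: _ => [|z x w y zx wy|//]; first by rewrite normc0.
exact: le_trans (le_normcD _ _) (lerD zx wy).
Qed.

Lemma normc_distC z w : normc (z - w) = normc (w - z).
Proof. by rewrite -normcN opprB. Qed.

Lemma lerB_normc z w : normc z - normc w <= normc (z - w).
Proof. by rewrite lerBlDr (le_trans _ (le_normcD _ _))// subrK. Qed.

Lemma normc_conj z : normc z^*%C = normc z.
Proof. by case: z => a b /=; rewrite sqrrN. Qed.

Lemma mulc_conj z : z * z^* = (normc z ^+ 2)%:C.
Proof.
rewrite sqr_normcE; case: z => a b; apply/eqP; rewrite eq_complex /=.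
by apply/andP; split; apply/eqP; ring.
Qed.

End ComplexModulus.

Section Homotopy.
Variable R : realType.
Implicit Types (z : R[i]) (p q : {poly R[i]}).

Definition hurwitz p := forall z, 0 <= complex.Re z -> p.[z] != 0.

(** The supremum of the t such that [P] holds on [0, t] satisfies [P] by closedness; were it less
    than 1, openness would move it further. *)
Lemma real_induction (P : R -> Prop) : P 0 ->
  (forall t, 0 <= t <= 1 -> P t -> exists2 e, 0 < e &
    forall u, 0 <= u <= 1 -> `|u - t| < e -> P u) ->
  (forall t, 0 <= t <= 1 ->
    (forall e, 0 < e -> exists u, [/\ 0 <= u <= 1, `|u - t| < e & P u]) -> P t) ->
  P 1.
Proof.
move=> P0 Popen Pclosed.
pose E := [set t : R | 0 <= t <= 1 /\ forall u, 0 <= u <= t -> P u]%classic.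
have E0 : E 0.
  by split=> [|u]; rewrite ?lexx ?ler01// => /le_anti <-.
have supE : has_sup E.
  by split; [exists 0|exists 1 => t [/andP[]]].
have s0 : 0 <= sup E by apply: sup_upper_bound.
have s1 : sup E <= 1 by apply: ge_sup => [|t [/andP[]]//]; exists 0.
have lts u : 0 <= u -> u < sup E -> P u.
  move=> u0 us; have e0 : 0 < sup E - u by rewrite subr_gt0.
  have [t [_ Et] ut] := sup_adherent e0 supE; apply: Et.
  by rewrite u0/= ltW// (le_lt_trans _ ut)// subKr.
have Ps : P (sup E).
  apply: Pclosed => [|e e0]; first by rewrite s0.
  have [/eqP s00|s00] := boolP (sup E == 0).
    by exists 0; rewrite s00 subrr normr0 lexx ler01; split.
  have {}s00 : 0 < sup E by rewrite lt_def s00.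
  pose u := sup E - Num.min e (sup E) / 2.
  have m0 : 0 < Num.min e (sup E) by rewrite lt_min e0.
  have m1 : Num.min e (sup E) <= e by rewrite ge_min lexx.
  have m2 : Num.min e (sup E) <= sup E by rewrite ge_min lexx orbT.
  exists u; split.
  - by apply/andP; split; rewrite /u; lra.
  - by rewrite /u addrAC subrr sub0r normrN gtr0_norm; lra.
  - by apply: lts; rewrite /u; lra.
have [/eqP <-//|s1'] := boolP (sup E == 1).
have {}s1' : sup E < 1 by rewrite lt_def eq_sym s1' s1.
have [//|e e0 Pe] := Popen _ _ Ps; first by rewrite s0.
pose v := Num.min 1 (sup E + e / 2).
have v1 : v <= 1 by rewrite ge_min lexx.
have v2 : v <= sup E + e / 2 by rewrite ge_min lexx orbT.
have vs : sup E < v by rewrite lt_min s1'/=; lra.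
suff /(sup_upper_bound supE) : E v by lra.
split=> [|u /andP[u0 uv]]; first by rewrite v1 andbT; lra.
have [/(lts _ u0)//|su] := ltP u (sup E).
apply: Pe; first by rewrite u0/=; lra.
by rewrite ger0_norm; lra.
Qed.

(** The factor (1 + |z|)^K dominates every |z|^k with k <= K, and it has the growth of the lower
    bound available for Hurwitz polynomials. *)
Lemma normc_horner_dist (K : nat) p q (L : R) z :
  (size p <= K.+1)%N -> (size q <= K.+1)%N ->
  (forall k, normc (p`_k - q`_k) <= L) ->
  normc (p.[z] - q.[z]) <= K.+1%:R * L * (1 + normc z) ^+ K.
Proof.
move=> sp sq pq.
rewrite (horner_coef_wide _ sp) (horner_coef_wide _ sq) -sumrB.
apply: le_trans (normc_sum _ _ _) _.
rewrite -mulrA mulr_natl -[X in _ *+ X]card_ord -sumr_const ler_sum// => i _.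
rewrite -mulrBl normcM normcX ler_pM ?normc_ge0 ?exprn_ge0 ?normc_ge0//.
have z0 := normc_ge0 z; have z1 : 1 <= 1 + normc z by rewrite lerDl.
apply: (@le_trans _ _ ((1 + normc z) ^+ i)).
  by rewrite lerXn2r ?nnegrE ?addr_ge0 ?lerDr.
by apply: ler_weXn2l => //; rewrite -ltnS.
Qed.

(** For a root u put a = - Re u > 0. On the half-plane |z - u| is at least a and at least |z| - |u|;
    adding (1 + |u|) / a times the first bound to the second gives 1 + |z| <= k |z - u|. The bounds
    are multiplied over the roots. *)
Lemma normc_horner_ge_hurwitz p : hurwitz p -> exists2 c : R, 0 < c &
  forall z, 0 <= complex.Re z -> c * (1 + normc z) ^+ (size p).-1 <= normc p.[z].
Proof.
move=> ph; have [s ps] := closed_field_poly_normal p.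
have p0 : p != 0.
  by apply/eqP => p0; move: (ph 0 (lexx _)); rewrite p0 horner0 eqxx.
have sz : (size p).-1 = size s.
  by rewrite ps size_scale ?lead_coef_eq0// size_prod_XsubC.
have rootN u : u \in s -> complex.Re u < 0.
  move=> us; rewrite ltNge; apply/negP => /ph; rewrite ps hornerZ mulf_eq0.
  by rewrite lead_coef_eq0 (negPf p0)/= -[_ == 0]/(root _ u) root_prod_XsubC us.
suff [c c0 cP] : exists2 c : R, 0 < c & forall z, 0 <= complex.Re z ->
    c * (1 + normc z) ^+ size s <= normc (\prod_(u <- s) ('X - u%:P)).[z].
  exists (normc (lead_coef p) * c).
    by rewrite mulr_gt0 ?normc_gt0 ?lead_coef_eq0.
  move=> z z0; rewrite sz {2}ps hornerZ normcM -mulrA ler_wpM2l ?normc_ge0//.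
  exact: cP.
elim: s rootN {ps sz} => [|u s IH] rootN.
  by exists 1 => // z _; rewrite big_nil hornerC expr0 mul1r normc1.
have [c c0 cP] : exists2 c : R, 0 < c & forall z, 0 <= complex.Re z ->
    c * (1 + normc z) ^+ size s <= normc (\prod_(u <- s) ('X - u%:P)).[z].
  by apply: IH => v vs; apply: rootN; rewrite inE vs orbT.
have ru : complex.Re u < 0 by apply: rootN; rewrite inE eqxx.
pose a := - complex.Re u.
have a0 : 0 < a by rewrite oppr_gt0.
pose k := ((1 + normc u) / a + 1).
have nu0 := normc_ge0 u.
have k0 : 0 < k.
  by apply: ltr_wpDl => //; apply: divr_ge0 (ltW a0); apply: addr_ge0.
exists (k^-1 * c) => [|z z0]; first by rewrite mulr_gt0 ?invr_gt0.
rewrite big_cons hornerM normcM /= exprS mulrACA ler_pM//.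
- by apply: mulr_ge0; [rewrite invr_ge0 ltW|apply: addr_ge0; rewrite ?normc_ge0].
- by apply: mulr_ge0 (ltW c0) _; apply: exprn_ge0; apply: addr_ge0; rewrite ?normc_ge0.
- rewrite hornerXsubC mulrC ler_pdivrMr//.
  have h1 : a <= normc (z - u).
    apply: le_trans (normc_Re _); apply: le_trans (ler_norm _).
    by rewrite cReB /a lerDr.
  have h2 := lerB_normc z u.
  have h3 : 1 + normc u <= (1 + normc u) / a * normc (z - u).
    by rewrite mulrAC ler_pdivlMr// ler_wpM2l// addr_ge0.
  by rewrite /k mulrDr mulr1 [X in _ <= X + _]mulrC; lra.
- exact: cP.
Qed.

(** Each root satisfies |z - u| >= Re z - Re u >= Re z. Unlike in the previous bound the constant
    depends on [p] only through its leading coefficient, so it survives a passage to the limit in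
    [p]. *)
Lemma normc_horner_ge_hurwitz_Re p z : hurwitz p -> 0 <= complex.Re z ->
  normc (lead_coef p) * complex.Re z ^+ (size p).-1 <= normc p.[z].
Proof.
move=> ph z0; have [s ps] := closed_field_poly_normal p.
have p0 : p != 0.
  by apply/eqP => p0; move: (ph 0 (lexx _)); rewrite p0 horner0 eqxx.
have sz : (size p).-1 = size s.
  by rewrite ps size_scale ?lead_coef_eq0// size_prod_XsubC.
have rootN u : u \in s -> complex.Re u < 0.
  move=> us; rewrite ltNge; apply/negP => /ph; rewrite ps hornerZ mulf_eq0.
  by rewrite lead_coef_eq0 (negPf p0)/= -[_ == 0]/(root _ u) root_prod_XsubC us.
rewrite sz [p in p.[_]]ps hornerZ normcM ler_wpM2l ?normc_ge0//.
elim: s rootN {ps sz} => [|u s IH] rootN.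
  by rewrite big_nil hornerC normc1.
rewrite big_cons hornerM normcM /= exprS ler_pM ?exprn_ge0//.
  rewrite hornerXsubC; apply: le_trans (normc_Re _).
  apply: le_trans (ler_norm _); rewrite cReB lerDl oppr_ge0 ltW//.
  by apply: rootN; rewrite inE eqxx.
by apply: IH => v vs; apply: rootN; rewrite inE vs orbT.
Qed.

(* The Hurwitz polynomials of a fixed degree are relatively open, by the growth
   bound [normc_horner_ge_hurwitz], and relatively closed away from the
   polynomials with an imaginary root, by [normc_horner_ge_hurwitz_Re]. *)
Lemma hurwitz_homotopy (K : nat) (p : R -> {poly R[i]}) (L : R) :
  (forall t, (size (p t) <= K.+1)%N) ->
  (forall t u k, 0 <= t <= 1 -> 0 <= u <= 1 ->
    normc ((p t)`_k - (p u)`_k) <= L * `|t - u|) ->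
  (forall t, 0 <= t <= 1 -> (p t)`_K != 0) ->
  (forall t z, 0 <= t <= 1 -> complex.Re z = 0 -> (p t).[z] != 0) ->
  hurwitz (p 0) -> hurwitz (p 1).
Proof.
move=> sp lip topK axis p0.
have L0 : 0 <= L.
  have := lip 1 0 0; rewrite subr0 normr1 mulr1 !lexx ler01 => /(_ isT isT) h.
  by apply: le_trans h; exact: normc_ge0.
have szp t : 0 <= t <= 1 -> size (p t) = K.+1.
  move=> /topK h; apply/eqP; rewrite eqn_leq sp/= ltnNge; apply: contra h => h.
  by rewrite nth_default.
(* [L + 1] rather than [L] makes [M] positive, as it becomes a divisor. *)
pose M := K.+1%:R * (L + 1).
have M0 : 0 < M by rewrite mulr_gt0 ?ltr0n// ltr_wpDl.
have dist t u z : 0 <= t <= 1 -> 0 <= u <= 1 ->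
    normc ((p u).[z] - (p t).[z]) <= M * `|u - t| * (1 + normc z) ^+ K.
  move=> t01 u01.
  apply: le_trans (normc_horner_dist z (sp u) (sp t) (fun k => lip u t k u01 t01)) _.
  rewrite ler_wpM2r ?exprn_ge0 ?addr_ge0 ?normc_ge0// mulrA ler_wpM2r//.
  by rewrite ler_wpM2l// lerDl.
apply: (@real_induction (fun t => hurwitz (p t))) => // t t01.
  move=> /normc_horner_ge_hurwitz[c c0 cP].
  exists (c / M) => [|u u01 ut z z0]; first by rewrite divr_gt0.
  rewrite -normc_gt0.
  have := lerB_normc (p t).[z] ((p t).[z] - (p u).[z]).
  rewrite subKr; apply: lt_le_trans; rewrite subr_gt0 normc_distC.
  apply: le_lt_trans (dist _ _ _ t01 u01) _; apply: lt_le_trans (cP _ z0).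
  rewrite szp//= ltr_pM2r ?exprn_gt0 ?ltr_wpDr ?normc_ge0//.
  by rewrite mulrC -ltr_pdivlMr.
move=> Pcl z z0; apply/negP => /eqP ptz.
have [/esym zz|zz] := eqVneq 0 (complex.Re z).
  by have := axis t z t01 zz; rewrite ptz eqxx.
have {z0 zz} z0 : 0 < complex.Re z by rewrite lt_def eq_sym zz.
(* If p t vanishes at z with Re z > 0, a nearby Hurwitz p u has modulus at z at most M |u - t| (1 +
   |z|)^K, while its leading coefficient lost at most (L + 1) |u - t|. [D] adds up both losses, so
   |u - t| < c / D is contradictory. *)
pose D := M * (1 + normc z) ^+ K + (L + 1) * complex.Re z ^+ K.
pose c := normc (p t)`_K * complex.Re z ^+ K.
have c0 : 0 < c by rewrite mulr_gt0 ?exprn_gt0 ?normc_gt0 ?topK.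
have D0 : 0 < D.
  have ? := normc_ge0 z; apply: addr_gt0; apply: mulr_gt0 => //.
  - by apply: exprn_gt0; apply: ltr_pwDl.
  - exact: ltr_wpDl.
  - exact: exprn_gt0.
have [u [u01 ut uh]] := Pcl (c / D) (divr_gt0 c0 D0).
have := normc_horner_ge_hurwitz_Re uh (ltW z0).
rewrite /lead_coef szp//=.
have := dist t u z t01 u01; rewrite ptz subr0 => h1 h2.
have := le_trans h2 h1.
have h3 : normc (p t)`_K - (L + 1) * `|u - t| <= normc (p u)`_K.
  have h3 := lerB_normc (p t)`_K ((p t)`_K - (p u)`_K).
  rewrite subKr normc_distC in h3; apply: le_trans h3.
  by rewrite lerD2l lerN2 (le_trans (lip _ _ _ u01 t01))// ler_wpM2r// lerDl.
apply/negP; rewrite -ltNge.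
apply: lt_le_trans (ler_wpM2r (exprn_ge0 K (ltW z0)) h3).
rewrite mulrBl -/c ltrBrDr.
have -> : M * `|u - t| * (1 + normc z) ^+ K + (L + 1) * `|u - t| * complex.Re z ^+ K
   = D * `|u - t| by rewrite /D; ring.
by rewrite mulrC -ltr_pdivlMr.
Qed.

End Homotopy.

Section MaxModulus.
Variable R : realType.
Implicit Types (z : R[i]) (n d : {poly R[i]}).

Lemma normc_coef_bound n : exists L : R, forall k, normc n`_k <= L.
Proof.
exists (\sum_(i < size n) normc n`_i) => k.
have [kn|nk] := ltnP k (size n).
  by rewrite (bigD1 (Ordinal kn))//= lerDl sumr_ge0// => i _; rewrite normc_ge0.
by rewrite nth_default// normc0 sumr_ge0// => i _; rewrite normc_ge0.
Qed.

(** If w = n(z) / d(z) had modulus greater than c, then d - (t / w) n would have no zero on the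
    imaginary axis and no degree drop for t in [0, 1]. It is Hurwitz at t = 0, hence also at t = 1,
    where it vanishes at z. The hypothesis on the top coefficient is the bound at infinity. *)
Lemma max_modulus_hurwitz n d (c : R) : hurwitz d -> (size n <= size d)%N ->
  (forall z, complex.Re z = 0 -> normc n.[z] <= c * normc d.[z]) ->
  normc n`_(size d).-1 <= c * normc (lead_coef d) ->
  forall z, 0 <= complex.Re z -> normc n.[z] <= c * normc d.[z].
Proof.
move=> dh nd axis top z z0; rewrite leNgt; apply/negP => lt.
have d0 : d != 0.
  by apply/eqP => d0; move: (dh 0 (lexx _)); rewrite d0 horner0 eqxx.
have dz := dh z z0; have ndz : 0 < normc d.[z] by rewrite normc_gt0.
have c0 : 0 <= c.
  have := le_trans (normc_ge0 _) top.
  by rewrite pmulr_lge0// normc_gt0 lead_coef_eq0.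
pose w := n.[z] / d.[z].
have cw : c < normc w by rewrite normcM normcV ltr_pdivlMr.
have w0 : 0 < normc w by apply: le_lt_trans cw.
have w0' : w != 0 by rewrite -normc_gt0.
have [L nL] := normc_coef_bound n.
pose p (t : R) := d - (t%:C / w) *: n.
have key (x y : R[i]) (t : R) : 0 <= t <= 1 -> normc x <= c * normc y -> y != 0 ->
    y - t%:C / w * x != 0.
  move=> /andP[t0 t1] xy y0; rewrite subr_eq0; apply/eqP => yx.
  have ny : 0 < normc y by rewrite normc_gt0.
  have : normc y < normc y.
    rewrite {1}yx !normcM normcV normc_ge0_real//.
    apply: le_lt_trans (_ : (normc w)^-1 * (c * normc y) < _); last first.
      by rewrite mulrA gtr_pMl// mulrC ltr_pdivrMr// mul1r.
    rewrite ler_pM ?mulr_ge0 ?invr_ge0 ?normc_ge0//.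
    by rewrite ler_piMl ?invr_ge0 ?normc_ge0.
  by rewrite ltxx.
suff /(_ z z0) : hurwitz (p 1).
  have nz : n.[z] != 0 by apply: contraNneq w0' => nz; rewrite /w nz mul0r.
  by rewrite /p hornerD hornerN hornerZ rmorph1 div1r invf_div divfK// subrr eqxx.
apply: (@hurwitz_homotopy _ (size d).-1 p ((normc w)^-1 * L)).
- move=> t; rewrite prednK ?size_poly_gt0//.
  rewrite (leq_trans (size_polyD _ _))// geq_max leqnn size_polyN.
  exact: leq_trans (size_scale_leq _ _) nd.
- move=> t u k _ _; rewrite /p !coefB !coefZ.
  have -> : d`_k - t%:C / w * n`_k - (d`_k - u%:C / w * n`_k)
      = (u - t)%:C / w * n`_k by rewrite rmorphB; ring.
  rewrite normcM [normc (_ / w)]normcM normcV normc_real distrC [X in _ <= X]mulrC.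
  rewrite -!mulrA; apply: ler_wpM2l => //.
  by apply: ler_wpM2l => //; rewrite invr_ge0 normc_ge0.
- by move=> t t01; rewrite /p coefB coefZ key// lead_coef_eq0.
- move=> t y t01 y0; rewrite /p hornerD hornerN hornerZ key ?axis//.
  by apply: dh; rewrite y0.
- by rewrite /p mul0r scale0r subr0.
Qed.

End MaxModulus.

(** * The ring of proper stable rational functions *)

Section Representation.
Variable R : realType.
Implicit Types (f g : {fraction {poly R}}) (a b p : {poly R}) (z : R[i]).

Local Notation "p %:CP" := (map_poly (real_complex R) p) (at level 2).

(** By Gauss's lemma the reduced denominator divides every denominator; this frees all later
    arguments from lowest terms. *)
Lemma frac_repr f a b : b != 0 ->
  f = FracField.tofrac a / FracField.tofrac b ->
  exists2 g, g != 0 & a = g * ratnum f /\ b = g * ratden f.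
Proof.
move=> b0 fE; have d0 := ratden_neq0 f.
have ab : a * ratden f = b * ratnum f.
  have b0' : FracField.tofrac b != 0 by rewrite tofrac_eq0.
  have d0' : FracField.tofrac (ratden f) != 0 by rewrite tofrac_eq0.
  have aE : FracField.tofrac a = f * FracField.tofrac b.
    by rewrite fE; apply: esym; apply: (divfK b0').
  have nE : FracField.tofrac (ratnum f) = f * FracField.tofrac (ratden f).
    by rewrite [X in _ = X * _]ratnum_div_ratden; apply: esym; apply: (divfK d0').
  apply/eqP; rewrite -tofrac_eq !tofracM aE nE mulrCA mulrA.
  exact: eqxx.
have : ratden f %| b.
  rewrite -(@Gauss_dvdpl _ _ (ratnum f)); last first.
    by rewrite coprimep_sym coprimep_ratnum_ratden.
  by rewrite -ab dvdp_mull// dvdpp.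
move=> /divpK; set g := _ %/ _ => gb.
exists g; first by apply: contraNneq b0 => g0; rewrite -gb g0 mul0r.
split=> //; apply: (mulIf d0); rewrite ab -gb; ring.
Qed.

Definition rh f := Defs.proper f /\ Defs.stable f.

Lemma hurwitz_root p : hurwitz p%:CP <->
  forall z, 0 <= complex.Re z -> ~~ root p%:CP z.
Proof. by []. Qed.

Lemma hurwitzCP_neq0 b : hurwitz b%:CP -> b != 0.
Proof.
move=> bh; apply/eqP => b0.
by move: (bh 0 (lexx _)); rewrite b0 map_poly0 horner0 eqxx.
Qed.

(** Cancelling the common factor removes roots of [b] and lowers both degrees equally. *)
Lemma rh_frac f a b : hurwitz b%:CP -> (size a <= size b)%N ->
  f = FracField.tofrac a / FracField.tofrac b -> rh f.
Proof.
move=> bh ab fE; have b0 := hurwitzCP_neq0 bh.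
have [g g0 [aE bE]] := frac_repr b0 fE; split; last first.
  apply/hurwitz_root => z /bh; rewrite bE rmorphM hornerM.
  by rewrite mulf_eq0 negb_or => /andP[].
rewrite /Defs.proper; have [->|n0] := eqVneq (ratnum f) 0; first by rewrite size_poly0.
have sg : (0 < size g)%N by rewrite size_poly_gt0.
have sd : (0 < size (ratden f))%N by rewrite size_poly_gt0 ratden_neq0.
have sn : (0 < size (ratnum f))%N by rewrite size_poly_gt0.
move: ab; rewrite aE bE !size_mul ?ratden_neq0//.
by rewrite -!subn1 leq_subLR subnKC ?addn_gt0 ?sg// leq_add2l.
Qed.

Lemma rh_repr f : rh f -> [/\ hurwitz (ratden f)%:CP,
  (size (ratnum f) <= size (ratden f))%N &
  f = FracField.tofrac (ratnum f) / FracField.tofrac (ratden f)].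
Proof. by case=> pf sf; split=> //; exact: ratnum_div_ratden. Qed.

Lemma rateval_frac f a b z : b%:CP.[z] != 0 ->
  f = FracField.tofrac a / FracField.tofrac b ->
  rateval f z = a%:CP.[z] / b%:CP.[z].
Proof.
move=> bz fE; have b0 : b != 0.
  by apply: contraNneq bz => ->; rewrite map_poly0 horner0.
have [g g0 [aE bE]] := frac_repr b0 fE.
have az : a%:CP.[z] = g%:CP.[z] * (ratnum f)%:CP.[z].
  by rewrite [in LHS]aE rmorphM hornerM.
have bz' : b%:CP.[z] = g%:CP.[z] * (ratden f)%:CP.[z].
  by rewrite [in LHS]bE rmorphM hornerM.
move: bz; rewrite /rateval az bz' mulf_eq0 negb_or => /andP[gz dz].
by rewrite -mulf_div divff ?mul1r.
Qed.

End Representation.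

(** * Reversed polynomials and values at infinity *)

Section Reversal.
Variable K : fieldType.
Implicit Types p : {poly K}.

(** The reciprocal polynomial z^e p(1/z). The degree [e] is a parameter, so that numerator and
    denominator of a fraction are reversed with the same power of z. *)
Definition revpoly e p := \poly_(i < e.+1) p`_(e - i).

Lemma horner_revpoly e p z : (size p <= e.+1)%N -> z != 0 ->
  p.[z] = z ^+ e * (revpoly e p).[z^-1].
Proof.
move=> sp z0; rewrite (horner_coef_wide _ sp).
rewrite (horner_coef_wide _ (size_poly _ _)) mulr_sumr.
rewrite (reindex_inj rev_ord_inj) /=; apply: eq_bigr => i _.
rewrite coef_poly ltn_ord subSS mulrCA; congr (_ * _).
rewrite exprVn; apply: expfB_cond.
by rewrite (negPf z0) add0n -ltnS.
Qed.

Lemma revpoly0 e p : (revpoly e p).[0] = p`_e.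
Proof. by rewrite horner_coef0 coef_poly subn0. Qed.

End Reversal.

Section EvaluationAtInfinity.
Variable R : realType.
Implicit Types (f g : {fraction {poly R}}) (a b p : {poly R}) (z : R[i]).

Local Notation "p %:CP" := (map_poly (real_complex R) p) (at level 2).

Lemma continuous_horner_reg (K : numFieldType) (p : {poly K}) :
  continuous (horner p : K^o -> K^o).
Proof.
elim/poly_ind: p => [|p c IH].
  have -> : (horner 0 : K^o -> K^o) = cst 0 by apply/funext => z; rewrite /= horner0.
  exact: cst_continuous.
have -> : (horner (p * 'X + c%:P) : K^o -> K^o) = (fun z : K^o => p.[z] * z + c :> K^o).
  by apply/funext => z; rewrite /= hornerMXaddC.
move=> x.
have h : (p.[z] * z : K^o) @[z --> (x : K^o)] --> (p.[x] * x : K^o).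
  have h1 : (p.[z] : K^o) @[z --> (x : K^o)] --> (p.[x] : K^o) := IH x.
  have h2 : (z : K^o) @[z --> (x : K^o)] --> (x : K^o) by exact: cvg_id.
  exact: (cvgM h1 h2).
have h3 : (c : K^o) @[z --> (x : K^o)] --> (c : K^o) by exact: (@cst_continuous K^o K^o c x).
exact: (@cvgD K K^o _ _ _ _ _ _ _ h h3).
Qed.

Lemma cvg_inv_imaginary :
  ((0 +i* w : R[i])^-1 : (R[i])^o) @[w --> +oo%R] --> (0 : (R[i])^o).
Proof.
apply/cvgrPdist_lt => /= e e0.
have [r er r0] : exists2 r : R, e = r%:C & 0 < r.
  by case: e e0 => r s; rewrite ltcE/= => /andP[/eqP->]; exists r.
near=> w; have w0 : 0 < w by near: w; exact: nbhs_pinfty_gt.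
rewrite sub0r normrN normrV ?unitfE ?eq_complex/= ?eqxx ?(gt_eqF w0)//.
rewrite normc_def /= expr0n add0r sqrtr_sqr gtr0_norm// er.
rewrite -fmorphV ltcR invf_plt ?posrE//.
by near: w; apply: nbhs_pinfty_gt; rewrite num_real.
Unshelve. all: by end_near. Qed.

(** Dividing by z^e leaves a quotient of reversed polynomials in 1/z, continuous at 0 because the
    reversed denominator takes there the leading coefficient of [b]. *)
Lemma rateval_infty_frac f a b : b != 0 -> (size a <= size b)%N ->
  f = FracField.tofrac a / FracField.tofrac b ->
  rateval_infty f = (a`_(size b).-1 / lead_coef b)%:C.
Proof.
move=> b0 ab fE.
apply: (@cvg_lim (R[i])^o (@norm_hausdorff R[i] (R[i])^o) R (pinfty_nbhs R)
  proper_pinfty_nbhs (fun w => rateval f (0 +i* w))).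
set e := (size b).-1; have be : size b = e.+1 by rewrite prednK ?size_poly_gt0.
pose ra := revpoly e a%:CP; pose rb := revpoly e b%:CP.
have rb0 : rb.[0] != 0.
  rewrite revpoly0 coef_map fmorph_eq0 -[_`_e]/(lead_coef b).
  by rewrite lead_coef_eq0.
have lim : (ra.[(0 +i* w)^-1] / rb.[(0 +i* w)^-1] : (R[i])^o) @[w --> +oo%R]
    --> (ra.[0] / rb.[0] : (R[i])^o).
  apply: cvgM.
    by apply: (cvg_comp _ _ cvg_inv_imaginary); exact: (@continuous_horner_reg R[i]).
  apply: cvgV => //.
  by apply: (cvg_comp _ _ cvg_inv_imaginary); exact: (@continuous_horner_reg R[i]).
have -> : (a`_e / lead_coef b)%:C = ra.[0] / rb.[0].
  by rewrite !revpoly0 !coef_map rmorphM fmorphV.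
apply: cvg_trans lim; apply: near_eq_cvg; near=> w.
have w0 : 0 +i* w != 0.
  by rewrite eq_complex /= eqxx gt_eqF//; near: w; exact: nbhs_pinfty_gt.
have rbw : rb.[(0 +i* w)^-1] != 0.
  near: w.
  have h : (rb.[(0 +i* w)^-1] : (R[i])^o) @[w --> +oo%R] --> (rb.[0] : (R[i])^o).
    by apply: (cvg_comp _ _ cvg_inv_imaginary); exact: (@continuous_horner_reg R[i]).
  exact: (cvgr_neq0 _ h).
have bw : b%:CP.[0 +i* w] != 0.
  rewrite (@horner_revpoly _ e) ?size_map_poly ?be//.
  by rewrite mulf_neq0 ?expf_neq0.
rewrite (rateval_frac bw fE) !(@horner_revpoly _ e _ (0 +i* w)) ?size_map_poly -?be//.
by rewrite -mulf_div divff ?mul1r// expf_neq0.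
Unshelve. all: by end_near. Qed.

End EvaluationAtInfinity.

Section StableRing.
Variable R : realType.
Implicit Types (f g : {fraction {poly R}}) (a b p q : {poly R}) (w : \bar R).

Local Notation "p %:CP" := (map_poly (real_complex R) p) (at level 2).

Lemma coefM_top (K : nzRingType) (p q : {poly K}) d e :
  (size p <= d.+1)%N -> (size q <= e.+1)%N -> (p * q)`_(d + e) = p`_d * q`_e.
Proof.
move=> pd qe; rewrite coefM (bigD1 (inord d)) //= inordK ?ltnS ?leq_addr//.
rewrite addKn big1 ?addr0// => i; rewrite -val_eqE /= inordK ?ltnS ?leq_addr//.
rewrite neq_ltn => /orP[id|di].
  by rewrite [X in _ * X]nth_default ?mulr0// (leq_trans qe)// ltn_subRL ltn_add2r.
by rewrite nth_default ?mul0r// (leq_trans pd).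
Qed.

(* The value at jw of a polynomial of degree at most [e], where at infinity the
   value is the coefficient of degree [e]. *)
Definition polyval w e p : R[i] :=
  match w with r%:E => p%:CP.[0 +i* r] | _ => (p`_e)%:C end.

Definition ev w f : R[i] :=
  match w with r%:E => rateval f (0 +i* r) | _ => rateval_infty f end.

Lemma freqrespE m (P : 'M[{fraction {poly R}}]_m) w : freqresp P w = map_mx (ev w) P.
Proof. by case: w. Qed.

Lemma polyval_neq0 w b : hurwitz b%:CP -> polyval w (size b).-1 b != 0.
Proof.
move=> bh; have := hurwitzCP_neq0 bh.
by case: w => [r _|b0|b0]/=; [apply: bh|..]; rewrite ?fmorph_eq0 ?lead_coef_eq0.
Qed.

Lemma polyvalD w e p q : polyval w e (p + q) = polyval w e p + polyval w e q.
Proof. by case: w => [r||]/=; rewrite ?rmorphD ?hornerD ?coefD ?rmorphD. Qed.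

Lemma polyvalN w e p : polyval w e (- p) = - polyval w e p.
Proof. by case: w => [r||]/=; rewrite ?rmorphN ?hornerN ?coefN ?rmorphN. Qed.

Lemma polyvalZ w e (c : R) p : polyval w e (c *: p) = c%:C * polyval w e p.
Proof. by case: w => [r||]/=; rewrite ?map_polyZ ?hornerZ ?coefZ ?rmorphM. Qed.

Lemma polyvalM w d e p q : (size p <= d.+1)%N -> (size q <= e.+1)%N ->
  polyval w (d + e) (p * q) = polyval w d p * polyval w e q.
Proof.
by move=> pd qe; case: w => [r||]/=; rewrite ?coefM_top// rmorphM// hornerM.
Qed.

Lemma ev_frac w f a b : hurwitz b%:CP -> (size a <= size b)%N ->
  f = FracField.tofrac a / FracField.tofrac b ->
  ev w f = polyval w (size b).-1 a / polyval w (size b).-1 b.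
Proof.
move=> bh ab fE; have b0 := hurwitzCP_neq0 bh.
case: w => [r||] /=; first by apply: rateval_frac => //; exact: bh.
  by rewrite (rateval_infty_frac b0 ab fE) rmorphM fmorphV.
by rewrite (rateval_infty_frac b0 ab fE) rmorphM fmorphV.
Qed.

Section TwoFractions.
Variables (f g : {fraction {poly R}}) (a b c d : {poly R}).
Hypotheses (bh : hurwitz b%:CP) (dh : hurwitz d%:CP).
Hypotheses (ab : (size a <= size b)%N) (cd : (size c <= size d)%N).
Hypotheses (fE : f = FracField.tofrac a / FracField.tofrac b)
  (gE : g = FracField.tofrac c / FracField.tofrac d).

Let b0 : b != 0. Proof. exact: hurwitzCP_neq0. Qed.
Let d0 : d != 0. Proof. exact: hurwitzCP_neq0. Qed.
Let sb : size b = (size b).-1.+1. Proof. by rewrite prednK ?size_poly_gt0. Qed.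
Let sd : size d = (size d).-1.+1. Proof. by rewrite prednK ?size_poly_gt0. Qed.

Lemma hurwitzM : hurwitz (b * d)%:CP.
Proof. by move=> z z0; rewrite rmorphM hornerM mulf_neq0 ?bh ?dh. Qed.

Lemma size_den : size (b * d)%R = ((size b).-1 + (size d).-1).+1%N.
Proof. by rewrite size_mul// {1}sb {1}sd addSn addnS. Qed.

Lemma size_num p q : (size p <= size b)%N -> (size q <= size d)%N ->
  (size (p * q)%R <= size (b * d)%R)%N.
Proof.
move=> pb qd; rewrite (leq_trans (size_polyMleq _ _))// size_mul//.
by rewrite -!subn1 leq_sub2r// leq_add.
Qed.

Lemma frac_mulE : f * g = FracField.tofrac (a * c) / FracField.tofrac (b * d).
Proof. by rewrite fE gE !tofracM invfM mulrACA. Qed.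

Lemma frac_subE :
  f - g = FracField.tofrac (a * d - b * c) / FracField.tofrac (b * d).
Proof.
have subf_div (F : fieldType) (x y z t : F) : y != 0 -> t != 0 ->
    x / y - z / t = (x * t - y * z) / (y * t) by move=> ? ?; field; apply/andP.
by rewrite fE gE tofracB !tofracM; apply: subf_div; rewrite tofrac_eq0.
Qed.

Lemma rh_mul_frac : rh (f * g).
Proof. exact: rh_frac hurwitzM (size_num ab cd) frac_mulE. Qed.

Lemma size_sub_num : (size (a * d - b * c)%R <= size (b * d)%R)%N.
Proof.
by rewrite (leq_trans (size_polyD _ _))// geq_max size_polyN !size_num.
Qed.

Lemma rh_sub_frac : rh (f - g).
Proof. exact: rh_frac hurwitzM size_sub_num frac_subE. Qed.

Lemma ev_mul_frac w : ev w (f * g) = ev w f * ev w g.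
Proof.
rewrite (ev_frac w hurwitzM (size_num ab cd) frac_mulE).
rewrite (ev_frac w bh ab fE) (ev_frac w dh cd gE) size_den /=.
by rewrite !polyvalM -?sb -?sd// mulf_div.
Qed.

Lemma ev_sub_frac w : ev w (f - g) = ev w f - ev w g.
Proof.
rewrite (ev_frac w hurwitzM size_sub_num frac_subE).
rewrite (ev_frac w bh ab fE) (ev_frac w dh cd gE) size_den /=.
rewrite polyvalD polyvalN !polyvalM -?sb -?sd//.
have := polyval_neq0 w bh; have := polyval_neq0 w dh.
by move=> ? ?; field; apply/andP.
Qed.

End TwoFractions.

Definition rhb : {pred {fraction {poly R}}} := fun f => `[< rh f >].

Lemma rhP f : reflect (rh f) (f \in rhb).
Proof. exact: asboolP. Qed.

Lemma ratC (c : R) : [/\ hurwitz (1 : {poly R})%:CP,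
  (size (c%:P : {poly R}) <= size (1%R : {poly R}))%N &
  FracField.tofrac c%:P = FracField.tofrac c%:P / FracField.tofrac (1 : {poly R})].
Proof.
split; last by rewrite tofrac1 divr1.
  by move=> z _; rewrite rmorph1 hornerC oner_eq0.
by rewrite size_poly1 size_polyC_leq1.
Qed.

Lemma rh_const (c : R) : rh (FracField.tofrac c%:P).
Proof. by have [h1 h2 h3] := ratC c; exact: rh_frac h3. Qed.

Lemma ev_const w (c : R) : ev w (FracField.tofrac c%:P) = c%:C.
Proof.
have [h1 h2 h3] := ratC c; rewrite (ev_frac w h1 h2 h3) size_poly1/=.
by case: w => [r||]/=; rewrite ?map_polyC ?rmorph1 ?hornerC ?coefC/= ?coef1/= ?rmorph1
  ?divr1.
Qed.

Lemma rhb_subring_closed : subring_closed rhb.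
Proof.
split=> [|f g|f g]; first by apply/rhP; rewrite -tofrac1; exact: rh_const.
  move=> /rhP/rh_repr[? ? fE] /rhP/rh_repr[? ? gE].
  by apply/rhP; exact: rh_sub_frac fE gE.
move=> /rhP/rh_repr[? ? fE] /rhP/rh_repr[? ? gE].
by apply/rhP; exact: rh_mul_frac fE gE.
Qed.

HB.instance Definition _ := GRing.isSubringClosed.Build _ rhb rhb_subring_closed.

(** As a commutative ring type, the proper stable functions carry matrices, determinants and
    polynomials, and evaluation at a frequency becomes a ring morphism commuting with all of
    them. *)
Record RH := MkRH {rhval :> {fraction {poly R}}; _ : rhval \in rhb}.
HB.instance Definition _ := [isSub for rhval].
HB.instance Definition _ := [Choice of RH by <:].
HB.instance Definition _ := [SubChoice_isSubComNzRing of RH by <:].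

Lemma RH_rh (h : RH) : rh (val h).
Proof. exact/rhP/(valP h). Qed.

Definition evRH w (h : RH) : R[i] := ev w (val h).

Fact evRH_zmod_morphism w : zmod_morphism (evRH w).
Proof.
move=> f g; have [? ? fE] := rh_repr (RH_rh f); have [? ? gE] := rh_repr (RH_rh g).
by rewrite /evRH rmorphB/=; by apply: (ev_sub_frac _ _ _ _ fE gE).
Qed.

Fact evRH_monoid_morphism w : monoid_morphism (evRH w).
Proof.
split=> [|f g]; first by rewrite /evRH rmorph1 -tofrac1 ev_const.
have [? ? fE] := rh_repr (RH_rh f); have [? ? gE] := rh_repr (RH_rh g).
by rewrite /evRH rmorphM/=; by apply: (ev_mul_frac _ _ _ _ fE gE).
Qed.

HB.instance Definition _ w :=
  GRing.isZmodMorphism.Build RH R[i] (evRH w) (evRH_zmod_morphism w).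
HB.instance Definition _ w :=
  GRing.isMonoidMorphism.Build RH R[i] (evRH w) (evRH_monoid_morphism w).

Lemma RHinf_lift m (P : 'M[{fraction {poly R}}]_m) : RHinf P ->
  exists Q : 'M[RH]_m, P = map_mx val Q.
Proof.
move=> Ph; have h i j : P i j \in rhb by apply/rhP; exact: Ph.
exists (\matrix_(i, j) MkRH (h i j)); apply/matrixP => i j.
by rewrite !mxE.
Qed.

Lemma RHinf_map_val m (Q : 'M[RH]_m) : RHinf (map_mx val Q).
Proof. by move=> i j; rewrite mxE; exact: RH_rh. Qed.

Lemma freqresp_map_val m (Q : 'M[RH]_m) w :
  freqresp (map_mx val Q) w = map_mx (evRH w) Q.
Proof. by rewrite freqrespE -map_mx_comp. Qed.

End StableRing.

(** * Invertibility in the stable ring and stability of the feedback loop *)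

Section StableInverse.
Variable R : realType.
Implicit Types (w : \bar R) (t u : R).

Local Notation "p %:CP" := (map_poly (real_complex R) p) (at level 2).

Lemma RH_common_denominator n (q : nat -> RH R) :
  exists (D : {poly R}) (A : nat -> {poly R}), hurwitz D%:CP /\
    forall k, (k < n)%N -> (size (A k) <= size D)%N /\
      val (q k) = FracField.tofrac (A k) / FracField.tofrac D.
Proof.
elim: n => [|n [D [A [Dh AD]]]].
  by exists 1, (fun=> 0); split=> // z _; rewrite rmorph1 hornerC oner_eq0.
have [dh ad qE] := rh_repr (RH_rh (q n)).
set a := ratnum _ in ad qE; set d := ratden _ in dh ad qE.
have D0 := hurwitzCP_neq0 Dh; have d0 := hurwitzCP_neq0 dh.
exists (D * d), (fun k => if (k == n)%N then D * a else A k * d).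
split=> [|k]; first exact: hurwitzM.
rewrite ltnS leq_eqVlt => /predU1P[->|kn].
  rewrite eqxx; split; first exact: size_num.
  by rewrite qE !tofracM -mulf_div divff ?mul1r ?tofrac_eq0.
rewrite ltn_eqF//; have [sA {}qE] := AD k kn; split; first exact: size_num.
by rewrite qE !tofracM -mulf_div [X in _ = _ * X]divff ?mulr1 ?tofrac_eq0.
Qed.

Lemma distX_le (k : nat) t u : 0 <= t <= 1 -> 0 <= u <= 1 ->
  `|t ^+ k - u ^+ k| <= k%:R * `|t - u|.
Proof.
move=> /andP[t0 t1] /andP[u0 u1]; rewrite subrXX normrM mulrC ler_wpM2r//.
apply: le_trans (ler_norm_sum _ _ _) _.
rewrite -[X in _ <= X%:R]card_ord -sumr_const ler_sum// => i _.
by rewrite ger0_norm ?mulr_ge0 ?exprn_ge0// mulr_ile1 ?exprn_ge0// exprn_ile1.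
Qed.

(** Over a common denominator, q(t) = N_t / D. Its values at finite frequencies keep the zeros of
    N_t off the imaginary axis, its value at infinity keeps the degree constant, and N_0 = D is
    Hurwitz. So N_1 is Hurwitz, and D / N_1 is the inverse. *)
Lemma RH_unit_homotopy (q : {poly RH R}) : q`_0 = 1 ->
  (forall t w, 0 <= t <= 1 -> (map_poly (evRH w) q).[t%:C] != 0) ->
  exists g, g * q.[1] = 1.
Proof.
move=> q0 qev; have [D [A [Dh AD]]] := RH_common_denominator (size q) (fun k => q`_k).
have D0 := hurwitzCP_neq0 Dh.
have DF0 : FracField.tofrac D != 0 by rewrite tofrac_eq0.
have sq : (0 < size q)%N.
  by rewrite lt0n; apply/eqP => sq; move: q0; rewrite nth_default ?sq// => /eqP;
    rewrite eq_sym oner_eq0.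
pose e := (size D).-1; have De : size D = e.+1 by rewrite prednK ?size_poly_gt0.
pose N t := \sum_(k < size q) t ^+ k *: A k.
have sN t : (size (N t) <= e.+1)%N.
  apply: leq_trans (size_sum _ _ _) _; apply/bigmax_leqP => k _.
  by rewrite (leq_trans (size_scale_leq _ _))// -De; have [] := AD k (ltn_ord k).
have NE t w : polyval w e (N t) = (map_poly (evRH w) q).[t%:C] * polyval w e D.
  have polyval_sum I (r : seq I) (P : pred I) (F : I -> {poly R}) :
      polyval w e (\sum_(i <- r | P i) F i) = \sum_(i <- r | P i) polyval w e (F i).
    apply: big_morph; first exact: polyvalD.
    by case: w => [r'||]/=; rewrite ?rmorph0 ?horner0 ?coef0.
  rewrite (horner_coef_wide _ (leq_trans (size_poly _ _) (leqnn _))).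
  rewrite polyval_sum mulr_suml; apply: eq_bigr => k _.
  have [sA qE] := AD k (ltn_ord k).
  rewrite polyvalZ coef_map /= /evRH (ev_frac w Dh sA qE) rmorphXn.
  rewrite [X in _ = X * _]mulrC -mulrA divfK//.
  exact: polyval_neq0.
have Nn0 t w : 0 <= t <= 1 -> polyval w e (N t) != 0.
  by move=> t01; rewrite NE mulf_neq0 ?qev ?polyval_neq0.
have A0 : A 0 = D.
  have [_ qE] := AD 0%N sq; apply/eqP; rewrite -tofrac_eq.
  apply/eqP; have h : FracField.tofrac (A 0) = val q`_0 * FracField.tofrac D.
    by rewrite qE; apply: esym; exact: (divfK DF0).
  by rewrite h q0 mul1r.
have B k : exists L : R, 0 <= L /\ forall j, normc (A k)%:CP`_j <= L.
  have [L LP] := normc_coef_bound (A k)%:CP.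
  by exists L; split=> //; apply: le_trans (LP 0%N); exact: normc_ge0.
have [L LP] := choice B.
have Nh : hurwitz (N 1)%:CP.
  apply: (@hurwitz_homotopy _ e (fun t => (N t)%:CP) (\sum_(k < size q) k%:R * L k)).
  - by move=> t; rewrite size_map_poly.
  - move=> t u j t01 u01; rewrite -coefB -rmorphB -sumrB rmorph_sum coef_sum.
    rewrite mulr_suml; apply: le_trans (normc_sum _ _ _) _; apply: ler_sum => k _.
    rewrite /= -scalerBl map_polyZ coefZ normcM normc_real mulrAC.
    apply: ler_pM; rewrite ?normc_ge0//; first exact: distX_le.
    by have [] := LP k.
  - move=> t t01; have := Nn0 t +oo%E t01.
    by rewrite /polyval coef_map.
  - move=> t z t01 z0; have := Nn0 t (complex.Im z)%:E t01.
    by rewrite /polyval -z0; case: z {z0}.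
  - rewrite /N (bigD1 (Ordinal sq))//= expr0 scale1r big1 ?addr0 ?A0// => k.
    by rewrite -val_eqE /= -lt0n => k0; rewrite expr0n gtn_eqF// scale0r.
(* The nonzero value at infinity also makes D / N_1 proper. *)
have DN : (size D <= size (N 1%R))%N.
  have := Nn0 1 +oo%E; rewrite lexx ler01 => /(_ isT); rewrite /polyval fmorph_eq0.
  by rewrite De ltnNge; apply: contra => ?; rewrite nth_default.
have gh : FracField.tofrac D / FracField.tofrac (N 1) \in @rhb R.
  by apply/rhP; exact: (rh_frac Nh DN).
exists (MkRH gh); apply: val_inj; rewrite rmorphM rmorph1 /=.
have NF0 : FracField.tofrac (N 1) != 0 by rewrite tofrac_eq0 hurwitzCP_neq0.
have -> : val q.[1] = FracField.tofrac (N 1) / FracField.tofrac D.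
  rewrite horner_coef rmorph_sum /N rmorph_sum mulr_suml; apply: eq_bigr => k _.
  have [_ qE] := AD k (ltn_ord k).
  by rewrite !expr1n mulr1 scale1r; exact: qE.
have cancel (F : fieldType) (x y : F) : x != 0 -> y != 0 -> x / y * (y / x) = 1.
  by move=> x0 y0; rewrite mulf_div [y * x]mulrC divff// mulf_neq0.
exact: (cancel _ _ _ DF0 NF0).
Qed.

End StableInverse.

Section Pencil.
Variables (A B : comNzRingType) (m : nat).

(** The homotopy parameter stays an indeterminate: the determinant is then a polynomial over the
    stable ring, to which [RH_unit_homotopy] applies. *)
Definition det_pencil (C : comNzRingType) (M : 'M[C]_m) : {poly C} :=
  \det (1%:M + 'X *: map_mx polyC M).

Lemma horner_det_pencil (M : 'M[A]_m) x :
  (det_pencil M).[x] = \det (1%:M + x *: M).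
Proof.
rewrite -[LHS]/(horner_eval x _) -det_map_mx; congr (\det _).
apply/matrixP => i j; rewrite !mxE rmorphD rmorphM rmorphMn rmorph1 /=.
by rewrite /horner_eval hornerX hornerC.
Qed.

Lemma map_det_pencil (f : {rmorphism A -> B}) (M : 'M[A]_m) :
  map_poly f (det_pencil M) = det_pencil (map_mx f M).
Proof.
rewrite /det_pencil -det_map_mx; congr (\det _); apply/matrixP => i j.
by rewrite !mxE rmorphD rmorphM rmorphMn rmorph1 /= map_polyX map_polyC.
Qed.

End Pencil.

Section FeedbackStability.
Variables (R : realType) (m N : nat).
Implicit Types (w : \bar R) (P : 'I_N -> 'M[{fraction {poly R}}]_m).

Lemma map_mx_prod (A B : nzRingType) (f : {rmorphism A -> B}) (Q : 'I_N -> 'M[A]_m) :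
  map_mx f (\prod_(i < N) Q i) = \prod_(i < N) map_mx f (Q i).
Proof. exact: (big_morph _ (@map_mxM _ _ f m m m) (map_mx1 f m)). Qed.

Lemma RHinf_lift_family P : (forall i, RHinf (P i)) ->
  exists Q : 'I_N -> 'M[RH R]_m, P = fun i => map_mx val (Q i).
Proof.
move=> Ph; have /choice[Q QE] : forall i, exists Q : 'M[RH R]_m, P i = map_mx val Q.
  by move=> i; apply: RHinf_lift.
by exists Q; apply/funext.
Qed.

(** Cramer's rule: once the determinant is a unit of the stable ring, the inverse is a stable
    multiple of the adjugate. *)
Lemma feedback_stable_of_det P : (forall i, RHinf (P i)) ->
  (forall t w, 0 <= t <= 1 ->
    \det (1%:M + t%:C *: \prod_(i < N) freqresp (P i) w) != 0) ->
  feedback_stable P.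
Proof.
move=> /RHinf_lift_family[Q ->] Pdet; pose M := \prod_(i < N) Q i.
pose q := det_pencil M.
have qE (h : RH R) : q.[h] = \det (1%:M + h *: M) by exact: horner_det_pencil.
have [||g gq] := @RH_unit_homotopy R q.
- rewrite -horner_coef0 qE scale0r addr0; exact: det1.
- move=> t w /(Pdet _ w); congr (_ != 0).
  rewrite map_det_pencil horner_det_pencil; congr (\det (_ + _ *: _)).
  by rewrite map_mx_prod; apply: eq_bigr => i _; rewrite freqresp_map_val.
rewrite qE scale1r in gq.
pose S := 1%:M + M; pose T := g *: \adj S.
have ST : S *m T = 1%:M.
  by rewrite /T -scalemxAr mul_mx_adj scale_scalar_mx gq.
have SE : 1%:M + \prod_(i < N) map_mx val (Q i) = map_mx val S.
  by rewrite map_mxD map_mx1 map_mx_prod.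
have STv : map_mx val S *m map_mx val T = 1%:M by rewrite -map_mxM ST map_mx1.
have Su := (mulmx1_unit STv).1.
rewrite /feedback_stable SE; split=> //.
have -> : invmx (map_mx val S) = map_mx val T.
  by rewrite -[LHS]mulmx1 -STv mulKmx.
exact: RHinf_map_val.
Qed.

(** The identity between the stable inverse and I + P_1 ... P_N holds over the stable ring, so
    evaluation at [w] transports it to complex matrices. *)
Lemma feedback_stable_ker P w (v : 'cV[R[i]]_m) : (forall i, RHinf (P i)) ->
  feedback_stable P -> (\prod_(i < N) freqresp (P i) w) *m v = - v -> v = 0.
Proof.
move=> /RHinf_lift_family[Q ->] [] + + Pv; pose M := \prod_(i < N) Q i.
have -> : 1%:M + \prod_(i < N) map_mx val (Q i) = map_mx val (1%:M + M).
  by rewrite map_mxD map_mx1 map_mx_prod.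
move=> Su /RHinf_lift[T TE].
have TS : T *m (1%:M + M) = 1%:M.
  pose F : {rmorphism RH R -> {fraction {poly R}}} := val.
  have /matrixP h : map_mx F (T *m (1%:M + M)) = map_mx F 1%:M.
    by rewrite map_mxM map_mx1 -TE mulVmx.
  by apply/matrixP => i j; apply: val_inj; have := h i j; rewrite mxE [RHS]mxE.
have Mv : map_mx (evRH w) M *m v = - v.
  rewrite -Pv map_mx_prod; congr (_ *m _); apply: eq_bigr => i _.
  by rewrite freqresp_map_val.
rewrite -[LHS]mul1mx -(map_mx1 (evRH w)) -TS map_mxM -mulmxA.
by rewrite map_mxD map_mx1 mulmxDl mul1mx Mv subrr mulmx0.
Qed.

End FeedbackStability.

(** * Products of regions *)

Section PolarForm.
Variable R : realType.
Implicit Types (a b t x y : R) (z w : R[i]).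

Lemma expi0 : expi 0 = 1 :> R[i].
Proof. by rewrite /expi cos0 sin0. Qed.

Lemma expiD a b : expi (a + b) = expi a * expi b.
Proof.
rewrite /expi cosD sinD; apply/eqP; rewrite eq_complex /=.
by rewrite eqxx addrC eqxx.
Qed.

Lemma expi_sum (I : Type) (r : seq I) (P : pred I) (F : I -> R) :
  expi (\sum_(i <- r | P i) F i) = \prod_(i <- r | P i) expi (F i).
Proof. exact: (big_morph _ expiD expi0). Qed.

Lemma normc_expi a : normc (expi a) = 1.
Proof. by rewrite /= cos2Dsin2 sqrtr1. Qed.

Lemma normc_polar x a : 0 <= x -> normc (x%:C * expi a) = x.
Proof. by move=> x0; rewrite normcM normc_expi mulr1 normc_ge0_real. Qed.

Lemma Re_polar x a : complex.Re (x%:C * expi a) = x * cos a.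
Proof. by rewrite cReMr. Qed.

Lemma Im_polar x a : complex.Im (x%:C * expi a) = x * sin a.
Proof. by rewrite cImM /= mul0r addr0. Qed.

Lemma le_cos x y : 0 <= x -> x <= y -> y <= pi -> cos y <= cos x.
Proof.
move=> x0 xy ypi; move: (xy); rewrite le_eqVlt => /predU1P[->//|xy'].
by rewrite ltW// ltr_cos// in_itv/= ?x0 ?ypi ?(le_trans x0) ?(le_trans xy).
Qed.

Lemma acos_itv x : -1 <= x <= 1 -> 0 <= acos x <= pi.
Proof. by move=> x1; rewrite acos_ge0 ?acos_lepi. Qed.

Lemma cos_acos x : -1 <= x <= 1 -> cos (acos x) = x.
Proof. by move=> x1; rewrite acosK// in_itv. Qed.

Lemma le_acos x y : -1 <= x -> x <= y -> y <= 1 -> acos y <= acos x.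
Proof.
move=> x1 xy y1; have hx : -1 <= x <= 1 by rewrite x1 (le_trans xy).
have hy : -1 <= y <= 1 by rewrite y1 (le_trans x1).
rewrite leNgt; apply/negP => h.
have /andP[ax ax'] := acos_itv hx; have /andP[ay ay'] := acos_itv hy.
have : cos (acos y) < cos (acos x) by rewrite ltr_cos ?in_itv/= ?ax ?ay.
by rewrite !cos_acos// ltNge xy.
Qed.

Lemma acos_cos_le t : acos (cos t) <= `|t|.
Proof.
rewrite -cos_norm; have [tpi|pit] := leP `|t| pi.
  by rewrite cosK// in_itv/= normr_ge0.
by rewrite (le_trans _ (ltW pit))// acos_lepi// cos_geN1 cos_le1.
Qed.

Lemma Re_div_normc z : -1 <= complex.Re z / normc z <= 1.
Proof.
have [->|z0] := eqVneq z 0; first by rewrite mul0r; apply/andP; lra.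
have nz : 0 < normc z by rewrite normc_gt0.
rewrite ler_pdivlMr// ler_pdivrMr// mulN1r mul1r -ler_norml.
exact: normc_Re.
Qed.

Lemma polar_form z : exists2 a,
  `|a| = acos (complex.Re z / normc z) & z = (normc z)%:C * expi a.
Proof.
have [->|z0] := eqVneq z 0.
  exists (acos (complex.Re 0 / normc 0)); last by rewrite normc0 mul0r.
  by rewrite ger0_norm// acos_ge0// Re_div_normc.
have nz : 0 < normc z by rewrite normc_gt0.
set c := _ / _; have c1 : -1 <= c <= 1 by exact: Re_div_normc.
have /andP[a0 api] := acos_itv c1.
have sE : normc z * Num.sqrt (1 - c ^+ 2) = `|complex.Im z|.
  rewrite -[X in X * _](ger0_norm (ltW nz)) -sqrtr_sqr -sqrtrM ?sqr_ge0//.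
  rewrite -sqrtr_sqr; congr Num.sqrt; rewrite /c mulrBr mulr1 exprMn exprVn.
  rewrite mulrCA divff ?mulr1 ?expf_neq0 ?gt_eqF// sqr_normcE; ring.
have rE : complex.Re z = normc z * c by rewrite /c mulrC divfK ?gt_eqF.
have [im|im] := leP 0 (complex.Im z).
  exists (acos c); first by rewrite ger0_norm.
  apply/eqP; rewrite eq_complex Re_polar Im_polar cos_acos// sin_acos//.
  by rewrite rE eqxx/= sE ger0_norm.
exists (- acos c); first by rewrite normrN ger0_norm.
apply/eqP; rewrite eq_complex Re_polar Im_polar cosN sinN cos_acos// sin_acos//.
by rewrite rE eqxx/= mulrN sE ltr0_norm// opprK.
Qed.

End PolarForm.

Section Region.
Variable R : realType.
Implicit Types (r u s : R) (z w : R[i]).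

(* For A = gamma / (1 + sin beta) and s = sin beta this is the region: the union of
   the discs with centre u and radius u s, for u in [0, A]. *)
Definition cone A s : set R[i] :=
  [set z | exists2 u, 0 <= u <= A & normc (z - u%:C) ^+ 2 <= (u * s) ^+ 2].

Variables (beta gamma : R).
Hypotheses (beta_bounds : 0 <= beta <= pi / 2) (gamma_gt0 : 0 < gamma).

Let s := sin beta.
Let A := gamma / (1 + s).

Let pi2_gt0 : 0 < pi / 2 :> R.
Proof. by rewrite divr_gt0 ?pi_gt0. Qed.

Lemma sin_beta_bounds : 0 <= s <= 1.
Proof.
rewrite sin_le1 andbT sin_ge0_pi//; case/andP: beta_bounds => -> h /=.
by have := pi2_gt0; lra.
Qed.

Lemma region_radius_gt0 : 0 < A.
Proof. by rewrite divr_gt0//; have /andP[] := sin_beta_bounds; lra. Qed.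

Let cos_beta_ge0 : 0 <= cos beta.
Proof.
apply: cos_ge0_pihalf; case/andP: beta_bounds => b0 ->; rewrite andbT.
by rewrite (le_trans _ b0)// oppr_le0 ltW.
Qed.

Lemma cos_region delta : - beta <= delta <= beta -> cos beta <= cos delta.
Proof.
rewrite -ler_norml => db; rewrite -[cos delta]cos_norm; apply: le_cos => //.
by case/andP: beta_bounds => _ h; have := pi2_gt0; lra.
Qed.

Lemma sin_region delta : - beta <= delta <= beta -> sin delta ^+ 2 <= s ^+ 2.
Proof.
move=> /cos_region h; rewrite /s !sin2cos2 lerD2l lerN2.
by rewrite ler_pXn2r// nnegrE (le_trans _ h).
Qed.

(** The ray of argument delta leaves the disc of centre u and radius u s at distance u (cos delta +
    sqrt (s^2 - sin^2 delta)) from the origin; this is the bound in [region], with u at most A. *)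
Lemma region_cone z : region beta gamma z <-> cone A s z.
Proof.
have /andP[s0 s1] := sin_beta_bounds; have A0 := region_radius_gt0.
split=> [[r [d [db /andP[r0 rm] ->]]]|[u /andP[u0 uA]]].
  rewrite -/A -/s in rm; set q := Num.sqrt _ in rm.
  have cd : 0 <= cos d by rewrite (le_trans _ (cos_region db)).
  have q2 : q ^+ 2 = s ^+ 2 - sin d ^+ 2.
    by rewrite sqr_sqrtr// subr_ge0 sin_region.
  have q0 : 0 <= q by rewrite sqrtr_ge0.
  (* Vanishing requires cos d = 0, hence beta = pi / 2; the ray then touches the disc only at the
     origin. *)
  have [c0|c0] := eqVneq (cos d + q) 0.
    have -> : r = 0 by apply/le_anti; rewrite r0 -(mulr0 A) -c0 rm.
    exists 0; first by rewrite lexx ltW.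
    by rewrite rmorph0 !mul0r subr0 normc0.
  have {c0}cq0 : 0 < cos d + q by rewrite lt_def c0 addr_ge0.
  pose u := r / (cos d + q).
  have ru : r = u * (cos d + q) by rewrite /u divfK ?gt_eqF.
  have u0 : 0 <= u by rewrite divr_ge0// ltW.
  exists u; first by rewrite u0 /= /u ler_pdivrMr.
  rewrite sqr_normcE cReB Re_polar -[X in _ + X ^+ 2]/(complex.Im (_ - _)).
  have -> : complex.Im (r%:C * expi d - u%:C) = r * sin d.
    by rewrite -(Im_polar r d); case: (_ * _) => ? ? /=; rewrite subr0.
  rewrite /= ru.
  have -> : (u * (cos d + q) * cos d - u) ^+ 2 + (u * (cos d + q) * sin d) ^+ 2
      = u ^+ 2 * ((cos d + q) ^+ 2 * (cos d ^+ 2 + sin d ^+ 2)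
                  - 2 * (cos d + q) * cos d + 1) by ring.
  rewrite cos2Dsin2 mulr1.
  have -> : (cos d + q) ^+ 2 - 2 * (cos d + q) * cos d + 1 = s ^+ 2.
    by have := cos2Dsin2 d; move: q2; lra.
  by rewrite [(u * s) ^+ 2]exprMn.
move=> uz; have [z0|z0] := eqVneq z 0.
  exists 0, 0; rewrite oppr_le0 z0 mul0r lexx /= cos0 sin0 expr0n subr0.
  have /andP[-> _] := beta_bounds; split=> //=.
  by rewrite mulr_ge0 ?(ltW A0)// addr_ge0// ?ler01// sqrtr_ge0.
have [d dE zE] := polar_form z; set r := normc z in zE.
have r0 : 0 < r by rewrite normc_gt0.
have uz' : r ^+ 2 - 2 * u * (r * cos d) + u ^+ 2 * (1 - s ^+ 2) <= 0.
  move: uz; rewrite sqr_normcE cReB zE Re_polar.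
  have -> : complex.Im (r%:C * expi d - u%:C) = r * sin d.
    by rewrite -(Im_polar r d); case: (_ * _) => ? ? /=; rewrite subr0.
  by have := cos2Dsin2 d; rewrite /=; nra.
have cd0 : 0 < cos d.
  rewrite ltNge; apply/negP => cd0.
  have h1 : 0 <= u * r * - cos d by rewrite mulr_ge0 ?mulr_ge0 ?oppr_ge0 ?(ltW r0).
  have h2 : 0 <= u ^+ 2 * (1 - s ^+ 2).
    by rewrite mulr_ge0 ?sqr_ge0// subr_ge0 expr_le1.
  have h3 : 0 < r ^+ 2 by rewrite exprn_gt0.
  lra.
have dpi : `|d| <= pi by rewrite dE acos_lepi// Re_div_normc.
have dpi2 : `|d| <= pi / 2.
  rewrite leNgt; apply/negP => h.
  have : cos `|d| <= cos (pi / 2) by apply: le_cos => //; apply: ltW.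
  by rewrite cos_norm cos_pihalf leNgt cd0.
have u0' : 0 < u.
  rewrite lt_def u0 andbT; apply/eqP => ue.
  by move: uz'; rewrite ue; have : 0 < r ^+ 2 by [rewrite exprn_gt0]; lra.
(* Completing the square in the disc condition yields both the bound on |sin d| and the one on
   [r]. *)
have key : (r - u * cos d) ^+ 2 <= u ^+ 2 * (s ^+ 2 - sin d ^+ 2).
  rewrite sin2cos2; nra.
have D0 : 0 <= s ^+ 2 - sin d ^+ 2.
  by have := le_trans (sqr_ge0 _) key; rewrite pmulr_rge0 ?exprn_gt0.
have sd : sin `|d| <= s.
  rewrite -(ler_pXn2r (n := 2)) ?nnegrE//; last first.
    by rewrite sin_ge0_pi// normr_ge0.
  by move: D0; rewrite subr_ge0; case: (ler0P d) => _; rewrite ?sinN ?sqrrN.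
exists r, d; split=> //.
- rewrite -ler_norml leNgt; apply/negP => h.
  suff : s < sin `|d| by rewrite ltNge sd.
  have /andP[b0 b1] := beta_bounds.
  have ? := pi2_gt0; have ? := normr_ge0 d.
  by rewrite /s ltr_sin// in_itv/= ?b1 ?dpi2 andbT; lra.
- rewrite ltW//= -/s -/A; set q := Num.sqrt _.
  have q0 : 0 <= q by rewrite sqrtr_ge0.
  have q2 : q ^+ 2 = s ^+ 2 - sin d ^+ 2 by rewrite sqr_sqrtr.
  have : r <= u * (cos d + q).
    rewrite mulrDr -lerBlDl.
    have [h|h] := leP (r - u * cos d) 0; first by rewrite (le_trans h)// mulr_ge0.
    rewrite -(ler_pXn2r (n := 2)) ?nnegrE ?(ltW h) ?mulr_ge0//.
    by rewrite exprMn q2.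
  by move=> /le_trans; apply; rewrite ler_wpM2r// (addr_ge0 (ltW cd0) q0).
Qed.

(** The radial bound decreases as |delta| grows, so a region contains, with a point, all points of
    smaller modulus and smaller absolute argument. *)
Lemma region_arc z : region beta gamma z -> exists d,
  [/\ `|d| <= pi / 2, z = (normc z)%:C * expi d &
   forall r d', 0 <= r <= normc z -> `|d'| <= `|d| ->
     region beta gamma (r%:C * expi d')].
Proof.
move=> [r [d [db /andP[r0 rm] ->]]]; exists d; rewrite normc_polar//.
have b1 : beta <= pi / 2 by case/andP: beta_bounds.
have dpi2 : `|d| <= pi / 2 by rewrite (le_trans _ b1)// ler_norml.
split=> // r' d' /andP[r'0 r'r] dd; exists r', d'; split=> //.
  by rewrite -ler_norml (le_trans dd)// ler_norml.
have cd : cos d <= cos d'.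
  rewrite -(cos_norm d) -(cos_norm d'); apply: le_cos => //.
  by have := pi2_gt0; lra.
have cd0 : 0 <= cos d by rewrite (le_trans _ (cos_region db)).
rewrite r'0 (le_trans r'r)// (le_trans rm)//= ler_wpM2l ?(ltW region_radius_gt0)//.
rewrite lerD// ler_wsqrtr// lerD2l lerN2 !sin2cos2 lerD2l lerN2.
by rewrite ler_pXn2r// nnegrE (le_trans cd0).
Qed.

End Region.

Section RegionProducts.
Variables (R : realType) (N : nat) (D : pred 'I_N) (beta gamma : 'I_N -> R).
Hypotheses (beta_bounds : forall i, D i -> 0 <= beta i <= pi / 2)
  (gamma_gt0 : forall i, D i -> 0 < gamma i).
Variables (i0 : 'I_N) (D_i0 : D i0).

Let S := prod_set D (fun i => region (beta i) (gamma i)).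

(* Rotating each factor proportionally to its own argument keeps it in its
   region. *)
Lemma prod_set_arc (z : 'I_N -> R[i]) :
  (forall i, D i -> region (beta i) (gamma i) (z i)) ->
  exists d : 'I_N -> R,
    [/\ forall i, D i -> `|d i| <= pi / 2,
        forall i, D i -> z i = (normc (z i))%:C * expi (d i) &
        forall r e, 0 <= r <= \prod_(i | D i) normc (z i) ->
          `|e| <= \sum_(i | D i) `|d i| -> S (r%:C * expi e)].
Proof.
move=> zR.
have /choice[d dP] : forall i, exists d, D i ->
    [/\ `|d| <= pi / 2, z i = (normc (z i))%:C * expi d &
     forall r d', 0 <= r <= normc (z i) -> `|d'| <= `|d| ->
       region (beta i) (gamma i) (r%:C * expi d')].
  move=> i; case: (boolP (D i)) => [Di|]; last by exists 0.
  have [d ?] := region_arc (beta_bounds Di) (gamma_gt0 Di) (zR i Di).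
  by exists d.
exists d; split=> [i /dP[]//|i /dP[]//|r e /andP[r0 rp] es].
set p := \prod_(i | D i) _ in rp; set s := \sum_(i | D i) _ in es.
have s0 : 0 <= s by rewrite sumr_ge0.
have p0 : 0 <= p by rewrite prodr_ge0// => i _; rewrite normc_ge0.
(* All arguments are scaled by the common ratio [l]. If s = 0, then e = 0 and the quotient is 0 by
   convention, as wanted. *)
pose l := e / s; have els : e = l * s.
  have [s00|s00] := eqVneq s 0; last by rewrite divfK.
  by apply/eqP; rewrite s00 mulr0 -normr_le0 -s00.
have l1 : `|l| <= 1.
  have [s00|s00] := eqVneq s 0; first by rewrite /l s00 invr0 mulr0 normr0.
  by rewrite normrM normfV (ger0_norm s0) ler_pdivrMr ?mul1r// lt_def s00.
pose c := r / p; have rcp : r = c * p.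
  have [p00|p00] := eqVneq p 0; last by rewrite divfK.
  by apply/eqP; rewrite p00 mulr0 eq_le r0 -p00 rp.
have c01 : 0 <= c <= 1.
  rewrite divr_ge0//=; have [p00|p00] := eqVneq p 0.
    by rewrite /c p00 invr0 mulr0 ler01.
  by rewrite ler_pdivrMr ?mul1r// lt_def p00.
(* The whole decrease of the modulus is charged to the factor [i0]. *)
pose k i := if i == i0 then c else 1.
have k01 i : 0 <= k i <= 1 by rewrite /k; case: ifP; rewrite ?ler01 ?lexx.
exists (fun i => (k i * normc (z i))%:C * expi (l * `|d i|)) => [i Di|].
  have [_ _ h] := dP i Di; have /andP[k0 k1] := k01 i.
  apply: h; first by rewrite mulr_ge0 ?normc_ge0//= ler_piMl ?normc_ge0.
  by rewrite normrM normr_id ler_piMl.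
rewrite big_split /= -expi_sum -rmorph_prod big_split /=.
have -> : \prod_(i | D i) k i = c.
  rewrite (bigD1 i0)//= {1}/k eqxx big1 ?mulr1// => i /andP[_ ii0].
  by rewrite /k (negPf ii0).
by rewrite -mulr_sumr -els -rcp.
Qed.

(** The second inequality compares the cosines of the arguments, denominators cleared. The argument
    of [w] in [0, pi] is at most the sum of the absolute arguments of its factors, so [prod_set_arc]
    reaches [w']. *)
Lemma prod_set_mono (w w' : R[i]) : S w -> normc w' <= normc w ->
  complex.Re w * normc w' <= complex.Re w' * normc w -> S w'.
Proof.
move=> [z zR <-] w'w Rew; set w0 := \prod_(i | D i) z i in w'w Rew.
have [d [_ zE arc]] := prod_set_arc zR.
have nw : normc w0 = \prod_(i | D i) normc (z i) by rewrite normc_prod.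
have wE : w0 = (normc w0)%:C * expi (\sum_(i | D i) d i).
  rewrite nw rmorph_prod expi_sum -big_split /=; exact: eq_bigr.
have [->|w'0] := eqVneq w' 0.
  rewrite -(mul0r (expi 0)) -(rmorph0 (real_complex R)); apply: arc.
    by rewrite lexx -nw normc_ge0.
  by rewrite normr0 sumr_ge0.
have nw' : 0 < normc w' by rewrite normc_gt0.
have nw0 : 0 < normc w0 by exact: lt_le_trans w'w.
have [a aE ->] := polar_form w'; apply: arc; first by rewrite normc_ge0 -nw.
apply: le_trans (ler_norm_sum _ _ _); apply: le_trans (acos_cos_le _).
have -> : cos (\sum_(i | D i) d i) = complex.Re w0 / normc w0.
  by rewrite [in RHS]wE Re_polar normc_polar ?normc_ge0// mulrC mulKf ?gt_eqF.
have /andP[h1 _] := Re_div_normc w0; have /andP[_ h2] := Re_div_normc w'.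
rewrite aE le_acos// ler_pdivrMr// mulrAC ler_pdivlMr//.
Qed.

End RegionProducts.

(** * Angles along a feedback loop *)

(** The Euclidean inner product of C^m seen as R^(2m). The angles of the scaled graph are angles for
    it; the locking prevents unfolding. *)
HB.lock Definition ip (R : realType) m (x y : 'cV[R[i]]_m) : R :=
  complex.Re (inner x y).

HB.lock Definition ang (R : realType) m (x y : 'cV[R[i]]_m) : R :=
  acos (ip x y / (enorm x * enorm y)).

Section RealInnerProduct.
Variables (R : realType) (m : nat).
Implicit Types (x y z : 'cV[R[i]]_m) (a b : R).

Lemma innerE x y : inner x y = \sum_i (x i 0)^*%C * y i 0.
Proof. by rewrite /inner !mxE; apply: eq_bigr => i _; rewrite !mxE. Qed.

Lemma Re_inner x y : complex.Re (inner x y) = ip x y.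
Proof. by rewrite ip.unlock. Qed.

Lemma ipE x y : ip x y = \sum_i (complex.Re (x i 0) * complex.Re (y i 0)
                               + complex.Im (x i 0) * complex.Im (y i 0)).
Proof.
rewrite -Re_inner innerE cRe_sum; apply: eq_bigr => i _; rewrite cReM.
by case: (x i 0) => p q /=; rewrite mulNr opprK.
Qed.

Lemma ipC x y : ip x y = ip y x.
Proof. by rewrite !ipE; apply: eq_bigr => i _; ring. Qed.

Lemma ipDr x y z : ip x (y + z) = ip x y + ip x z.
Proof.
rewrite !ipE -big_split; apply: eq_bigr => i _; rewrite mxE.
by case: (y i 0) (z i 0) => [? ?] [? ?] /=; ring.
Qed.

Lemma ipZr a x y : ip x (a%:C *: y) = a * ip x y.
Proof.
rewrite !ipE mulr_sumr; apply: eq_bigr => i _; rewrite mxE.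
by case: (y i 0) => [? ?] /=; ring.
Qed.

Lemma ipDl x y z : ip (y + z) x = ip y x + ip z x.
Proof. by rewrite ipC ipDr !(ipC x). Qed.

Lemma ipZl a x y : ip (a%:C *: y) x = a * ip y x.
Proof. by rewrite ipC ipZr (ipC x). Qed.

Lemma ipNr x y : ip x (- y) = - ip x y.
Proof. by rewrite -scaleN1r -(rmorph1 (real_complex R)) -rmorphN ipZr mulN1r. Qed.

Lemma ipNl x y : ip (- x) y = - ip x y.
Proof. by rewrite ipC ipNr ipC. Qed.

Lemma ip_ge0 x : 0 <= ip x x.
Proof. by rewrite ipE sumr_ge0// => i _; rewrite addr_ge0// -expr2 sqr_ge0. Qed.

Lemma ip_eq0 x : (ip x x == 0) = (x == 0).
Proof.
apply/eqP/eqP => [|->]; last first.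
  by rewrite ipE big1// => i _; rewrite !mxE /= !mul0r addr0.
rewrite ipE => /eqP; rewrite psumr_eq0 => [/allP h|i _]; last first.
  by rewrite addr_ge0// -expr2 sqr_ge0.
apply/matrixP => i j; rewrite (ord1 j) mxE.
have := h i (mem_index_enum i); rewrite paddr_eq0 -?expr2 ?sqr_ge0//.
rewrite !sqrf_eq0; case: (x i 0) => p q /=.
by case/andP => /eqP -> /eqP ->.
Qed.

Lemma sqr_enorm x : enorm x ^+ 2 = ip x x.
Proof. by rewrite sqr_sqrtr Re_inner ?ip_ge0. Qed.

Lemma enorm_ge0 x : 0 <= enorm x.
Proof. exact: sqrtr_ge0. Qed.

Lemma enorm_eq0 x : (enorm x == 0) = (x == 0).
Proof. by rewrite -sqrf_eq0 sqr_enorm ip_eq0. Qed.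

Lemma enorm_gt0 x : (0 < enorm x) = (x != 0).
Proof. by rewrite lt_def enorm_ge0 andbT enorm_eq0. Qed.

Lemma enormZ a x : enorm (a%:C *: x) = `|a| * enorm x.
Proof.
apply/eqP; rewrite -(eqrXn2 (n := 2)) ?mulr_ge0 ?enorm_ge0//.
by rewrite exprMn !sqr_enorm ipZl ipZr mulrA real_normK ?num_real// expr2.
Qed.

Lemma enormN x : enorm (- x) = enorm x.
Proof. by rewrite /enorm !Re_inner ipNl ipNr opprK. Qed.

Lemma cauchy_schwarz x y : ip x y ^+ 2 <= ip x x * ip y y.
Proof.
have [y0|y0] := eqVneq (ip y y) 0.
  have /eqP -> : y == 0 by rewrite -ip_eq0 y0.
  have -> : ip x 0 = 0 by rewrite ipE big1// => i _; rewrite !mxE /= !mulr0 addr0.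
  by rewrite expr0n mulr_ge0 ?ip_ge0.
have {}y0 : 0 < ip y y by rewrite lt_def y0 ip_ge0.
have := ip_ge0 ((ip y y)%:C *: x + (- ip x y)%:C *: y).
rewrite !ipDl !ipDr !ipZl !ipZr (ipC y x).
have -> : ip y y * (ip y y * ip x x) + ip y y * (- ip x y * ip x y)
  + (- ip x y * (ip y y * ip x y) + - ip x y * (- ip x y * ip y y))
  = ip y y * (ip x x * ip y y - ip x y ^+ 2) by ring.
by rewrite pmulr_rge0// subr_ge0.
Qed.

Lemma ip_le_enorm x y : `|ip x y| <= enorm x * enorm y.
Proof.
rewrite -(ler_pXn2r (n := 2)) ?nnegrE ?mulr_ge0 ?enorm_ge0//.
by rewrite real_normK ?num_real// exprMn !sqr_enorm cauchy_schwarz.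
Qed.

Lemma innerZr (c : R[i]) x y : inner x (c *: y) = c * inner x y.
Proof.
by rewrite !innerE mulr_sumr; apply: eq_bigr => i _; rewrite mxE mulrCA.
Qed.

Lemma innerZl (c : R[i]) x y : inner (c *: x) y = c^* * inner x y.
Proof.
by rewrite !innerE mulr_sumr; apply: eq_bigr => i _; rewrite mxE rmorphM mulrA.
Qed.

Lemma enormZC (c : R[i]) x : enorm (c *: x) = normc c * enorm x.
Proof.
apply/eqP; rewrite -(eqrXn2 (n := 2)) ?mulr_ge0 ?enorm_ge0 ?normc_ge0//.
rewrite exprMn !sqr_enorm -Re_inner innerZr innerZl mulrA mulc_conj.
by rewrite cReMr Re_inner.
Qed.

(** A rotation of [y] makes the inner product real, and the real inequality applies. *)
Lemma normc_inner_le x y : normc (inner x y) <= enorm x * enorm y.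
Proof.
have [a _ cE] := polar_form (inner x y).
have : `|ip x (expi (- a) *: y)| <= enorm x * enorm y.
  by apply: le_trans (ip_le_enorm _ _) _; rewrite enormZC normc_expi mul1r.
have -> : ip x (expi (- a) *: y) = normc (inner x y).
  by rewrite -Re_inner innerZr [in LHS]cE mulrCA -expiD addNr expi0 mulr1.
by rewrite ger0_norm ?normc_ge0.
Qed.

Lemma angE x y : ang x y = acos (ip x y / (enorm x * enorm y)).
Proof. by rewrite ang.unlock. Qed.

Lemma ip_div_itv x y : -1 <= ip x y / (enorm x * enorm y) <= 1.
Proof.
have [e0|e0] := eqVneq (enorm x * enorm y) 0.
  by rewrite e0 invr0 mulr0; apply/andP; lra.
have {}e0 : 0 < enorm x * enorm y by rewrite lt_def e0 mulr_ge0 ?enorm_ge0.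
rewrite ler_pdivlMr// ler_pdivrMr// mulN1r mul1r -ler_norml.
exact: ip_le_enorm.
Qed.

Lemma ang_itv x y : 0 <= ang x y <= pi.
Proof. by rewrite angE; apply: acos_itv; exact: ip_div_itv. Qed.

Lemma cos_ang x y : cos (ang x y) = ip x y / (enorm x * enorm y).
Proof. by rewrite angE cos_acos// ip_div_itv. Qed.

Lemma angC x y : ang x y = ang y x.
Proof. by rewrite !angE ipC [enorm x * _]mulrC. Qed.

Lemma angNN x y : ang (- x) (- y) = ang x y.
Proof. by rewrite !angE ipNl ipNr opprK !enormN. Qed.

Lemma angZl a x y : 0 < a -> ang (a%:C *: x) y = ang x y.
Proof.
move=> a0; rewrite !angE ipZl enormZ gtr0_norm//; congr acos.
by rewrite -[a * _ * enorm y]mulrA -mulf_div divff ?gt_eqF// mul1r.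
Qed.

Lemma ang_refl x : x != 0 -> ang x x = 0.
Proof.
by move=> x0; rewrite !angE -expr2 sqr_enorm divff ?ip_eq0// acos1.
Qed.

(** Cauchy-Schwarz for the components of [x] and [z] orthogonal to [y]; equivalently, the Gram
    determinant of three unit vectors is nonnegative. *)
Lemma gram_unit x y z : ip x x = 1 -> ip y y = 1 -> ip z z = 1 ->
  (ip x z - ip x y * ip y z) ^+ 2 <= (1 - ip x y ^+ 2) * (1 - ip y z ^+ 2).
Proof.
move=> x1 y1 z1.
have := cauchy_schwarz (x + (- ip x y)%:C *: y) (z + (- ip y z)%:C *: y).
rewrite !ipDl !ipDr !ipZl !ipZr x1 y1 z1 (ipC y x) (ipC z y).
by apply: etrans; congr (_ <= _); ring.
Qed.

(** [gram_unit] bounds the cosine of the angle from [x] to [z] below by the cosine of the sum of the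
    other two, which settles the case of a sum at most pi; otherwise the claim is trivial. *)
Lemma ang_triangle x y z : x != 0 -> y != 0 -> z != 0 ->
  ang x z <= ang x y + ang y z.
Proof.
rewrite -!enorm_gt0 => x0 y0 z0.
pose u (v : 'cV[R[i]]_m) := ((enorm v)^-1)%:C *: v.
have uu v : 0 < enorm v -> ip (u v) (u v) = 1.
  move=> v0; rewrite ipZl ipZr -sqr_enorm mulrA -expr2 -exprMn mulVf ?gt_eqF//.
  by rewrite expr1n.
have uE v w : ip v w / (enorm v * enorm w) = ip (u v) (u w).
  by rewrite ipZl ipZr invfM; ring.
have /andP[a0 api] := ang_itv x y; have /andP[b0 bpi] := ang_itv y z.
have := cos_acos (ip_div_itv x y); have := cos_acos (ip_div_itv y z).
have := sin_acos (ip_div_itv x y); have := sin_acos (ip_div_itv y z).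
have /andP[c1 c2] := ip_div_itv x z.
have /andP[p1 p2] := ip_div_itv x y; have /andP[q1 q2] := ip_div_itv y z.
rewrite -!angE.
set p := ip x y / _ in p1 p2 *; set q := ip y z / _ in q1 q2 *.
set c := ip x z / _ in c1 c2 *.
move=> sb sa cb ca.
have [abpi|piab] := leP (ang x y + ang y z) pi; last first.
  by rewrite (le_trans _ (ltW piab))//; case/andP: (ang_itv x z).
have gram : (c - p * q) ^+ 2 <= (1 - p ^+ 2) * (1 - q ^+ 2).
  by rewrite /p /q /c !uE gram_unit ?uu.
suff /le_acos h : cos (ang x y + ang y z) <= c.
  rewrite {1}angE; apply: le_trans (h _ _) _; rewrite ?cos_geN1//.
  by rewrite cosK// in_itv/= abpi addr_ge0.
have p2' : 0 <= 1 - p ^+ 2 by nra.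
have q2' : 0 <= 1 - q ^+ 2 by nra.
rewrite cosD ca cb sa sb -sqrtrM// lerBlDr -lerBlDl.
have [h|h] := leP (p * q - c) 0; first by rewrite (le_trans h)// sqrtr_ge0.
by rewrite -(ger0_norm (ltW h)) -sqrtr_sqr ler_wsqrtr// -[X in X ^+ 2]opprB sqrrN.
Qed.

Lemma angle_ang t x y : x != 0 -> y != 0 ->
  angle t x y = ang x (expi (- t) *: y).
Proof.
move=> x0 y0; rewrite /angle (negPf x0) (negPf y0) !angE.
by rewrite enormZC normc_expi mul1r Re_inner.
Qed.

Lemma enormE x : enorm x = Num.sqrt (ip x x).
Proof. by rewrite /enorm Re_inner. Qed.

End RealInnerProduct.

Local Opaque enorm.

Section Chains.
Variables (K : comNzRingType) (m : nat).

(** The signals are numbered against the flow: [V N] enters the cascade, and factor i turns [V i.+1]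
    into [V i]. *)
Lemma prod_chain N (C : 'I_N -> 'M[K]_m) (v : 'cV[K]_m) :
  exists V : nat -> 'cV[K]_m, [/\ V N = v, V 0%N = (\prod_(i < N) C i) *m v &
    forall i : 'I_N, V i = C i *m V i.+1].
Proof.
elim: N C => [|N IH] C; first by exists (fun=> v); rewrite big_ord0 mul1mx; split=> // -[].
have [V [VN V0 VS]] := IH (fun i => C (lift ord0 i)).
exists (fun i => if i is j.+1 then V j else C ord0 *m V 0%N); split=> //.
  by rewrite big_ord_recl -mulmxA -V0.
by move=> i; case: (unliftP ord0 i) => [j|] -> //=; exact: VS.
Qed.

Lemma chain_prod N (C : 'I_N -> 'M[K]_m) (V : nat -> 'cV[K]_m) :
  (forall i : 'I_N, V i = C i *m V i.+1) -> (\prod_(i < N) C i) *m V N = V 0%N.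
Proof.
elim: N C V => [|N IH] C V VS; first by rewrite big_ord0 mul1mx.
rewrite big_ord_recl -mulmxA (IH _ (fun i => V i.+1)) => [|i]; last exact: (VS (lift ord0 i)).
exact/esym/(VS ord0).
Qed.

End Chains.

(** * Sufficiency of the graph condition *)

Section Sufficiency.
Variable R : realType.

Lemma telescope_prod_div (f : nat -> R) N : (forall i, (i <= N)%N -> f i != 0) ->
  \prod_(i < N) (f i / f i.+1) = f 0%N / f N.
Proof.
elim: N => [|N IH] f0; first by rewrite big_ord0 divff// f0.
rewrite big_ord_recr/= IH => [|i iN]; last by rewrite f0// (leq_trans iN).
by rewrite mulrA divfK// f0.
Qed.

Lemma sum_ord_neq N (k : 'I_N) (f : nat -> R) : \sum_(i < N | i != k) f i
  = \sum_(0 <= i < k) f i + \sum_(k.+1 <= i < N) f i.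
Proof.
have kN := ltn_ord k.
have : \sum_(0 <= i < N) f i
    = \sum_(0 <= i < k) f i + (f k + \sum_(k.+1 <= i < N) f i).
  by rewrite (big_cat_nat (leq0n k) (ltnW kN))//= (big_ltn kN).
by rewrite big_mkord (bigD1 k)//=; lra.
Qed.

(* Since |Im (e^(-jt) c)| <= sin a, the value Re c lies between cos (t + a) and
   cos (t - a). *)
Lemma opposite_phase (c : R[i]) (t D : R) : normc c <= 1 ->
  acos (- complex.Re c) <= D ->
  let a := acos (complex.Re (expi (- t) * c)) in
  exists2 e, `|e| <= D &
    expi (t + a) * expi e = -1 \/ expi (t - a) * expi e = -1.
Proof.
move=> c1 cD a; set w := expi (- t) * c.
have w1 : normc w <= 1 by rewrite normcM normc_expi mul1r.
have cE : c = expi t * w by rewrite mulrA -expiD subrr expi0 mul1r.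
have Rw : -1 <= complex.Re w <= 1.
  by rewrite -ler_norml (le_trans (normc_Re w)).
have Rc : -1 <= complex.Re c <= 1.
  by rewrite -ler_norml (le_trans (normc_Re c)).
have ca : cos a = complex.Re w by rewrite cos_acos.
have sa : sin a = Num.sqrt (1 - complex.Re w ^+ 2) by rewrite sin_acos.
have iw : `|complex.Im w| <= sin a.
  rewrite sa -sqrtr_sqr ler_wsqrtr//.
  have := sqr_normcE w; have : normc w ^+ 2 <= 1 by rewrite expr_le1 ?normc_ge0.
  lra.
have Rec : complex.Re c = cos t * cos a - sin t * complex.Im w.
  by rewrite [in LHS]cE cReM /= ca.
(* The witness is the argument of - expi (- s) in (-pi, pi]; its absolute value is arccos (- cos s),
   at most arccos (- Re c) because cos s <= Re c. *)
have close s : cos s <= complex.Re c ->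
    exists2 e, `|e| <= D & expi s * expi e = -1.
  move=> sc; have [e eE zE] := polar_form (- expi (- s)).
  have n1 : normc (- expi (- s)) = 1 by rewrite normcN normc_expi.
  exists e.
    rewrite eE n1 divr1; apply: le_trans cD; rewrite cReN /= cosN.
    by have ? := cos_geN1 s; apply: le_acos; lra.
  have -> : expi e = - expi (- s) by rewrite [RHS]zE n1; exact/esym/mul1r.
  rewrite mulrN -expiD subrr expi0; exact: erefl.
move: iw; rewrite ler_norml => /andP[iw1 iw2].
have [st|st] := leP 0 (sin t).
  have [|e eD ee] := close (t + a); last by exists e => //; left.
  by rewrite cosD Rec lerD2l lerN2 ler_wpM2l.
have [|e eD ee] := close (t - a); last by exists e => //; right.
rewrite cosB Rec lerD2l -mulrN ler_wnM2l ?(ltW st)//; lra.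
Qed.

(* By the triangle inequality for angles, the angles of the factors other than
   [C k] add up to at least the angle between [C k u] and [- u], where [u] is the
   input of [C k]. The factor [t] is absorbed by decreasing a modulus in the
   product set. *)
Lemma SRG_of_ker m N (k i0 : 'I_N) (beta gamma : 'I_N -> R)
    (C : 'I_N -> 'M[R[i]]_m) (v : 'cV[R[i]]_m) (t theta : R) :
  i0 != k ->
  (forall i, i != k -> 0 <= beta i <= pi / 2) ->
  (forall i, i != k -> 0 < gamma i) ->
  (forall i, i != k -> SRG 0 (C i) `<=` region (beta i) (gamma i)) ->
  0 <= t <= 1 -> v != 0 -> v + t%:C *: ((\prod_(i < N) C i) *m v) = 0 ->
  mul_set (SRG theta (C k))
    (prod_set (fun i => i != k) (fun i => region (beta i) (gamma i))) (-1).
Proof.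
move=> i0k bb gg CR /andP[t0 t1] v0 vt.
have [V [VN V0 VS]] := prod_chain C v.
have {}vt : V N = - (t%:C *: V 0%N) by rewrite VN V0; apply/eqP; rewrite -addr_eq0 vt.
have {}t0 : 0 < t.
  rewrite lt_def t0 andbT; apply: contra_neq v0 => t00.
  by rewrite -VN vt t00 rmorph0 scale0r oppr0.
have Vn0 i : (i <= N)%N -> V i != 0.
  move=> iN; apply: contra_neq v0 => Vi; suff : V 0%N = 0.
    by rewrite -VN vt => ->; rewrite scaler0 oppr0.
  elim: i iN Vi => // i IH iN Vi; apply: IH; first exact: ltnW.
  by rewrite (VS (Ordinal iN)) /= Vi mulmx0.
pose f i := enorm (V i).
have f0 i : (i <= N)%N -> 0 < f i by move=> /Vn0; rewrite enorm_gt0.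
pose g i := ang (V i.+1) (V i).
pose z (i : 'I_N) : R[i] := (f i / f i.+1)%:C * expi (g i).
have fpos (i : 'I_N) : 0 < f i / f i.+1 by rewrite divr_gt0 ?f0// ltnW.
have zR i : i != k -> region (beta i) (gamma i) (z i).
  move=> ik; apply: (CR i ik); exists (V i.+1); rewrite ?Vn0//= -VS; left.
  rewrite add0r angle_ang ?Vn0// ?(ltnW (ltn_ord i))//.
  by rewrite oppr0 expi0 scale1r.
have [d [dpi zE arc]] := prod_set_arc (D := fun i => i != k) bb gg i0k zR.
have nz i : normc (z i) = f i / f i.+1 by rewrite normc_polar// ltW.
(* The argument supplied by the region and the angle along the chain are only known to give the same
   point, so they are compared through their cosines on [0, pi]. *)
have dg i : i != k -> `|d i| = g i.
  move=> ik; apply: (@cos_inj R).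
  - rewrite in_itv/= normr_ge0 (le_trans (dpi i ik))// ler_pdivrMr//.
    by rewrite ler_peMr ?pi_ge0// ler1n.
  - by rewrite in_itv/= ang_itv.
  rewrite cos_norm; have := congr1 (@complex.Re R) (zE i ik).
  rewrite nz /z !Re_polar => /mulfI -> //; first by rewrite gt_eqF.
have angle_sum a n : (a + n <= N)%N ->
    ang (V a) (V (a + n)%N) <= \sum_(a <= i < a + n) g i.
  elim: n => [|n IH] an.
    by rewrite addn0 in an *; rewrite ang_refl ?Vn0// big_geq.
  rewrite addnS in an *; rewrite big_nat_recr ?leq_addr//=.
  have aN : (a <= N)%N by rewrite (leq_trans _ (ltnW an))// leq_addr.
  apply: le_trans (ang_triangle (Vn0 a aN) (Vn0 _ (ltnW an)) (Vn0 _ an)) _.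
  by rewrite [ang (V (a + n)%N) _]angC; exact: lerD (IH (ltnW an)) (lexx _).
have kN := ltn_ord k.
pose u := V k.+1; pose y := V k.
have u0 : u != 0 by exact: Vn0.
have y0 : y != 0 by apply: Vn0; exact: ltnW.
(* The factors before [k] lead from y to V 0. As V 0 is a negative multiple of V N, the factors
   after [k] lead from there to - u. *)
have uy : ang y (- u) <= \sum_(i < N | i != k) `|d i|.
  have -> : \sum_(i < N | i != k) `|d i| = \sum_(i < N | i != k) g i.
    by apply: eq_bigr => i; exact: dg.
  rewrite sum_ord_neq; apply: le_trans (ang_triangle y0 (Vn0 0%N (leq0n _)) _) _.
    by rewrite oppr_eq0.
  rewrite lerD//.
    by rewrite angC; have := angle_sum 0%N k; rewrite add0n => h; apply: h; exact: ltnW.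
  have -> : ang (V 0%N) (- u) = ang (V k.+1) (V N).
    by rewrite -(angZl _ _ t0) -[t%:C *: _]opprK -vt angNN angC.
  by have := angle_sum k.+1 (N - k.+1)%N; rewrite subnKC//; apply.
pose c := inner u y / (enorm u * enorm y)%:C.
have uy0 : 0 < enorm u * enorm y by rewrite mulr_gt0 ?enorm_gt0.
have c1 : normc c <= 1.
  by rewrite normcM normcV normc_ge0_real ?(ltW uy0)// ler_pdivrMr// mul1r normc_inner_le.
have Rdiv (w : R[i]) (x : R) : complex.Re (w / x%:C) = complex.Re w / x.
  by rewrite -fmorphV mulrC cReMr mulrC.
have cD : acos (- complex.Re c) <= \sum_(i < N | i != k) `|d i|.
  apply: le_trans uy; rewrite !angE ipNr enormN mulNr (ipC y u) (mulrC (enorm y)).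
  by rewrite Rdiv Re_inner; exact: lexx.
have [e eD ee] := opposite_phase theta c1 cD.
have thetaE : acos (complex.Re (expi (- theta) * c)) = angle theta u (C k *m u).
  rewrite -VS -/y angle_ang// !angE enormZC normc_expi mul1r.
  by rewrite /c mulrA Rdiv -Re_inner innerZr.
rewrite thetaE in ee.
have pE : \prod_(i < N | i != k) normc (z i) = (f k.+1 / f k) / t.
  have : \prod_(i < N) (f i / f i.+1) = t^-1.
    rewrite telescope_prod_div => [|i iN]; last by rewrite gt_eqF ?f0.
    have -> : f N = t * f 0%N by rewrite /f vt enormN enormZ gtr0_norm.
    by rewrite invfM mulrCA mulfV ?mulr1// gt_eqF// f0.
  have cancel (a b p x : R) : a != 0 -> b != 0 -> a / b * p = x -> p = b / a * x.
    by move=> a0 b0 <-; field; apply/andP.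
  rewrite (bigD1 k)//= => /cancel h.
  rewrite (eq_bigr (fun i : 'I_N => f i / f i.+1)) => [|i _]; last exact: nz.
  by apply: h; rewrite gt_eqF// f0// ltnW.
have fk : 0 < f k.+1 / f k by rewrite divr_gt0 ?f0// ltnW.
have rS : prod_set (fun i => i != k) (fun i => region (beta i) (gamma i))
    ((f k.+1 / f k)%:C * expi e).
  apply: arc => //; rewrite ltW//= pE ler_pdivlMr// ler_piMr// ltW//.
have mul_opp s : expi s * expi e = -1 ->
    (f k / f k.+1)%:C * expi s * ((f k.+1 / f k)%:C * expi e) = -1.
  have fE : f k / f k.+1 * (f k.+1 / f k) = 1.
    by rewrite -[f k / _]invf_div mulVf// gt_eqF.
  by move=> se; rewrite mulrACA se -rmorphM fE rmorph1 mul1r.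
case: ee => se.
  exists ((f k / f k.+1)%:C * expi (theta + angle theta u (C k *m u))).
    by exists u => //=; left; rewrite -VS.
  by exists ((f k.+1 / f k)%:C * expi e) => //; exact: mul_opp.
exists ((f k / f k.+1)%:C * expi (theta - angle theta u (C k *m u))).
  by exists u => //=; right; rewrite -VS.
by exists ((f k.+1 / f k)%:C * expi e) => //; exact: mul_opp.
Qed.

End Sufficiency.

Section SufficientCondition.
Variables (R : realType) (m N : nat).

Lemma rateval_conj (f : {fraction {poly R}}) (z : R[i]) :
  rateval f z^*%C = (rateval f z)^*%C.
Proof.
have hornerJ (p : {poly R}) :
    (map_poly (real_complex R) p).[z^*%C] = ((map_poly (real_complex R) p).[z])^*%C.
  rewrite -horner_map /= -map_poly_comp; congr (_.[_]).
  by apply: eq_map_poly => x; exact/esym/conjc_real.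
by rewrite /rateval !hornerJ rmorphM fmorphV.
Qed.

(** The determinant test asks for every frequency, the graph condition for nonnegative ones only;
    real coefficients relate the two by conjugation. *)
Lemma freqresp_opp (P : 'M[{fraction {poly R}}]_m) (w : \bar R) :
  freqresp P (- w)%E = map_mx (if w is _%:E then @conjc R else id) (freqresp P w).
Proof.
case: w => [r||]; apply/matrixP => i j; rewrite !mxE //.
by rewrite -rateval_conj.
Qed.

Lemma other_index (k : 'I_N) : (1 < N)%N -> exists i : 'I_N, i != k.
Proof.
move=> N1; have N0 : (0 < N)%N by exact: ltnW.
have [k0|k0] := eqVneq (val k) 0%N.
  by exists (Ordinal N1); rewrite -val_eqE /= k0.
by exists (Ordinal N0); rewrite -val_eqE /= eq_sym.
Qed.

Lemma robust_stability_sufficient (k : 'I_N) (P : 'I_N -> 'M[{fraction {poly R}}]_m)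
    (beta gamma : 'I_N -> R) (theta : \bar R -> R) :
  (1 < N)%N -> RHinf (P k) ->
  (forall i, i != k -> 0 <= beta i <= pi / 2) ->
  (forall i, i != k -> 0 < gamma i) ->
  (forall i, i != k -> uncertain_class (beta i) (gamma i) (P i)) ->
  (forall w : \bar R, (0 <= w)%E ->
    ~ mul_set (SRG (theta w) (freqresp (P k) w))
        (prod_set (fun i => i != k) (fun i => region (beta i) (gamma i))) (-1)) ->
  feedback_stable P.
Proof.
move=> N1 Pk bb gg Pi noSRG; have [i0 i0k] := other_index k N1.
have PRH i : RHinf (P i).
  by have [->//|/Pi[]//] := eqVneq i k.
have detP t w : (0 <= w)%E -> 0 <= t <= 1 ->
    \det (1%:M + t%:C *: \prod_(i < N) freqresp (P i) w) != 0.
  move=> w0 t01; rewrite -det_tr; apply/negP => /det0P[v v0 vM].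
  apply: (noSRG w w0).
  apply: (@SRG_of_ker R m N k i0 _ _ (fun i => freqresp (P i) w) v^T t) => //.
  - by move=> i ik; exact: (Pi i ik).2.
  - by apply: contra_neq v0 => h; rewrite -[v]trmxK h trmx0.
  - by rewrite scalemxAl -[X in X + _]mul1mx -mulmxDl -[_ + _]trmxK -trmx_mul vM trmx0.
apply: feedback_stable_of_det => // t w t01.
have [w0|w0] := leP 0%E w; first exact: detP.
have w0' : (0 <= - w)%E by rewrite leeNr oppe0 ltW.
have := detP t _ w0' t01.
case: w w0 w0' => [r _ _|//|_ _]; last exact: id.
apply: contra_neq => d0.
pose cj : {rmorphism R[i] -> R[i]} := @conjc R.
rewrite -(rmorph0 cj) -d0 -det_map_mx; congr (\det _).
have tE : cj t%:C = t%:C by exact: conjc_real.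
rewrite map_mxD map_mx1 map_mxZ map_mx_prod tE; congr (_ + _ *: _).
apply: eq_bigr => i _; exact: (freqresp_opp (P i) r%:E).
Qed.

End SufficientCondition.

(** * Destabilizing perturbations *)

Section AllPass.
Variable R : realType.
Implicit Types (z : R[i]) (w : \bar R).

Definition interior_freq w := (0 < w)%E && (w < +oo)%E.

(** The values that stable functions with real coefficients can take at [w]: all of them at an
    interior frequency, only the real ones at 0 and infinity. *)
Definition freq_real w z := interior_freq w \/ complex.Im z = 0.

Local Notation "p %:CP" := (map_poly (real_complex R) p) (at level 2).

Lemma RH_real (c : R) : exists h : RH R, forall w, evRH w h = c%:C.
Proof.
have hc : FracField.tofrac c%:P \in @rhb R by apply/rhP; exact: rh_const.
by exists (MkRH hc) => w; exact: ev_const.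
Qed.

(** The function is c (alpha - s) / (alpha + s): on the imaginary axis the two linear factors are
    conjugate, and at infinity it tends to - c. *)
Lemma allpass_frac (c alpha : R) : 0 < alpha -> exists h : RH R,
  (forall x : R, evRH x%:E h
     = c%:C * ((alpha%:C - 0 +i* x) / (alpha%:C + 0 +i* x))) /\
  forall w, normc (evRH w h) = `|c|.
Proof.
move=> a0; pose a : {poly R} := c *: (alpha%:P - 'X); pose b : {poly R} := 'X + alpha%:P.
have sb : size b = 2 by rewrite size_XaddC.
have sa : (size a <= 2)%N.
  rewrite (leq_trans (size_scale_leq _ _))// -opprB size_polyN size_XsubC//.
have bE z : b%:CP.[z] = alpha%:C + z.
  by rewrite rmorphD /= map_polyX map_polyC hornerD hornerX hornerC addrC.
have aE z : a%:CP.[z] = c%:C * (alpha%:C - z).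
  by rewrite map_polyZ hornerZ rmorphB /= map_polyX map_polyC hornerD hornerN hornerX hornerC.
have bh : hurwitz b%:CP.
  move=> z z0; rewrite bE; apply/eqP => /(congr1 (@complex.Re R)).
  by rewrite cReD /= => h; have := ltr_wpDr z0 a0; rewrite h ltxx.
have ab : (size a <= size b)%N by rewrite sb.
have hh : FracField.tofrac a / FracField.tofrac b \in @rhb R.
  by apply/rhP; exact: (rh_frac bh ab).
have evE w : evRH w (MkRH hh) = polyval w 1 a / polyval w 1 b.
  by rewrite /evRH (ev_frac w bh ab (erefl _)) sb.
have evx (x : R) : evRH x%:E (MkRH hh)
    = c%:C * ((alpha%:C - 0 +i* x) / (alpha%:C + 0 +i* x)).
  by rewrite evE /polyval aE bE mulrA.
have a1 : a`_1 = - c by rewrite coefZ coefB coefC coefX /=; ring.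
have b1 : b`_1 = 1 by rewrite coefD coefC coefX /=; ring.
exists (MkRH hh); split=> // -[x||]; last 2 first.
- by rewrite evE /polyval a1 b1 divr1 normc_real normrN.
- by rewrite evE /polyval a1 b1 divr1 normc_real normrN.
rewrite evx normcM normc_real normcM normcV.
have -> : alpha%:C + 0 +i* x = (alpha%:C - 0 +i* x)^*%C.
  by apply/eqP; rewrite eq_complex /=; apply/andP; split; apply/eqP; ring.
rewrite normc_conj divff ?mulr1// normc_eq0 eq_complex negb_and /=.
by rewrite subr0 gt_eqF.
Qed.

(** As alpha runs through the positive reals, (alpha - jw) / (alpha + jw) covers the open lower unit
    half-circle. The sign of [c] brings z / c onto it; a real [z] is a constant. *)
Lemma allpass_interpolation w z : (0 <= w)%E -> freq_real w z -> exists h : RH R,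
  evRH w h = z /\ forall w', normc (evRH w' h) = normc z.
Proof.
move=> w0 wz; have [im0|im0] := eqVneq (complex.Im z) 0.
  have [h hE] := RH_real (complex.Re z); exists h.
  have -> : z = (complex.Re z)%:C by case: z im0 {wz hE} => p q /= ->.
  by split=> [|w']; rewrite hE.
case: wz => [|/eqP]; last by rewrite (negPf im0).
rewrite /interior_freq; case: w w0 => [om||] // _ /andP[om0 omy]; last by move: omy; rewrite ltxx.
rewrite lte_fin in om0.
have z0 : 0 < normc z by rewrite normc_gt0; apply: contra_neq im0 => ->.
suff [c [c1 cz]] : exists c : R, `|c| = normc z /\ complex.Im z / c < 0.
  pose p := complex.Re z / c; pose q := complex.Im z / c.
  have c0 : c != 0 by rewrite -normr_gt0 c1.
  have zE : z = c%:C * (p +i* q).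
    apply/eqP; rewrite eq_complex /= !mul0r subr0 addr0.
    by rewrite /p /q ![c * _]mulrC !divfK// !eqxx.
  have pq : p ^+ 2 + q ^+ 2 = 1.
    rewrite /p /q !exprMn -mulrDl -sqr_normcE -c1 real_normK ?num_real//.
    by rewrite exprVn divff// expf_neq0.
  have q2 : 0 < q ^+ 2 by rewrite exprn_even_gt0//= lt_eqF.
  have p1 : 0 < 1 + p.
    by rewrite ltNge; apply/negP => h; have := sqr_ge0 (1 + p); nra.
  (* The imaginary part of alpha - j om = (p + jq) (alpha + j om), solved for alpha; it is positive
     as q < 0 and p > -1. *)
  pose al := om * (1 + p) / - q.
  have al0 : 0 < al by rewrite divr_gt0 ?oppr_gt0// mulr_gt0.
  have [h [hE hn]] := allpass_frac c al0; exists h; rewrite hE; split; last first.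
    by move=> w'; rewrite hn.
  have q0 : q != 0 by rewrite lt_eqF.
  rewrite zE; congr (_ * _).
  have d0 : al%:C + 0 +i* om != 0.
    by rewrite eq_complex negb_and /= addr0 gt_eqF.
  apply: (mulIf d0); rewrite divfK//; apply/eqP; rewrite eq_complex /=.
  rewrite subr0 !addr0 sub0r add0r /al.
  apply/andP; split; apply/eqP.
    have -> : p * (om * (1 + p) / - q) - q * om
       = om * (1 + p) / - q + om / q * (1 - p ^+ 2 - q ^+ 2) by field.
    by rewrite -addrA -opprD pq subrr mulr0 addr0.
  by field.
have [h|h] := ltP (complex.Im z) 0.
  exists (normc z); rewrite ger0_norm ?(ltW z0)//; split=> //.
  by rewrite pmulr_llt0 ?invr_gt0.
exists (- normc z); rewrite normrN ger0_norm ?(ltW z0)//; split=> //.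
by rewrite invrN mulrN oppr_lt0 divr_gt0// lt_def im0.
Qed.

End AllPass.

Section ScaledGraphPoints.
Variables (R : realType) (m : nat).
Implicit Types (C : 'M[R[i]]_m) (x y : 'cV[R[i]]_m) (z : R[i]).

(** Both signs of the angle are included, so modulus and real part decide membership and the
    arccosine disappears. *)
Lemma SRG0P C z : SRG 0 C z <-> exists2 x, x != 0 &
  normc z = enorm (C *m x) / enorm x /\
  complex.Re z = ip x (C *m x) / enorm x ^+ 2.
Proof.
have r0 x : 0 <= enorm (C *m x) / enorm x by rewrite divr_ge0 ?enorm_ge0.
have cosE x : x != 0 -> enorm (C *m x) / enorm x * cos (angle 0 x (C *m x))
    = ip x (C *m x) / enorm x ^+ 2.
  move=> x0; have nx : 0 < enorm x by rewrite enorm_gt0.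
  have [y0|y0] := eqVneq (C *m x) 0.
    have /eqP -> : enorm (C *m x) == 0 by rewrite enorm_eq0 y0.
    by rewrite y0 !mul0r ipE big1 ?mul0r// => i _; rewrite !mxE /= !mulr0 addr0.
  have ny : 0 < enorm (C *m x) by rewrite enorm_gt0.
  rewrite angle_ang// oppr0 expi0 scale1r cos_ang.
  by field; rewrite !gt_eqF.
split=> [[x x0 /= h]|[x x0 [nz rz]]]; exists x => //.
  case: h => ->; rewrite normc_polar// Re_polar.
    by rewrite add0r cosE.
  by rewrite sub0r cosN cosE.
have [y0|y0] := eqVneq (C *m x) 0.
  have r00 : enorm (C *m x) / enorm x = 0.
    by apply/eqP; rewrite mulf_eq0 enorm_eq0 y0 eqxx.
  by left; rewrite /= r00 rmorph0 mul0r; apply: eq0_normc; rewrite nz r00.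
have nx : 0 < enorm x by rewrite enorm_gt0.
have ny : 0 < enorm (C *m x) by rewrite enorm_gt0.
have [a aE ->] := polar_form z.
have {}aE : `|a| = angle 0 x (C *m x).
  rewrite aE angle_ang// oppr0 expi0 scale1r !angE; congr acos.
  by rewrite nz rz; field; rewrite !gt_eqF.
rewrite -aE -nz /= add0r sub0r.
by case: (ler0P a) => _; [right|left]; rewrite ?opprK.
Qed.

Lemma enorm_sub_sqr x y (u : R) : enorm (y - u%:C *: x) ^+ 2
  = enorm y ^+ 2 - 2 * u * ip x y + u ^+ 2 * enorm x ^+ 2.
Proof.
by rewrite !sqr_enorm ipDl !ipDr !ipNl !ipNr !ipZl !ipZr (ipC y x); ring.
Qed.

(** The distance |z - u| depends only on |z| and Re z; for the graph point attained at [x] it equals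
    |C x - u x| / |x|. *)
Lemma SRG0_sub_region C (beta gamma u : R) : 0 <= beta <= pi / 2 -> 0 < gamma ->
  0 <= u <= gamma / (1 + sin beta) ->
  (forall x, enorm (C *m x - u%:C *: x) <= u * sin beta * enorm x) ->
  SRG 0 C `<=` region beta gamma.
Proof.
move=> bb g0 uA CuP z /SRG0P[x x0 [nz rz]]; apply/region_cone => //.
exists u => //; have nx : 0 < enorm x by rewrite enorm_gt0.
have -> : normc (z - u%:C) ^+ 2 = normc z ^+ 2 - 2 * u * complex.Re z + u ^+ 2.
  by rewrite !sqr_normcE; case: z {nz rz} => p q /=; ring.
rewrite nz rz.
have /andP[s0 _] := sin_beta_bounds bb; have /andP[u0 _] := uA.
have h : enorm (C *m x - u%:C *: x) ^+ 2 <= (u * sin beta * enorm x) ^+ 2.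
  by rewrite ler_pXn2r// nnegrE ?mulr_ge0 ?enorm_ge0.
rewrite enorm_sub_sqr [X in _ <= X]exprMn in h.
rewrite -(@ler_pM2r _ (enorm x ^+ 2)) ?exprn_gt0//.
apply: le_trans h; rewrite le_eqVlt; apply/orP; left; apply/eqP.
by field; rewrite gt_eqF.
Qed.

End ScaledGraphPoints.

Section Destabilization.
Variables (R : realType) (m : nat).
Implicit Types (x y v : 'cV[R[i]]_m) (w : \bar R).

Lemma enorm_eq_normc x y : (forall i, normc (x i 0) = normc (y i 0)) ->
  enorm x = enorm y.
Proof.
move=> xy; rewrite !enormE !ipE; congr Num.sqrt; apply: eq_bigr => i _.
by rewrite -!expr2 -!sqr_normcE xy.
Qed.

(** The perturbation is u I + a b, where at [w] the column a is (v' - u v) / |v|^2 and the row b is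
    the conjugate of v. Its entries being all-pass, the norm of a b is |v' - u v| / |v| at every
    frequency, hence at most u sin beta. *)
Lemma class_interpolation w (beta gamma u : R) v v' :
  (0 <= w)%E -> 0 <= beta <= pi / 2 -> 0 < gamma ->
  0 <= u <= gamma / (1 + sin beta) -> v != 0 ->
  enorm (v' - u%:C *: v) <= u * sin beta * enorm v ->
  (forall i, freq_real w (v i 0) /\ freq_real w (v' i 0)) ->
  exists P : 'M[{fraction {poly R}}]_m,
    uncertain_class beta gamma P /\ freqresp P w *m v = v'.
Proof.
move=> w0 bb g0 uA v0 vv' vr; have nv : 0 < enorm v by rewrite enorm_gt0.
pose x : 'cV[R[i]]_m := ((enorm v ^+ 2)^-1)%:C *: (v' - u%:C *: v).
have /choice[a aE] : forall i, exists h : RH R,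
    evRH w h = x i 0 /\ forall w', normc (evRH w' h) = normc (x i 0).
  move=> i; apply: allpass_interpolation => //; have [v1 v2] := vr i.
  case: v1 v2 => [|im1]; [by left|case=> [|im2]; [by left|right]].
  rewrite !mxE; case: (v i 0) im1 (v' i 0) im2 => [p q] /= -> [p' q'] /= ->.
  by ring.
have /choice[b bE] : forall i, exists h : RH R, evRH w h = (v i 0)^*%C /\
    forall w', normc (evRH w' h) = normc (v i 0)^*%C.
  move=> i; apply: allpass_interpolation => //.
  case: (vr i).1 => [|im1]; [by left|right].
  by case: (v i 0) im1 => p q /= ->; rewrite oppr0.
have [c cE] := RH_real u.
pose Q : 'M[RH R]_m := c%:M + (\col_i a i) *m (\row_i b i).
pose aw w' : 'cV[R[i]]_m := \col_i evRH w' (a i).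
pose bw w' : 'cV[R[i]]_m := \col_i (evRH w' (b i))^*%C.
have inner_scalar (s : 'M[R[i]]_1) (y : 'cV[R[i]]_m) : y *m s = s 0 0 *: y.
  by rewrite {1}[s]mx11_scalar mul_mx_scalar.
have QE w' y : map_mx (evRH w') Q *m y = u%:C *: y + inner (bw w') y *: aw w'.
  rewrite map_mxD map_scalar_mx /= cE map_mxM mulmxDl mul_scalar_mx -mulmxA; congr (_ + _).
  have -> : map_mx (evRH w') (\col_i a i) = aw w'.
    by apply/matrixP => i j; rewrite !mxE.
  have bE' : (map_mx (evRH w') (\row_i b i) *m y) 0 0 = inner (bw w') y.
    rewrite innerE mxE; apply: eq_bigr => i _; rewrite !mxE.
    by congr (_ * _); rewrite conjcK.
  by rewrite (inner_scalar (_ *m y) (aw w')) bE'.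
exists (map_mx val Q); split; last first.
  rewrite freqresp_map_val QE.
  have -> : aw w = x by apply/matrixP => i j; rewrite mxE (aE i).1 (ord1 j).
  have -> : bw w = v.
    by apply/matrixP => i j; rewrite mxE (bE i).1 (ord1 j) conjcK.
  have -> : inner v v = (enorm v ^+ 2)%:C.
    rewrite sqr_enorm -Re_inner; have : complex.Im (inner v v) = 0.
      rewrite innerE; apply: (big_ind (fun z : R[i] => complex.Im z = 0)) => //.
        by case=> ? ? [? ?] /= -> ->; rewrite addr0.
      by move=> i _; case: (v i 0) => p q /=; ring.
    by case: (inner v v) => p q /= ->.
  by rewrite scalerA -rmorphM mulfV ?gt_eqF ?exprn_gt0// scale1r addrC subrK.
split=> [|w' w'0]; first exact: RHinf_map_val.
rewrite freqresp_map_val; apply: (SRG0_sub_region bb g0 uA) => y.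
rewrite QE addrC addKr enormZC.
have -> : enorm (aw w') = enorm x.
  by apply: enorm_eq_normc => i; rewrite mxE (aE i).2.
have bv : enorm (bw w') = enorm v.
  by apply: enorm_eq_normc => i; rewrite mxE normc_conj (bE i).2 normc_conj.
have := normc_inner_le (bw w') y; rewrite bv => h.
have xE : enorm x = (enorm v ^+ 2)^-1 * enorm (v' - u%:C *: v).
  by rewrite enormZ ger0_norm// invr_ge0 sqr_ge0.
apply: le_trans (ler_wpM2r (enorm_ge0 _) h) _.
rewrite mulrAC ler_wpM2r ?enorm_ge0// xE mulrCA.
have -> : (enorm v ^+ 2)^-1 * (enorm v * enorm (v' - u%:C *: v))
    = enorm (v' - u%:C *: v) / enorm v by field; rewrite gt_eqF.
by rewrite ler_pdivrMr.
Qed.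

Lemma destabilizing_chain N (k : 'I_N) (Pk : 'M[{fraction {poly R}}]_m) w
    (beta gamma : 'I_N -> R) (V : nat -> 'cV[R[i]]_m) :
  (0 <= w)%E -> RHinf Pk ->
  (forall i, i != k -> 0 <= beta i <= pi / 2) ->
  (forall i, i != k -> 0 < gamma i) ->
  (forall i, (i <= N)%N -> V i != 0) -> V 0%N = - V N ->
  V k = freqresp Pk w *m V k.+1 ->
  (forall i : 'I_N, i != k -> exists2 u,
     0 <= u <= gamma i / (1 + sin (beta i)) &
     enorm (V i - u%:C *: V i.+1) <= u * sin (beta i) * enorm (V i.+1)) ->
  (forall i j, (i <= N)%N -> freq_real w (V i j 0)) ->
  exists P : 'I_N -> 'M[{fraction {poly R}}]_m, [/\ P k = Pk,
    forall i, i != k -> uncertain_class (beta i) (gamma i) (P i) &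
    ~ feedback_stable P].
Proof.
move=> w0 PkRH bb g0 Vn0 V0 Vk Vu Vr.
have /choice[P0 P0E] : forall i : 'I_N, exists P : 'M[{fraction {poly R}}]_m,
    i != k -> uncertain_class (beta i) (gamma i) P /\ freqresp P w *m V i.+1 = V i.
  move=> i; have [->|ik] := eqVneq i k; first by exists 0.
  have [u uA uV] := Vu i ik.
  have [|P PE] := class_interpolation w0 (bb i ik) (g0 i ik) uA (Vn0 _ (ltn_ord i)) uV.
    by move=> j; split; apply: Vr => //; exact: ltnW.
  by exists P.
pose P i := if i == k then Pk else P0 i.
have Pk_eq : P k = Pk by rewrite /P eqxx.
have PP0 i : i != k -> P i = P0 i by rewrite /P => /negPf ->.
exists P; split=> // [i ik|Pst]; first by rewrite PP0//; exact: (P0E i ik).1.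
have PRH i : RHinf (P i).
  by have [->|ik] := eqVneq i k; rewrite ?Pk_eq ?PP0//; exact: (P0E i ik).1.1.
have VP : forall i : 'I_N, V i = freqresp (P i) w *m V i.+1.
  by move=> i; have [->|ik] := eqVneq i k; rewrite ?Pk_eq ?PP0 ?(P0E i ik).2.
have h : \prod_(i < N) freqresp (P i) w *m V N = - V N.
  by rewrite -V0; exact: chain_prod VP.
by have := Vn0 N (leqnn N); rewrite (feedback_stable_ker PRH Pst h) eqxx.
Qed.

End Destabilization.

Section PlaneChains.
Variable R : realType.

Lemma scalar_chain N (z : 'I_N -> R[i]) (c : R[i]) : exists W : nat -> R[i],
  [/\ W N = c, W 0%N = (\prod_(i < N) z i) * c,
      forall i : 'I_N, W i = z i * W i.+1 &
      (forall i, complex.Im (z i) = 0) -> complex.Im c = 0 ->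
        forall i, (i <= N)%N -> complex.Im (W i) = 0].
Proof.
elim: N z => [|N IH] z.
  by exists (fun=> c); rewrite big_ord0 mul1r; split=> // -[].
have [W [WN W0 WS WI]] := IH (fun i => z (lift ord0 i)).
exists (fun i => if i is j.+1 then W j else z ord0 * W 0%N); split=> //.
- by rewrite big_ord_recl -mulrA -W0.
- by move=> i; case: (unliftP ord0 i) => [j|] -> //=; exact: WS.
- move=> zI cI [_|i iN]; last by apply: WI => // j; exact: zI.
  by rewrite cImM zI mul0r addr0 (WI (fun j => zI _) cI) ?mulr0.
Qed.

Variable m : nat.
Implicit Types (e : 'cV[R[i]]_m) (z : R[i]).

(** This copy of the complex plane is only real-linear: [e2] plays the imaginary unit and need not
    be a complex multiple of [e1]. *)
Definition plane e1 e2 z := (complex.Re z)%:C *: e1 + (complex.Im z)%:C *: e2.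

Lemma planeB e1 e2 z z' (u : R) :
  plane e1 e2 z - u%:C *: plane e1 e2 z' = plane e1 e2 (z - u%:C * z').
Proof.
rewrite /plane scalerDr !scalerA opprD addrACA -!scalerBl -!rmorphM -!rmorphB.
by congr (_%:C *: _ + _%:C *: _); case: z z' => [p q] [p' q'] /=; ring.
Qed.

Lemma planeN e1 e2 z : plane e1 e2 (- z) = - plane e1 e2 z.
Proof.
rewrite /plane opprD -!scaleNr -!rmorphN.
by congr (_%:C *: _ + _%:C *: _); case: z.
Qed.

Lemma enorm_plane e1 e2 z : ip e1 e1 = 1 -> ip e2 e2 = 1 -> ip e1 e2 = 0 ->
  enorm (plane e1 e2 z) = normc z.
Proof.
move=> e11 e22 e12; apply/eqP; rewrite -(eqrXn2 (n := 2)) ?enorm_ge0 ?normc_ge0//.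
rewrite sqr_enorm sqr_normcE ipDl !ipDr !ipZl !ipZr e11 e22 (ipC e2) e12.
by apply/eqP; ring.
Qed.

(** The last hypothesis lists three ways of making every signal interpolable at [w]: an interior
    frequency, two real directions, or real factors, which keep the signals on the real line of
    [e1]. *)
Lemma destabilizing_plane N (k : 'I_N) (Pk : 'M[{fraction {poly R}}]_m) (w : \bar R)
    (beta gamma : 'I_N -> R) (z : 'I_N -> R[i]) e1 e2 :
  (0 <= w)%E -> RHinf Pk ->
  (forall i, i != k -> 0 <= beta i <= pi / 2) ->
  (forall i, i != k -> 0 < gamma i) ->
  ip e1 e1 = 1 -> ip e2 e2 = 1 -> ip e1 e2 = 0 ->
  (forall i, i != k -> region (beta i) (gamma i) (z i)) ->
  freqresp Pk w *m e1 = plane e1 e2 (z k) ->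
  \prod_(i < N) z i = -1 ->
  [\/ interior_freq w,
    forall j, complex.Im (e1 j 0) = 0 /\ complex.Im (e2 j 0) = 0 |
    (forall j, complex.Im (e1 j 0) = 0) /\ (forall i, complex.Im (z i) = 0)] ->
  exists P : 'I_N -> 'M[{fraction {poly R}}]_m, [/\ P k = Pk,
    forall i, i != k -> uncertain_class (beta i) (gamma i) (P i) &
    ~ feedback_stable P].
Proof.
move=> w0 PkRH bb g0 e11 e22 e12 zR Pe1 z1 re.
have [W [WN W0 WS WI]] := scalar_chain z 1.
have {}W0 : W 0%N = -1 by rewrite W0 z1 mulr1.
have Wn0 i : (i <= N)%N -> W i != 0.
  move=> iN; apply/eqP => Wi; suff : W 0%N = 0.
    by rewrite W0 => /eqP; rewrite oppr_eq0 oner_eq0.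
  elim: i iN Wi => // i IH iN Wi; apply: IH; first exact: ltnW.
  by rewrite (WS (Ordinal iN)) /= Wi mulr0.
(* Normalizes the chain so that the input of [Pk] is exactly [e1]. *)
pose d := (W k.+1)^-1; have dn0 : d != 0 by rewrite invr_eq0 Wn0.
have Wk : W k.+1 * d = 1 by rewrite mulfV ?Wn0.
have nV i : enorm (plane e1 e2 (W i * d)) = normc (W i * d) by exact: enorm_plane.
apply: (@destabilizing_chain R m N k Pk w beta gamma
         (fun i => plane e1 e2 (W i * d))) => //.
- by move=> i iN; rewrite -enorm_gt0 nV normc_gt0 mulf_neq0 ?Wn0.
- by rewrite W0 WN mulN1r mul1r planeN.
- rewrite WS -mulrA Wk mulr1 -Pe1; congr (_ *m _).
  by rewrite /plane /= scale1r scale0r addr0.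
- move=> i ik; have [u uA uz] := (region_cone (bb i ik) (g0 i ik) (z i)).1 (zR i ik).
  exists u => //; have /andP[u0 _] := uA.
  have /andP[s0 _] := sin_beta_bounds (bb i ik).
  rewrite planeB enorm_plane// nV WS -mulrA -mulrBl normcM ler_wpM2r ?normc_ge0//.
  by rewrite -(ler_pXn2r (n := 2)) ?nnegrE ?normc_ge0 ?mulr_ge0.
- move=> i j iN; case: re => [|er|[er zr]]; first by left.
    right; rewrite !mxE; have [] := er j; case: (e1 j 0) => p q /= ->.
    by case: (e2 j 0) => p' q' /= ->; ring.
  right; have WI' i' : (i' <= N)%N -> complex.Im (W i') = 0.
    exact: (WI zr (erefl _)).
  have dI : complex.Im d = 0.
    rewrite /d; have := WI' k.+1 (ltn_ord k); case: (W k.+1) => p q /= ->.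
    by rewrite !(mul0r, oppr0).
  rewrite !mxE cImM (WI' i iN) dI mulr0 mul0r addr0 rmorph0 mul0r addr0 cImM er.
  by rewrite mulr0 mul0r addr0.
Qed.

End PlaneChains.

(** * The frequencies zero and infinity *)

Section BoundaryPoint.
Variable R : realType.
Implicit Types (P Q : {poly R[i]}) (n d : {poly R}) (z : R[i]) (c t : R).

Local Notation "p %:CP" := (map_poly (real_complex R) p) (at level 2).

Lemma poly_Re_lt0_near P : complex.Re P.[0] < 0 ->
  exists2 t, 0 < t <= 1 & complex.Re P.[t%:C] < 0.
Proof.
elim/poly_ind: P => [|p c _]; first by rewrite horner0 ltxx.
rewrite hornerMXaddC mulr0 add0r => c0.
have [L pL] := normc_coef_bound p.
pose K := (size p).-1; pose M := K.+1%:R * L * 2 ^+ K.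
have L0 : 0 <= L by rewrite (le_trans _ (pL 0%N))// normc_ge0.
have M0 : 0 <= M by rewrite !mulr_ge0 ?exprn_ge0// ler0n.
have pM t : 0 <= t <= 1 -> normc p.[t%:C] <= M.
  move=> /andP[t0 t1]; rewrite -[p.[_]]subr0 -[X in _ - X](horner0 t%:C).
  apply: le_trans (normc_horner_dist (K := K) (L := L) _ _ _ _) _.
  - by rewrite /K; case: (size p).
  - by rewrite size_poly0.
  - by move=> k; rewrite coef0 subr0.
  - rewrite ler_wpM2l ?mulr_ge0 ?ler0n// lerXn2r ?nnegrE ?addr_ge0 ?normc_ge0//.
    by rewrite normc_ge0_real// lerD2l.
(* [M] bounds the cofactor [p] on [0, 1], so at this [t] the real part moves by less than |Re c|. *)
pose t := Num.min 1 (- complex.Re c / (2 * (M + 1))).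
have M1 : 0 < 2 * (M + 1) by lra.
have t1 : t <= 1 by rewrite ge_min lexx.
have t2 : t <= - complex.Re c / (2 * (M + 1)) by rewrite ge_min lexx orbT.
have t0 : 0 < t by rewrite lt_min ltr01/= divr_gt0// oppr_gt0.
exists t; first by rewrite t0.
rewrite hornerMXaddC cReD mulrC cReMr.
have h1 : complex.Re p.[t%:C] <= M.
  rewrite (le_trans (ler_norm _))// (le_trans (normc_Re _))// pM// t1 ltW//.
have h2 : t * complex.Re p.[t%:C] <= t * M by rewrite ler_wpM2l// ltW.
have h3 : t * (2 * (M + 1)) <= - complex.Re c by rewrite -ler_pdivlMr.
have : 0 <= t * M by rewrite mulr_ge0// ltW.
lra.
Qed.

Lemma horner_conj P t : (map_poly (@conjc R) P).[t%:C] = (P.[t%:C])^*%C.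
Proof.
by rewrite -[X in _.[X]](conjc_real t) (horner_map (@conjc R : {rmorphism R[i] -> R[i]})).
Qed.

Lemma horner_conj_real n z : (n%:CP).[z^*%C] = ((n%:CP).[z])^*%C.
Proof.
pose cj : {rmorphism R[i] -> R[i]} := @conjc R.
rewrite -[RHS](horner_map cj) -map_poly_comp; congr (_.[_]).
by apply: eq_map_poly => x; exact/esym/conjc_real.
Qed.

(** On the real line c^2 |Q|^2 - |P|^2 is a polynomial, thanks to the conjugated coefficients; if
    negative at 0, it would be negative at some t > 0. *)
Lemma normc_horner_limit P Q c : 0 <= c ->
  (forall t, 0 < t -> normc P.[t%:C] <= c * normc Q.[t%:C]) ->
  normc P.[0] <= c * normc Q.[0].
Proof.
move=> c0 PQ; rewrite leNgt; apply/negP => h.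
pose S := (c ^+ 2)%:C *: (Q * map_poly (@conjc R) Q) - P * map_poly (@conjc R) P.
have SE t : complex.Re S.[t%:C] = (c * normc Q.[t%:C]) ^+ 2 - normc P.[t%:C] ^+ 2.
  rewrite /S hornerD hornerN hornerZ !hornerM !horner_conj cReB.
  by rewrite !mulc_conj cReMr exprMn.
have [|t /andP[t0 _]] := @poly_Re_lt0_near S.
  rewrite -(rmorph0 (real_complex R)) SE rmorph0 subr_lt0.
  by rewrite ltr_pXn2r// nnegrE ?mulr_ge0 ?normc_ge0.
rewrite SE subr_lt0 ltr_pXn2r// ?nnegrE ?mulr_ge0 ?normc_ge0//.
by rewrite ltNge PQ.
Qed.

Lemma expiX a k : expi a ^+ k = expi (k%:R * a) :> R[i].
Proof.
elim: k => [|k IH]; first by rewrite expr0 mul0r expi0.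
by rewrite exprS IH -expiD -natr1 mulrDl mul1r addrC.
Qed.

(** Conjugation gives the negative half of the axis, a limit gives 0, and the same limit for the
    reversed polynomials gives infinity. *)
Lemma max_modulus_imaginary n d c : 0 <= c -> hurwitz d%:CP ->
  (size n <= size d)%N ->
  (forall t, 0 < t -> normc (n%:CP).[0 +i* t] <= c * normc (d%:CP).[0 +i* t]) ->
  forall z, 0 <= complex.Re z -> normc (n%:CP).[z] <= c * normc (d%:CP).[z].
Proof.
move=> c0 dh nd axis; have d0 := hurwitzCP_neq0 dh.
have imE (t : R) : 'i%C * t%:C = 0 +i* t.
  by apply/eqP; rewrite eq_complex /=; apply/andP; split; apply/eqP; ring.
have compE (p : {poly R[i]}) (s : R[i]) x : (p \Po (s *: 'X)).[x] = p.[s * x].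
  by rewrite horner_comp hornerZ hornerX.
apply: max_modulus_hurwitz; rewrite ?size_map_poly//.
  move=> [r t] /= ->; have [t0|t0|<-] := ltgtP 0 t.
  - exact: axis.
  - have -> : 0 +i* t = (0 +i* - t)^*%C by rewrite /= opprK.
    rewrite !horner_conj_real !normc_conj; apply: axis; by rewrite oppr_gt0.
  - have := @normc_horner_limit (n%:CP \Po ('i%C *: 'X)) (d%:CP \Po ('i%C *: 'X)) c c0.
    by rewrite !compE mulr0 => h; apply: h => t' t'0; rewrite !compE imE; exact: axis.
pose e := (size d).-1; have de : size d = e.+1 by rewrite prednK ?size_poly_gt0.
have := @normc_horner_limit (revpoly e n%:CP \Po (- 'i%C *: 'X))
  (revpoly e d%:CP \Po (- 'i%C *: 'X)) c c0.
rewrite !compE mulr0 !revpoly0 /lead_coef size_map_poly -/e; apply => t t0.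
rewrite !compE; have w0 : 0 +i* t^-1 != 0 :> R[i].
  by rewrite eq_complex /= eqxx gt_eqF// invr_gt0.
have iE : - 'i%C * t%:C = (0 +i* t^-1)^-1 :> R[i].
  apply: (mulIf w0); rewrite mulVf//; apply/eqP; rewrite eq_complex /=.
  by apply/andP; split; apply/eqP; field; rewrite gt_eqF.
have := axis t^-1; rewrite invr_gt0 => /(_ t0).
rewrite !(@horner_revpoly _ e _ (0 +i* _)) ?size_map_poly ?de -?de//.
rewrite !normcM mulrCA ler_pM2l; first by rewrite iE.
by rewrite normcX exprn_gt0// normc_gt0.
Qed.

(* A boundary version of the maximum principle: where |n/d| reaches its maximum
   [c] over the closed right half-plane, at the origin, n/d turns at a nonzero
   rate along the imaginary axis. Otherwise c - n/d would vanish there to an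
   order at least 2 and have a negative real part in some direction. *)
Lemma hopf_rotation n d c A s z : 0 < c -> hurwitz d%:CP -> (size n <= size d)%N ->
  (forall t, 0 < t -> normc (n%:CP).[0 +i* t] < c * normc (d%:CP).[0 +i* t]) ->
  n.[0] = c * d.[0] -> cone A s z -> 0 <= s <= 1 -> complex.Im z < 0 ->
  exists2 t, 0 < t & (n%:CP).[0 +i* t] != 0 /\
    cone A s (z * c%:C * (d%:CP).[0 +i* t] / (n%:CP).[0 +i* t]).
Proof.
move=> c0 dh nd axis n0 [u /andP[u0 uA] uz] /andP[s0 s1] imz.
have nle : forall x, 0 <= complex.Re x -> normc (n%:CP).[x] <= c * normc (d%:CP).[x].
  by apply: max_modulus_imaginary => // [|t t0]; apply: ltW => //; exact: axis.
pose e := c *: d - n.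
have e0 : e != 0.
  rewrite subr_eq0; apply/eqP => cd; have := axis 1 ltr01.
  by rewrite -cd map_polyZ hornerZ normcM normc_real gtr0_norm// ltxx.
have [k [b]] := multiplicity_XsubC e 0; rewrite e0 subr0 /= => b0 eE.
have {}b0 : b.[0] != 0 by [].
have k0 : (0 < k)%N.
  rewrite lt0n; apply/eqP => k0; move: b0.
  have -> : b = e by rewrite eE k0 expr0 mulr1.
  by rewrite hornerD hornerN hornerZ n0 subrr eqxx.
have EE x : (e%:CP).[x] = c%:C * (d%:CP).[x] - (n%:CP).[x].
  by rewrite rmorphB /= map_polyZ hornerD hornerN hornerZ.
have EB x : (e%:CP).[x] = (b%:CP).[x] * x ^+ k.
  by rewrite eE rmorphM rmorphXn /= map_polyX hornerM hornerXn.
have d0 : d.[0] != 0.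
  have := dh 0 (lexx _); rewrite -(rmorph0 (real_complex R)) horner_map.
  by rewrite fmorph_eq0.
(* This is |n| <= c |d| rewritten with n = c d - e. *)
have ReE x : 0 <= complex.Re x ->
    normc (e%:CP).[x] ^+ 2 <= 2 * c * complex.Re ((e%:CP).[x] * ((d%:CP).[x])^*%C).
  move=> x0; have h : normc (n%:CP).[x] ^+ 2 <= (c * normc (d%:CP).[x]) ^+ 2.
    by rewrite ler_pXn2r ?nnegrE ?mulr_ge0 ?normc_ge0 ?(ltW c0)// nle.
  have nE : (n%:CP).[x] = c%:C * (d%:CP).[x] - (e%:CP).[x].
    by rewrite EE opprB addrC subrK.
  move: h; rewrite nE exprMn !sqr_normcE.
  by case: ((d%:CP).[x]) ((e%:CP).[x]) => [p q] [p' q'] /=; lra.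
pose mu := b.[0] * d.[0].
have mu0 : mu != 0 by rewrite mulf_neq0.
have hornerC0 (p : {poly R}) : (p%:CP).[0] = (p.[0])%:C.
  by rewrite -(rmorph0 (real_complex R)) horner_map.
have compE (p : {poly R[i]}) (w : R[i]) x : (p \Po (w *: 'X)).[x] = p.[w * x].
  by rewrite horner_comp hornerZ hornerX.
(* Along the ray of x, e times the conjugate of d is t^k x^k b(0) d(0) to leading order, and [ReE]
   forbids a negative real part. *)
have direction x : 0 <= complex.Re x -> 0 <= complex.Re (x ^+ k) * mu.
  move=> x0; rewrite leNgt; apply/negP => h.
  have [|t /andP[t0 _]] := @poly_Re_lt0_near
      (x ^+ k *: ((b%:CP \Po (x *: 'X)) * (d%:CP \Po (x^*%C *: 'X)))).
    by rewrite hornerZ hornerM !compE !mulr0 !hornerC0 -rmorphM mulrC cReMr mulrC.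
  rewrite hornerZ hornerM !compE.
  have -> : x^*%C * t%:C = (x * t%:C)^*%C.
    by rewrite rmorphM; congr (_ * _); exact/esym/conjc_real.
  rewrite horner_conj_real => lt0.
  have xt : 0 <= complex.Re (x * t%:C) by rewrite mulrC cReMr mulr_ge0// ltW.
  have := le_trans (sqr_ge0 _) (ReE _ xt); rewrite EB exprMn.
  have -> : (b%:CP).[x * t%:C] * (x ^+ k * t%:C ^+ k) * ((d%:CP).[x * t%:C])^*%C
     = (t ^+ k)%:C * (x ^+ k * ((b%:CP).[x * t%:C] * ((d%:CP).[x * t%:C])^*%C)).
    by rewrite rmorphXn; ring.
  rewrite cReMr pmulr_rge0 ?mulr_gt0// pmulr_rge0 ?exprn_gt0//.
  by rewrite leNgt lt0.
have {}mu0 : 0 < mu.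
  rewrite lt_def mu0; have := direction 1; rewrite expr1n mul1r; apply.
  by rewrite /= ler01.
have k1 : k = 1%N.
  apply/eqP; rewrite eqn_leq k0 andbT leqNgt; apply/negP => k2.
  (* For k >= 2 this direction lies in the half-plane, while its k-th power has argument 3 pi / 4
     and a negative real part. *)
  pose a : R := 3 * pi / 4 / k%:R.
  have kR : (2 : R) <= k%:R by rewrite ler_nat.
  have kR0 : (0 : R) < k%:R by rewrite ltr0n.
  have pi0 := pi_gt0 R.
  have a0 : 0 <= a by rewrite !divr_ge0 ?mulr_ge0 ?pi_ge0.
  have a1 : a <= pi / 2 by rewrite /a ler_pdivrMr//; nra.
  have /direction : 0 <= complex.Re (expi a).
    by rewrite /= cos_ge0_pihalf// a1 andbT (le_trans _ a0)// oppr_le0 divr_ge0 ?pi_ge0.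
  rewrite expiX /a [k%:R * _]mulrC divfK ?gt_eqF// pmulr_lge0//=.
  have -> : 3 * pi / 4 = pi / 4 + pi / 2 :> R by field.
  rewrite cosDpihalf oppr_ge0 leNgt sin_gt0_pihalf//.
  by apply/andP; split; lra.
have u0' : 0 < u.
  rewrite lt_def u0 andbT; apply/eqP => ue; move: uz; rewrite ue mul0r rmorph0 subr0 expr0n /=.
  rewrite sqr_normcE; have : 0 < complex.Im z ^+ 2 by rewrite exprn_even_gt0//= lt_eqF.
  by have := sqr_ge0 (complex.Re z); lra.
have [|t /andP[t0 _]] := @poly_Re_lt0_near
    ((- 'i%C * z) *: ((d%:CP \Po ('i%C *: 'X)) * (b%:CP \Po (- 'i%C *: 'X)))).
  rewrite hornerZ hornerM !compE !mulr0 !hornerC0 -rmorphM mulrC cReMr [d.[0] * _]mulrC.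
  rewrite pmulr_rlt0//; by case: z imz {uz} => p q /=; lra.
rewrite hornerZ hornerM !compE.
have -> : 'i%C * t%:C = 0 +i* t.
  by apply/eqP; rewrite eq_complex /=; apply/andP; split; apply/eqP; ring.
have -> : - 'i%C * t%:C = (0 +i* t)^*%C.
  by apply/eqP; rewrite eq_complex /=; apply/andP; split; apply/eqP; ring.
rewrite horner_conj_real; set x := 0 +i* t => lt0.
have x0 : 0 <= complex.Re x by rewrite /= lexx.
have := ReE x x0; have := dh x x0.
have : (n%:CP).[x] = c%:C * (d%:CP).[x] - (e%:CP).[x] by rewrite EE opprB addrC subrK.
have zE : complex.Re (z * (d%:CP).[x] * ((e%:CP).[x])^*%C) < 0.
  rewrite EB k1 expr1 rmorphM.
  have -> : z * (d%:CP).[x] * (((b%:CP).[x])^*%C * x^*%C)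
      = t%:C * (- 'i%C * z * ((d%:CP).[x] * ((b%:CP).[x])^*%C)).
    have -> : x^*%C = - 'i%C * t%:C by
      apply/eqP; rewrite eq_complex /=; apply/andP; split; apply/eqP; ring.
    by ring.
  by rewrite cReMr pmulr_rlt0.
move: zE; set D := (d%:CP).[x]; set E := (e%:CP).[x]; set N := (n%:CP).[x].
move=> zE NE D0 ED.
(* Since z c d - u n = (z - u) c d + u e, the right side minus the left is [h1] plus [h2] minus the
   nonpositive quantity of [h3]. *)
have key : normc (z * c%:C * D - u%:C * N) ^+ 2 <= (u * s) ^+ 2 * normc N ^+ 2.
  have us : (u * s) ^+ 2 <= u ^+ 2.
    by rewrite exprMn ler_piMr ?sqr_ge0// expr_le1.
  have h1 : 0 <= (u ^+ 2 - (u * s) ^+ 2)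
      * (2 * c * complex.Re (E * D^*%C) - normc E ^+ 2).
    by apply: mulr_ge0; rewrite subr_ge0.
  have h2 : 0 <= (c ^+ 2 * normc D ^+ 2) * ((u * s) ^+ 2 - normc (z - u%:C) ^+ 2).
    by apply: mulr_ge0; [apply: mulr_ge0; exact: sqr_ge0|rewrite subr_ge0].
  have h3 : (2 * u * c) * complex.Re (z * D * E^*%C) <= 0.
    by rewrite pmulr_rle0 ?mulr_gt0// ltW.
  rewrite NE; move: h1 h2 h3; rewrite !sqr_normcE.
  case: (z) (D) (E) => [z1 z2] [d1 d2] [e1 e2] /=; lra.
have N0 : N != 0.
  apply/eqP => N0; move: key; rewrite N0 mulr0 subr0 normc0 expr0n mulr0.
  apply/negP; rewrite -ltNge exprn_gt0// normc_gt0 !mulf_neq0//.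
    by apply: contra_ltN imz => /eqP ->; rewrite lexx.
  by rewrite fmorph_eq0 gt_eqF.
exists t => //; split=> //; exists u; first by rewrite u0.
have -> : z * c%:C * D / N - u%:C = (z * c%:C * D - u%:C * N) / N.
  by rewrite mulrBl mulfK.
by rewrite normcM normcV exprMn exprVn ler_pdivrMr// exprn_gt0// normc_gt0.
Qed.

End BoundaryPoint.

(** * From points of the scaled graph to destabilizing perturbations *)

Section DestabilizingVectors.
Variables (R : realType) (m : nat).
Implicit Types (x y e : 'cV[R[i]]_m) (q : R[i]) (w : \bar R).

(** [e2] is the normalized component of [y] orthogonal to [e1]; for real [q] this component is zero
    and the spare direction [e] takes its place. *)
Lemma plane_complete e1 y e q : ip e1 e1 = 1 -> ip e e = 1 -> ip e1 e = 0 ->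
  ip y y = normc q ^+ 2 -> ip e1 y = complex.Re q ->
  exists e2, [/\ ip e2 e2 = 1, ip e1 e2 = 0, y = plane e1 e2 q &
    forall j, complex.Im (e1 j 0) = 0 -> complex.Im (y j 0) = 0 ->
      complex.Im (e j 0) = 0 -> complex.Im (e2 j 0) = 0].
Proof.
move=> e11 ee e1e yy e1y; set p := complex.Re q in e1y.
pose r := y - p%:C *: e1.
have rr : ip r r = complex.Im q ^+ 2.
  rewrite ipDl !ipDr !ipNl !ipNr !ipZl !ipZr yy e11 (ipC y) e1y sqr_normcE -/p.
  by ring.
have [q0|q0] := eqVneq (complex.Im q) 0.
  exists e; split=> //; rewrite /plane q0 rmorph0 scale0r addr0.
  by apply/eqP; rewrite -subr_eq0 -ip_eq0 -/p -/r rr q0 expr0n.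
exists ((complex.Im q)^-1%:C *: r); split=> [|||j e1j yj _].
- by rewrite ipZl ipZr rr; field.
- by rewrite ipZr ipDr ipNr ipZr e1y e11; ring.
- rewrite /plane scalerA -rmorphM mulfV// scale1r /r -/p.
  by rewrite addrC subrK.
- rewrite !mxE; case: (y j 0) yj (e1 j 0) e1j => [y1 y2] /= -> [u1 u2] /= ->.
  by ring.
Qed.

Lemma destabilizing_vector N (k : 'I_N) (Pk : 'M[{fraction {poly R}}]_m) w
    (beta gamma : 'I_N -> R) x q s e :
  (0 <= w)%E -> RHinf Pk ->
  (forall i, i != k -> 0 <= beta i <= pi / 2) ->
  (forall i, i != k -> 0 < gamma i) -> x != 0 ->
  normc q = enorm (freqresp Pk w *m x) / enorm x ->
  complex.Re q = ip x (freqresp Pk w *m x) / enorm x ^+ 2 ->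
  ip e e = 1 -> ip x e = 0 ->
  prod_set (fun i => i != k) (fun i => region (beta i) (gamma i)) s ->
  q * s = -1 ->
  interior_freq w \/ (forall j, [/\ complex.Im (x j 0) = 0,
    complex.Im ((freqresp Pk w *m x) j 0) = 0 & complex.Im (e j 0) = 0]) ->
  exists P : 'I_N -> 'M[{fraction {poly R}}]_m, [/\ P k = Pk,
    forall i, i != k -> uncertain_class (beta i) (gamma i) (P i) &
    ~ feedback_stable P].
Proof.
move=> w0 PkRH bb g0 x0 nq rq ee xe [z zR zs] qs re.
have nx : 0 < enorm x by rewrite enorm_gt0.
pose c := (enorm x)^-1; have c0 : 0 < c by rewrite invr_gt0.
pose e1 := c%:C *: x; pose y := freqresp Pk w *m e1.
have yE : y = c%:C *: (freqresp Pk w *m x) by rewrite /y -scalemxAr.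
have e11 : ip e1 e1 = 1.
  by rewrite ipZl ipZr -sqr_enorm /c; field; rewrite gt_eqF.
have e1e : ip e1 e = 0 by rewrite ipZl xe mulr0.
have yy : ip y y = normc q ^+ 2.
  by rewrite yE ipZl ipZr -sqr_enorm nq /c; field; rewrite gt_eqF.
have e1y : ip e1 y = complex.Re q.
  by rewrite yE ipZl ipZr rq /c; field; rewrite gt_eqF.
have [e2 [e22 e12 yp e2r]] := plane_complete e11 ee e1e yy e1y.
pose zz i := if i == k then q else z i.
apply: (@destabilizing_plane R m N k Pk w beta gamma zz e1 e2) => //.
- by move=> i ik; rewrite /zz (negPf ik); exact: zR.
- by rewrite /zz eqxx -yp.
- rewrite (bigD1 k)//= {1}/zz eqxx -qs -zs; congr (_ * _).
  by apply: eq_bigr => i ik; rewrite /zz (negPf ik).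
- case: re => [h|re]; [exact: Or31|apply: Or32 => j].
  have [xj yj ej] := re j; have e1j : complex.Im (e1 j 0) = 0.
    by rewrite mxE cImM xj mulr0 mul0r addr0.
  split=> //; apply: e2r => //.
  by rewrite yE mxE cImM yj mulr0 mul0r addr0.
Qed.

Lemma necessary_interior N (k : 'I_N) (Pk : 'M[{fraction {poly R}}]_m) w
    (beta gamma : 'I_N -> R) :
  (0 <= w)%E -> interior_freq w -> RHinf Pk ->
  (forall i, i != k -> 0 <= beta i <= pi / 2) ->
  (forall i, i != k -> 0 < gamma i) ->
  mul_set (SRG 0 (freqresp Pk w))
    (prod_set (fun i => i != k) (fun i => region (beta i) (gamma i))) (-1) ->
  exists P : 'I_N -> 'M[{fraction {poly R}}]_m, [/\ P k = Pk,
    forall i, i != k -> uncertain_class (beta i) (gamma i) (P i) &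
    ~ feedback_stable P].
Proof.
move=> w0 wi PkRH bb g0 [q /SRG0P[x x0 [nq rq]] [s sS qs]].
have nx : enorm x != 0 by rewrite enorm_eq0.
(* As [inner x x] is real, j x is orthogonal to x for [ip]: interior frequencies offer a spare
   direction even for m = 1. *)
pose e := ((enorm x)^-1)%:C *: ('i%C *: x).
have inner_re : complex.Im (inner x x) = 0.
  rewrite innerE; apply: (big_ind (fun z : R[i] => complex.Im z = 0)) => //.
    by case=> ? ? [? ?] /= -> ->; rewrite addr0.
  by move=> i _; case: (x i 0) => p p' /=; ring.
apply: (destabilizing_vector w0 PkRH bb g0 x0 nq rq _ _ sS qs (or_introl wi) (e := e)).
  rewrite ipZl ipZr -sqr_enorm enormZC /= expr0n add0r expr1n sqrtr1 mul1r.
  by field.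
by rewrite ipZr -Re_inner innerZr cReM /= inner_re mul0r mulr0 subrr mulr0.
Qed.

End DestabilizingVectors.

(** To be read with a = |x|, b = |C x|, p = Re <x, C x>, and the primes for another vector. Keeping
    p / a^2 when p >= 0, and p / b^2 when p < 0, makes the cosine p / (a b) decrease as the gain b /
    a grows. *)
Lemma norm_angle_compare (R : realFieldType) (a b a' b' p p' : R) :
  0 < a -> 0 < b -> 0 < a' -> 0 < b' -> b * a' <= a * b' ->
  (if 0 <= p then a ^+ 2 * p' = p * a' ^+ 2 else b ^+ 2 * p' = p * b' ^+ 2) ->
  b / a <= b' / a' /\ p' / (a' * b') <= p / (a * b).
Proof.
move=> a0 b0 a'0 b'0 le E; split.
  by rewrite ler_pdivrMr// mulrAC ler_pdivlMr// [b' * a]mulrC.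
rewrite ler_pdivrMr ?mulr_gt0// mulrAC ler_pdivlMr ?mulr_gt0//.
case: (leP 0 p) E => p0 E.
  rewrite -(ler_pM2l a0); have -> : a * (p' * (a * b)) = a ^+ 2 * p' * b by ring.
  rewrite E; have -> : a * (p * (a' * b')) = p * a' * (a * b') by ring.
  have -> : p * a' ^+ 2 * b = p * a' * (b * a') by ring.
  by rewrite ler_wpM2l// mulr_ge0// ltW.
rewrite -(ler_pM2l b0); have -> : b * (p' * (a * b)) = b ^+ 2 * p' * a by ring.
rewrite E; have -> : b * (p * (a' * b')) = p * b' * (b * a') by ring.
have -> : p * b' ^+ 2 * a = p * b' * (a * b') by ring.
by rewrite ler_wnM2l// (mulr_le0_ge0 (ltW p0) (ltW b'0)).
Qed.

(** * Real vectors attaining graph points of a real matrix *)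

Section RealVectors.
Variables (R : realType) (m : nat).
Implicit Types (x y u : 'cV[R[i]]_m) (C : 'M[R[i]]_m).

Definition is_real_vec x := forall j, complex.Im (x j 0) = 0.

Definition re_vec x : 'cV[R[i]]_m := \col_j (complex.Re (x j 0))%:C.
Definition im_vec x : 'cV[R[i]]_m := \col_j (complex.Im (x j 0))%:C.

Lemma ip_re_im x y : ip x y = ip (re_vec x) (re_vec y) + ip (im_vec x) (im_vec y).
Proof.
by rewrite !ipE -big_split; apply: eq_bigr => i _; rewrite !mxE /=; ring.
Qed.

Variable C : 'M[R[i]]_m.
Hypothesis C_real : forall i j, complex.Im (C i j) = 0.

Lemma mul_re_vec x : re_vec (C *m x) = C *m re_vec x.
Proof.
apply/matrixP => i j; rewrite !mxE cRe_sum rmorph_sum; apply: eq_bigr => l _.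
by rewrite mxE; case: (C i l) (C_real i l) => p p' /= ->; rewrite cReMr rmorphM.
Qed.

Lemma mul_im_vec x : im_vec (C *m x) = C *m im_vec x.
Proof.
have cIm_sum (I : Type) (r : seq I) (P : pred I) (F : I -> R[i]) :
    complex.Im (\sum_(i <- r | P i) F i) = \sum_(i <- r | P i) complex.Im (F i).
  by apply: big_morph => // [[? ?] [? ?]].
apply/matrixP => i j; rewrite !mxE cIm_sum rmorph_sum; apply: eq_bigr => l _.
by rewrite mxE; case: (C i l) (C_real i l) => p p' /= ->; rewrite cImM /= mul0r addr0 rmorphM.
Qed.

Lemma real_vec_mul u : is_real_vec u -> is_real_vec (C *m u).
Proof.
move=> ur j; rewrite mxE; apply: (big_ind (fun z : R[i] => complex.Im z = 0)) => //.
  by case=> ? ? [? ?] /= -> ->; rewrite addr0.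
by move=> l _; rewrite cImM C_real ur mulr0 mul0r addr0.
Qed.

(** Both requirements on a real substitute for [x], a gain at least as large and a kept ratio, are
    sign conditions on forms of this family. *)
Definition qform (a b c : R) u :=
  a * ip u (C *m u) + b * ip (C *m u) (C *m u) + c * ip u u.

Lemma qform_re_im a b c x :
  qform a b c x = qform a b c (re_vec x) + qform a b c (im_vec x).
Proof.
rewrite /qform (ip_re_im x x) (ip_re_im x (C *m x)) (ip_re_im (C *m x) (C *m x)).
by rewrite mul_re_vec mul_im_vec; ring.
Qed.

Lemma qform_comb a b c u v (A B : R) :
  qform a b c (A%:C *: u + B%:C *: v)
  = A ^+ 2 * qform a b c u + B ^+ 2 * qform a b c v
    + A * B * (a * (ip u (C *m v) + ip v (C *m u))
       + 2 * b * ip (C *m u) (C *m v) + 2 * c * ip u v).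
Proof.
rewrite /qform mulmxDr -!scalemxAr !ipDl !ipDr !ipZl !ipZr.
rewrite (ipC (C *m v) (C *m u)) (ipC v u).
move: (ip u (C *m u)) (ip v (C *m v)) (ip u (C *m v)) (ip v (C *m u)) (ip u v)
  (ip u u) (ip v v) (ip (C *m u) (C *m u)) (ip (C *m v) (C *m v))
  (ip (C *m u) (C *m v)) => *.
ring.
Qed.

(* On the real plane spanned by the real and imaginary parts of [x], each of the
   two forms takes opposite values at vectors obtained from one another by a
   quarter turn. *)
Lemma real_vector_qform a b c a' b' c' x : x != 0 ->
  qform a b c x = 0 -> qform a' b' c' x = 0 ->
  exists u, [/\ u != 0, is_real_vec u, qform a b c u = 0 & 0 <= qform a' b' c' u].
Proof.
move=> x0; rewrite !(qform_re_im _ _ _ x); set v := re_vec x; set v' := im_vec x.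
move=> /eqP; rewrite addr_eq0 => /eqP f1; move=> /eqP; rewrite addr_eq0 => /eqP f2.
set F := qform a b c v' in f1; set F' := qform a' b' c' v' in f2.
pose M := a * (ip v (C *m v') + ip v' (C *m v))
       + 2 * b * ip (C *m v) (C *m v') + 2 * c * ip v v'.
(* The first form has opposite values at v and v', so its vanishing at A v + B v' is this equation;
   for F != 0 it is a quadratic equation in A with B = 1 and nonnegative discriminant. *)
have [A [B [AB0 AB]]] : exists A B : R, A ^+ 2 + B ^+ 2 != 0 /\
    (B ^+ 2 - A ^+ 2) * F + A * B * M = 0.
  have [F0|F0] := eqVneq F 0.
    by exists 1, 0; rewrite F0; split; [rewrite expr1n expr0n addr0 oner_eq0|ring].
  pose r := Num.sqrt (M ^+ 2 + 4 * F ^+ 2).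
  have r2 : r ^+ 2 = M ^+ 2 + 4 * F ^+ 2.
    by rewrite sqr_sqrtr// addr_ge0 ?sqr_ge0// mulr_ge0 ?sqr_ge0// ler0n.
  exists ((M + r) / (2 * F)), 1; split.
    by rewrite expr1n gt_eqF// ltr_wpDl ?sqr_ge0.
  have -> : (1 ^+ 2 - ((M + r) / (2 * F)) ^+ 2) * F + (M + r) / (2 * F) * 1 * M
      = (4 * F ^+ 2 + M ^+ 2 - r ^+ 2) / (4 * F) by field.
  by rewrite r2 [4 * _ + _]addrC subrr mul0r.
pose u := A%:C *: v + B%:C *: v'; pose u' := (- B)%:C *: v + A%:C *: v'.
have realc (p q : R) : is_real_vec (p%:C *: v + q%:C *: v').
  by move=> j; rewrite !mxE /=; ring.
have fu : qform a b c u = 0.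
  by rewrite qform_comb f1 -/F -/M -AB; ring.
have fu' : qform a b c u' = 0.
  have -> : qform a b c u' = - ((B ^+ 2 - A ^+ 2) * F + A * B * M).
    by rewrite qform_comb f1 -/F -/M; ring.
  by rewrite AB oppr0.
have sum0 : qform a' b' c' u + qform a' b' c' u' = 0.
  by rewrite !qform_comb f2 -/F'; ring.
have z0 : qform a' b' c' (0 : 'cV[R[i]]_m) = 0.
  have ip0 y : ip (0 : 'cV[R[i]]_m) y = 0.
    by rewrite ipE big1// => i _; rewrite !mxE /= !mul0r addr0.
  by rewrite /qform mulmx0 !ip0 !mulr0 !addr0.
(* v and v' may be dependent, so that one of u and u' can vanish, but not both. *)
have nz : u = 0 -> u' = 0 -> False.
  move=> u0 u'0; move/eqP: x0; apply.
  have h1 : (A ^+ 2 + B ^+ 2)%:C *: v = 0.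
    have -> : (A ^+ 2 + B ^+ 2)%:C *: v = A%:C *: u - B%:C *: u'.
      apply/matrixP => i j; rewrite !mxE !rmorphN !rmorphD !rmorphXn; ring.
    by rewrite u0 u'0 !scaler0 subrr.
  have h2 : (A ^+ 2 + B ^+ 2)%:C *: v' = 0.
    have -> : (A ^+ 2 + B ^+ 2)%:C *: v' = B%:C *: u + A%:C *: u'.
      apply/matrixP => i j; rewrite !mxE !rmorphN !rmorphD !rmorphXn; ring.
    by rewrite u0 u'0 !scaler0 addr0.
  have ABC : (A ^+ 2 + B ^+ 2)%:C != 0 :> R[i] by rewrite fmorph_eq0.
  apply/matrixP => i j; rewrite (ord1 j) mxE.
  move/eqP: h1; rewrite scaler_eq0 (negPf ABC) => /eqP/matrixP/(_ i 0).
  move/eqP: h2; rewrite scaler_eq0 (negPf ABC) => /eqP/matrixP/(_ i 0).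
  by rewrite !mxE; case: (x i 0) => p q /= [->] [->].
have := realc (- B) A; have := realc A B; rewrite -/u -/u'.
move: (u) (u') fu fu' sum0 nz => {}u {}u' fu fu' sum0 nz ru ru'.
have [k0|k0] := leP 0 (qform a' b' c' u).
  have [u0|u0] := eqVneq u 0; last by exists u.
  have k'0 : qform a' b' c' u' = 0 by rewrite -[LHS]add0r -{1}z0 -{1}u0 sum0.
  exists u'; split; [apply/eqP => u'0; exact: nz u0 u'0|exact: ru'|exact: fu'|].
  by rewrite k'0.
exists u'; split; [|exact: ru'|exact: fu'|].
  apply/eqP => u'0; move: sum0; rewrite u'0 z0 addr0 => k00.
  by move: k0; rewrite k00 ltxx.
by move: k0 sum0; move: (qform _ _ _ u) (qform _ _ _ u') => *; lra.
Qed.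

(** The form required to vanish keeps Re <u, C u> / |u|^2 or Re <u, C u> / |C u|^2, by the sign of
    Re <x, C x>; the one required to be nonnegative compares gains. [norm_angle_compare] then yields
    the angle. *)
Lemma real_SRG_point x : x != 0 -> C *m x != 0 ->
  exists u, [/\ u != 0, C *m u != 0, is_real_vec u &
    enorm (C *m x) / enorm x <= enorm (C *m u) / enorm u /\
    ang x (C *m x) <= ang u (C *m u)].
Proof.
move=> x0 Cx0; have nx : 0 < enorm x by rewrite enorm_gt0.
have nCx : 0 < enorm (C *m x) by rewrite enorm_gt0.
have kx : qform 0 (ip x x) (- ip (C *m x) (C *m x)) x = 0.
  rewrite /qform mul0r add0r mulrC mulNr; exact: subrr.
have [a [b [c [abc lx]]]] : exists a b c : R,
    (if 0 <= ip x (C *m x) then [/\ a = ip x x, b = 0 & c = - ip x (C *m x)]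
     else [/\ a = ip (C *m x) (C *m x), b = - ip x (C *m x) & c = 0])
    /\ qform a b c x = 0.
  case: (leP 0 (ip x (C *m x))) => _.
    exists (ip x x), 0, (- ip x (C *m x)); split=> //.
    by rewrite /qform mul0r addr0 mulNr mulrC subrr.
  exists (ip (C *m x) (C *m x)), (- ip x (C *m x)), 0; split=> //.
  by rewrite /qform mul0r addr0 mulNr mulrC subrr.
have [u [u0 ur lu ku]] := real_vector_qform x0 lx kx.
have nu : 0 < enorm u by rewrite enorm_gt0.
have {}ku : enorm (C *m x) * enorm u <= enorm x * enorm (C *m u).
  rewrite -(ler_pXn2r (n := 2)) ?nnegrE ?mulr_ge0 ?enorm_ge0//.
  rewrite !exprMn !sqr_enorm -subr_ge0; move: ku.
  by rewrite /qform mul0r add0r mulNr.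
have nCu : 0 < enorm (C *m u).
  have h : 0 < enorm x * enorm (C *m u) by apply: lt_le_trans ku; exact: mulr_gt0.
  by move: h; rewrite pmulr_rgt0.
have E : if 0 <= ip x (C *m x)
    then enorm x ^+ 2 * ip u (C *m u) = ip x (C *m x) * enorm u ^+ 2
    else enorm (C *m x) ^+ 2 * ip u (C *m u) = ip x (C *m x) * enorm (C *m u) ^+ 2.
  move: abc lu; rewrite /qform !sqr_enorm.
  case: (leP 0 (ip x (C *m x))) => _ [-> -> ->] /eqP.
    by rewrite mul0r addr0 mulNr subr_eq0 => /eqP.
  by rewrite mul0r addr0 mulNr subr_eq0 => /eqP.
have Cu0 : C *m u != 0 by rewrite -enorm_gt0.
have [h1 h2] := norm_angle_compare nx nCx nu nCu ku E.
have /andP[l1 _] := ip_div_itv u (C *m u); have /andP[_ l2] := ip_div_itv x (C *m x).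
exists u; split; [exact: u0|exact: Cu0|exact: ur|split; first exact: h1].
by rewrite !angE; exact: le_acos l1 h2 l2.
Qed.

Lemma real_orthogonal u : (1 < m)%N -> is_real_vec u ->
  exists e : 'cV[R[i]]_m, [/\ ip e e = 1, ip u e = 0 & is_real_vec e].
Proof.
move=> m1 ur.
suff [e [e0 ue er]] : exists e : 'cV[R[i]]_m, [/\ e != 0, ip u e = 0 & is_real_vec e].
  exists (((enorm e)^-1)%:C *: e); have ne : enorm e != 0 by rewrite enorm_eq0.
  split=> [||j]; first by rewrite ipZl ipZr -sqr_enorm; field.
    by rewrite ipZr ue mulr0.
  by rewrite mxE cImM er mulr0 mul0r addr0.
pose i0 : 'I_m := Ordinal (ltnW m1); pose i1 : 'I_m := Ordinal m1.
pose d (i : 'I_m) : 'cV[R[i]]_m := delta_mx i 0.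
have ud i : ip u (d i) = complex.Re (u i 0).
  rewrite ipE (bigD1 i)//= !mxE !eqxx /= mulr1 mulr0 addr0 big1 ?addr0// => j ji.
  by rewrite !mxE (negPf ji) /= !mulr0 addr0.
have dr i : is_real_vec (d i).
  by move=> j; rewrite mxE; case: (_ && _).
pose p := complex.Re (u i0 0); pose q := complex.Re (u i1 0).
have [p0|p0] := eqVneq p 0.
  exists (d i0); split; rewrite ?ud//.
  apply/eqP => /matrixP/(_ i0 0); rewrite !mxE !eqxx => /eqP.
  by rewrite oner_eq0.
exists (q%:C *: d i0 + (- p)%:C *: d i1); split.
- apply/eqP => /matrixP/(_ i1 0); rewrite !mxE !eqxx /= mulr0 add0r mulr1.
  by move=> /eqP; rewrite fmorph_eq0 oppr_eq0 (negPf p0).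
- by rewrite ipDr !ipZr !ud -/p -/q; ring.
- by move=> j; rewrite !mxE; case: (_ && _); case: (_ && _) => /=; ring.
Qed.

End RealVectors.

Section BoundaryFrequencies.
Variable R : realType.
Implicit Types (z q s : R[i]) (w : \bar R) (c t : R).

Local Notation "p %:CP" := (map_poly (real_complex R) p) (at level 2).

Lemma cReV z : complex.Re z^-1 = complex.Re z / normc z ^+ 2.
Proof. by rewrite sqr_normcE; case: z. Qed.

(** Passing from q to -1/q inverts the modulus and replaces the absolute argument by its supplement;
    the conclusion has the form required by [prod_set_mono]. *)
Lemma neg_inv_compare q q' : q != 0 -> normc q <= normc q' ->
  complex.Re q' / normc q' <= complex.Re q / normc q ->
  normc (- q'^-1) <= normc (- q^-1) /\
  complex.Re (- q^-1) * normc (- q'^-1) <= complex.Re (- q'^-1) * normc (- q^-1).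
Proof.
rewrite -normc_gt0 => q0 qq' Re; have q'0 := lt_le_trans q0 qq'.
rewrite !normcN !normcV !cReN !cReV; split; first by rewrite lef_pV2.
have -> : - (complex.Re q / normc q ^+ 2) * (normc q')^-1
    = - ((normc q)^-1 * (normc q')^-1) * (complex.Re q / normc q).
  by field; rewrite !gt_eqF.
have -> : - (complex.Re q' / normc q' ^+ 2) * (normc q)^-1
    = - ((normc q)^-1 * (normc q')^-1) * (complex.Re q' / normc q').
  by field; rewrite !gt_eqF.
by rewrite ler_wnM2l// oppr_le0 mulr_ge0// invr_ge0 ltW.
Qed.

Lemma region_conj (beta gamma : R) z :
  region beta gamma z -> region beta gamma z^*%C.
Proof.
move=> [r [d [/andP[d1 d2] rd ->]]]; exists r, (- d).
rewrite lerN2 d2 lerNl d1 cosN sinN sqrrN; split=> //.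
by apply/eqP; rewrite eq_complex /expi cosN sinN /=; apply/andP; split; apply/eqP; ring.
Qed.

Lemma interior_freqPn w : (0 <= w)%E -> ~ interior_freq w -> w = 0%E \/ w = +oo%E.
Proof.
case: w => [r||] //; rewrite /interior_freq ?lee_fin ?lte_fin => r0; last by right.
rewrite ltry andbT => /negP; rewrite -leNgt => r0'; left.
by congr (_%:E); apply/le_anti; rewrite r0 r0'.
Qed.

Lemma ev_boundary_real f w : w = 0%E \/ w = +oo%E -> rh f -> complex.Im (ev w f) = 0.
Proof.
move=> w0 /rh_repr[dh nd fE].
suff [a [b ->]] : exists a b : R, ev w f = a%:C / b%:C.
  by rewrite -fmorphV -rmorphM.
rewrite (ev_frac w dh nd fE); case: w0 => ->; rewrite /polyval; last by do 2 eexists.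
exists (ratnum f).[0], (ratden f).[0].
by rewrite -!horner_map.
Qed.

Lemma freqresp_boundary_real m (P : 'M[{fraction {poly R}}]_m) w :
  w = 0%E \/ w = +oo%E -> RHinf P -> forall i j, complex.Im (freqresp P w i j) = 0.
Proof. by move=> w0 PRH i j; rewrite freqrespE mxE ev_boundary_real. Qed.

Lemma map_revpoly e (p : {poly R}) : (revpoly e p)%:CP = revpoly e p%:CP.
Proof.
apply/polyP => i; rewrite coef_map [in LHS]coef_poly [RHS]coef_poly.
by case: ifP => _; [rewrite coef_map|exact: rmorph0].
Qed.

(* The substitution s -> 1/s exchanges the two ends of the imaginary axis. *)
Lemma boundary_chart f w c : w = 0%E \/ w = +oo%E -> rh f -> ev w f = c%:C ->
  exists n d : {poly R}, [/\ hurwitz d%:CP, (size n <= size d)%N,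
    n.[0] = c * d.[0] &
    forall t, 0 < t -> exists2 om, 0 < om &
      ev om%:E f = (n%:CP).[0 +i* t] / (d%:CP).[0 +i* t] \/
      ev om%:E f = ((n%:CP).[0 +i* t] / (d%:CP).[0 +i* t])^*%C].
Proof.
move=> w0 /rh_repr[dh nd fE].
set n := ratnum f in nd fE; set d := ratden f in dh nd fE.
have evE x := ev_frac x dh nd fE.
have d0 : d.[0] != 0.
  have := dh 0 (lexx _); rewrite -(rmorph0 (real_complex R)) horner_map.
  by rewrite fmorph_eq0.
rewrite evE; case: w0 => -> evc.
  exists n, d; split=> //.
    have e0 E (p : {poly R}) : polyval 0%E E p = (p.[0])%:C.
      by rewrite -[LHS]/((p%:CP).[(0 : R)%:C]) horner_map.
    move: evc; rewrite !e0 -fmorphV -rmorphM.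
    by move=> /complexI <-; rewrite divfK.
  by move=> t t0; exists t => //; left; rewrite evE.
pose e := (size d).-1; have de : size d = e.+1.
  by rewrite prednK// size_poly_gt0 hurwitzCP_neq0.
have lc0 : d`_e != 0 by rewrite -[_`_e]/(lead_coef d) lead_coef_eq0 hurwitzCP_neq0.
have srd : size (revpoly e d) = e.+1.
  apply/eqP; rewrite eqn_leq size_poly/= ltnNge; apply: contra d0 => h.
  have := nth_default 0 h; rewrite coef_poly leqnn subnn horner_coef0 => ->.
  by rewrite eqxx.
exists (revpoly e n), (revpoly e d); split.
- move=> z z0; rewrite map_revpoly.
  have [->|zn0] := eqVneq z 0; first by rewrite revpoly0 coef_map fmorph_eq0.
  have := dh z^-1; rewrite cReV divr_ge0 ?sqr_ge0// => /(_ isT).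
  rewrite (@horner_revpoly _ e) ?size_map_poly ?de ?invr_eq0// invrK.
  by rewrite mulf_eq0 negb_or => /andP[].
- by rewrite srd; exact: size_poly.
- move: evc; rewrite /polyval !revpoly0 -/e -fmorphV -rmorphM => /complexI <-.
  by rewrite divfK.
(* The inverse of j / t is - j t, the conjugate of j t; hence the conjugated alternative. *)
- move=> t t0; exists t^-1; rewrite ?invr_gt0//; right.
  have w0 : 0 +i* t^-1 != 0 :> R[i].
    by rewrite eq_complex /= eqxx gt_eqF// invr_gt0.
  have iE : (0 +i* t^-1)^-1 = (0 +i* t)^*%C :> R[i].
    apply: (mulfI w0); rewrite mulfV//; apply/eqP; rewrite eq_complex /=.
    by apply/andP; split; apply/eqP; field; rewrite gt_eqF.
  pose cj : {rmorphism R[i] -> R[i]} := @conjc R.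
  rewrite evE /polyval -/e !(@horner_revpoly _ e _ (0 +i* t^-1)) ?size_map_poly ?de -?de//.
  have -> (x y : R[i]) : (x / y)^*%C = x^*%C / y^*%C by exact: (fmorph_div cj).
  rewrite -!horner_conj_real -iE !map_revpoly.
  by rewrite -mulf_div divff ?mul1r// expf_neq0.
Qed.

Section NecessaryBoundary.
Variables (m N : nat) (k : 'I_N) (Pk : 'M[{fraction {poly R}}]_m).
Variables (beta gamma : 'I_N -> R) (w : \bar R).
Hypotheses (w_boundary : w = 0%E \/ w = +oo%E) (Pk_RH : RHinf Pk)
  (beta_bounds : forall i, i != k -> 0 <= beta i <= pi / 2)
  (gamma_gt0 : forall i, i != k -> 0 < gamma i) (N_gt1 : (1 < N)%N).

Let S := prod_set (fun i => i != k) (fun i => region (beta i) (gamma i)).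

Let w_ge0 : (0 <= w)%E.
Proof. by case: w_boundary => ->. Qed.

Lemma necessary_boundary_gt1 : (1 < m)%N ->
  mul_set (SRG 0 (freqresp Pk w)) S (-1) ->
  exists P : 'I_N -> 'M[{fraction {poly R}}]_m, [/\ P k = Pk,
    forall i, i != k -> uncertain_class (beta i) (gamma i) (P i) &
    ~ feedback_stable P].
Proof.
move=> m1 [q /SRG0P[x x0 [nq rq]] [s sS qs]]; set C := freqresp Pk w in nq rq.
have Cr : forall i j, complex.Im (C i j) = 0 by exact: freqresp_boundary_real.
have q0 : q != 0.
  by apply/eqP => q0; move/eqP: qs; rewrite q0 mul0r eq_sym oppr_eq0 oner_eq0.
have Cx0 : C *m x != 0.
  have := normc_gt0 q; rewrite q0 nq => /eqP; apply: contraTneq => ->.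
  have /eqP -> : enorm (0 : 'cV[R[i]]_m) == 0 by rewrite enorm_eq0.
  by rewrite mul0r ltxx.
have [u [u0 Cu0 ur [le1 le2]]] := real_SRG_point Cr x0 Cx0.
have [e [ee ue er]] := real_orthogonal m1 ur.
have nu : 0 < enorm u by rewrite enorm_gt0.
have nCu : 0 < enorm (C *m u) by rewrite enorm_gt0.
have nx : 0 < enorm x by rewrite enorm_gt0.
have nCx : 0 < enorm (C *m x) by rewrite enorm_gt0.
have ru : 0 < enorm (C *m u) / enorm u by exact: divr_gt0.
pose q' := (enorm (C *m u) / enorm u)%:C * expi (ang u (C *m u)).
have nq' : normc q' = enorm (C *m u) / enorm u by rewrite normc_polar// ltW.
have cq' : cos (ang u (C *m u)) = ip u (C *m u) / (enorm u * enorm (C *m u)).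
  exact: cos_ang.
have rq' : complex.Re q' = ip u (C *m u) / enorm u ^+ 2.
  have := lt0r_neq0 nu; have := lt0r_neq0 nCu; rewrite Re_polar cq'.
  move: (enorm u) (enorm (C *m u)) (ip u (C *m u)) => a b p b0 a0.
  by field; apply/andP.
have q'0 : q' != 0 by rewrite -normc_gt0 nq'.
have sE : s = - q^-1 by apply: (mulfI q0); rewrite qs mulrN mulfV.
have [||h1 h2] := @neg_inv_compare q q' q0; first by rewrite nq nq'.
  have -> : complex.Re q' / normc q' = cos (ang u (C *m u)).
    by rewrite Re_polar nq' mulrAC mulfV ?mul1r// gt_eqF.
  have -> : complex.Re q / normc q = cos (ang x (C *m x)).
    have := lt0r_neq0 nx; have := lt0r_neq0 nCx; rewrite nq rq cos_ang.
    move: (enorm x) (enorm (C *m x)) (ip x (C *m x)) => a b p b0 a0.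
    by field; apply/andP.
  have /andP[a0 _] := ang_itv x (C *m x); have /andP[_ a1] := ang_itv u (C *m u).
  exact: le_cos.
have [i0 i0k] := other_index k N_gt1.
have s'S : S (- q'^-1).
  apply: (prod_set_mono beta_bounds gamma_gt0 i0k (w := s)) => //; rewrite sE//.
apply: (destabilizing_vector w_ge0 Pk_RH beta_bounds gamma_gt0 u0 nq' rq' ee ue s'S).
  by rewrite mulrN mulfV.
by right=> j; split; [exact: ur|exact: real_vec_mul|exact: er].
Qed.

End NecessaryBoundary.

End BoundaryFrequencies.

(** * Systems of size one at the frequencies 0 and infinity *)

Section NecessaryScalar.
Variable R : realType.
Implicit Types (z q s : R[i]) (c t : R).

Local Notation "p %:CP" := (map_poly (real_complex R) p) (at level 2).

Lemma mulmx_scalar1 (C : 'M[R[i]]_1) (x : 'cV[R[i]]_1) : C *m x = C 0 0 *: x.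
Proof. by rewrite {1}[C]mx11_scalar mul_scalar_mx. Qed.

Lemma SRG0_scalar (C : 'M[R[i]]_1) : SRG 0 C (C 0 0).
Proof.
apply/SRG0P; exists (1%:M : 'cV[R[i]]_1).
  by apply/eqP => /matrixP/(_ 0 0); rewrite !mxE => /eqP; rewrite oner_eq0.
have i1 : inner (1%:M : 'cV[R[i]]_1) 1%:M = 1.
  by rewrite innerE big_ord1 !mxE conjc1 mul1r.
have e1 : enorm (1%:M : 'cV[R[i]]_1) = 1.
  by rewrite enormE -Re_inner i1 /= sqrtr1.
by rewrite mulmx_scalar1 enormZC e1 divr1 mulr1 -Re_inner innerZr i1 mulr1 expr1n divr1.
Qed.

Variables (N : nat) (k : 'I_N) (Pk : 'M[{fraction {poly R}}]_1).
Variables (beta gamma : 'I_N -> R) (w : \bar R).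
Hypotheses (w_boundary : w = 0%E \/ w = +oo%E) (Pk_RH : RHinf Pk)
  (beta_bounds : forall i, i != k -> 0 <= beta i <= pi / 2)
  (gamma_gt0 : forall i, i != k -> 0 < gamma i) (N_gt1 : (1 < N)%N).

Let S := prod_set (fun i => i != k) (fun i => region (beta i) (gamma i)).

Let f := Pk 0 0.

Let f_rh : rh f. Proof. exact: Pk_RH. Qed.

Let freq00 w' : freqresp Pk w' 0 0 = ev w' f.
Proof. by rewrite freqrespE mxE. Qed.

(** No rotation is required when P_k(jw) is negative: every factor is replaced by its modulus, which
    stays in its region and leaves a positive product 1 / |c|. *)
Lemma scalar_negative (c : R) z : c < 0 -> ev w f = c%:C -> S z -> c%:C * z = -1 ->
  exists P : 'I_N -> 'M[{fraction {poly R}}]_1, [/\ P k = Pk,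
    forall i, i != k -> uncertain_class (beta i) (gamma i) (P i) &
    ~ feedback_stable P].
Proof.
move=> c0 fc [y yR yz] cz.
pose zz i := if i == k then c%:C else (normc (y i))%:C.
pose e1 : 'cV[R[i]]_1 := 1%:M; pose e2 : 'cV[R[i]]_1 := 'i%C%:M.
have ord00 : (0 : 'I_1) == 0 by [].
apply: (@destabilizing_plane R 1 N k Pk w beta gamma zz e1 e2) => //.
- by case: w_boundary => ->.
- by rewrite ipE big_ord1 !mxE eqxx /=; ring.
- by rewrite ipE big_ord1 !mxE eqxx /=; ring.
- by rewrite ipE big_ord1 !mxE eqxx /=; ring.
- move=> i ik; rewrite /zz (negPf ik).
  have [d [_ _ h]] := region_arc (beta_bounds ik) (gamma_gt0 ik) (yR i ik).
  rewrite -[(normc _)%:C]mulr1 -(@expi0 R); apply: h.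
    by rewrite normc_ge0 lexx.
  by rewrite normr0.
- rewrite mulmx_scalar1 freq00 fc /plane /zz eqxx /=.
  by rewrite rmorph0 scale0r addr0.
- rewrite (bigD1 k)//= {1}/zz eqxx.
  have -> : \prod_(i < N | i != k) zz i = (normc z)%:C.
    rewrite -yz normc_prod rmorph_prod; apply: eq_bigr => i ik.
    by rewrite /zz (negPf ik).
  have := congr1 (@normc R) cz; rewrite normcM normcN normc1 normc_real ltr0_norm// => h.
  by rewrite -rmorphM -[c]opprK mulNr h rmorphN rmorph1.
- apply: Or33; split=> [j|i]; first by rewrite (ord1 j) mxE eqxx.
  by rewrite /zz; case: ifP.
Qed.

Lemma prod_set_conj z : S z -> S z^*%C.
Proof.
move=> [y yR <-]; exists (fun i => (y i)^*%C) => [i ik|].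
  by apply: region_conj; exact: yR.
pose cj : {rmorphism R[i] -> R[i]} := @conjc R.
by rewrite -(rmorph_prod cj).
Qed.

(* If no interior frequency destabilizes the loop then |f| is maximal at the
   boundary frequency, where [hopf_rotation] makes one factor of the product
   absorb the rotation of f. *)
Lemma scalar_positive (c : R) z : 0 < c -> ev w f = c%:C -> S z -> c%:C * z = -1 ->
  exists2 om : R, 0 < om & mul_set (SRG 0 (freqresp Pk om%:E)) S (-1).
Proof.
move=> c0 fc zS cz; apply: contrapT => noom.
have cC0 : c%:C != 0 by rewrite fmorph_eq0 gt_eqF.
have no om s : 0 < om -> S s -> ev om%:E f * s <> -1.
  move=> om0 sS fs; apply: noom; exists om => //.
  by exists (freqresp Pk om%:E 0 0); [exact: SRG0_scalar|exists s; rewrite ?freq00].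
have [i0 i0k] := other_index k N_gt1.
have zE : z = - (c^-1)%:C.
  by apply: (mulfI cC0); rewrite cz mulrN -rmorphM mulfV ?gt_eqF// rmorph1.
(* z = -1/c has the largest possible argument, so wherever |f| >= c the point -1/f is also in the
   product set. *)
have lt_c om : 0 < om -> normc (ev om%:E f) < c.
  move=> om0; rewrite ltNge; apply/negP => le_c.
  have g0 : ev om%:E f != 0 by rewrite -normc_gt0 (lt_le_trans c0).
  apply: (no om (- (ev om%:E f)^-1) om0); last by rewrite mulrN mulfV.
  have [||h1 h2] := @neg_inv_compare R c%:C (ev om%:E f) cC0.
  - by rewrite normc_ge0_real// ltW.
  - rewrite [X in _ <= _ / X]normc_ge0_real ?(ltW c0)//= divff ?gt_eqF//.
    by have /andP[] := Re_div_normc (ev om%:E f).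
  apply: (prod_set_mono beta_bounds gamma_gt0 i0k zS).
    by rewrite zE fmorphV.
  by rewrite zE fmorphV.
have [n [d [dh nd n0 chart]]] := boundary_chart w_boundary f_rh fc.
have axis t : 0 < t -> normc (n%:CP).[0 +i* t] < c * normc (d%:CP).[0 +i* t].
  move=> t0; have [om om0 fE] := chart t t0.
  have dt : 0 < normc (d%:CP).[0 +i* t] by rewrite normc_gt0 dh//= lexx.
  rewrite -ltr_pdivrMr// -normcV -normcM.
  by have := lt_c om om0; case: fE => ->; rewrite ?normc_conj.
have [y yR yz] := zS.
(* Real points of the regions are nonnegative, whereas the product z is negative. *)
have [j jk yj] : exists2 j, j != k & complex.Im (y j) != 0.
  apply: contrapT => real_y.
  suff : 0 <= z by rewrite zE oppr_ge0 lecR leNgt invr_gt0 c0.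
  rewrite -yz prodr_ge0// => i ik.
  have [d' [dpi yE _]] := region_arc (beta_bounds ik) (gamma_gt0 ik) (yR i ik).
  have yi : complex.Im (y i) = 0.
    by apply/eqP; apply: contrapT => yi; apply: real_y; exists i => //; apply/negP.
  rewrite lecE yi /= eqxx /= yE Re_polar mulr_ge0 ?normc_ge0// cos_ge0_pihalf//.
  by rewrite -ler_norml.
have [y' y'R [y'z y'j]] : exists2 y' : 'I_N -> R[i],
    forall i, i != k -> region (beta i) (gamma i) (y' i) &
    \prod_(i < N | i != k) y' i = z /\ complex.Im (y' j) < 0.
  have [yj0|yj0] := ltP (complex.Im (y j)) 0; first by exists y.
  pose cj : {rmorphism R[i] -> R[i]} := @conjc R.
  exists (fun i => (y i)^*%C) => [i ik|]; first by apply: region_conj; exact: yR.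
  split; last by case: (y j) yj yj0 => p p' /= ? ?; rewrite oppr_lt0 lt_def; apply/andP.
  by rewrite -(rmorph_prod cj) yz zE rmorphN; congr (- _); exact: conjc_real.
have [t t0 [nt0 cone_t]] := hopf_rotation c0 dh nd axis n0
  ((region_cone (beta_bounds jk) (gamma_gt0 jk) _).1 (y'R j jk))
  (sin_beta_bounds (beta_bounds jk)) y'j.
have dt0 : (d%:CP).[0 +i* t] != 0 by rewrite dh//= lexx.
(* Factor [j] alone absorbs c d / n; as z c = -1, the product becomes - (n / d)^-1. *)
pose v i := if i == j then y' j * c%:C * (d%:CP).[0 +i* t] / (n%:CP).[0 +i* t] else y' i.
have vS : S (\prod_(i < N | i != k) v i).
  exists v => // i ik; rewrite /v; case: eqP => [->|_]; last exact: y'R.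
  by apply/(region_cone (beta_bounds jk) (gamma_gt0 jk)).
have vE : \prod_(i < N | i != k) v i = - ((n%:CP).[0 +i* t] / (d%:CP).[0 +i* t])^-1.
  have : \prod_(i < N | i != k) v i
      = z * c%:C * ((d%:CP).[0 +i* t] / (n%:CP).[0 +i* t]).
    rewrite -y'z (bigD1 j jk)/= [in RHS](bigD1 j jk)/= {1}/v eqxx.
    rewrite (eq_bigr y') => [|i /andP[_ /negPf ij]]; last by rewrite /v ij.
    by ring.
  by rewrite [z * _]mulrC cz mulN1r invf_div.
have g0 : (n%:CP).[0 +i* t] / (d%:CP).[0 +i* t] != 0.
  by rewrite mulf_neq0 ?invr_eq0.
have [om om0 [fE|fE]] := chart t t0.
  by apply: (no om _ om0 vS); rewrite fE vE mulrN mulfV.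
apply: (no om _ om0 (prod_set_conj vS)).
pose cj : {rmorphism R[i] -> R[i]} := @conjc R.
rewrite fE vE -[LHS]/(cj _ * cj _) -rmorphM mulrN mulfV// rmorphN.
by congr (- _); exact: conjc1.
Qed.

Lemma necessary_boundary_scalar :
  mul_set (SRG 0 (freqresp Pk w)) S (-1) ->
  exists P : 'I_N -> 'M[{fraction {poly R}}]_1, [/\ P k = Pk,
    forall i, i != k -> uncertain_class (beta i) (gamma i) (P i) &
    ~ feedback_stable P].
Proof.
move=> [q /SRG0P[x x0 [nq rq]] [s sS qs]].
have nx : 0 < enorm x by rewrite enorm_gt0.
have [c fc] : exists c : R, ev w f = c%:C.
  have := ev_boundary_real w_boundary f_rh; case: (ev w f) => p p' /= ->.
  by exists p.
have xx : inner x x = (enorm x ^+ 2)%:C.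
  rewrite innerE big_ord1 mulrC sqr_enorm ipE big_ord1.
  by case: (x 0 0) => p p'; apply/eqP; rewrite eq_complex /=; apply/andP; split; apply/eqP; ring.
have qc : q = c%:C.
  move: nq rq; rewrite mulmx_scalar1 freq00 fc enormZC -Re_inner innerZr xx -rmorphM /=.
  rewrite !mulfK ?gt_eqF ?exprn_gt0// => nq rq.
  have := sqr_normcE q; rewrite nq rq /= expr0n addr0 sqr_sqrtr ?sqr_ge0//.
  move=> /eqP; rewrite -subr_eq0 opprD addrA subrr sub0r oppr_eq0 sqrf_eq0 => /eqP iq.
  by apply/eqP; rewrite eq_complex rq iq /= !eqxx.
rewrite qc in qs.
have [c0|c0|c0] := ltgtP 0 c.
- have [om om0 h] := scalar_positive c0 fc sS qs.
  apply: (necessary_interior _ _ Pk_RH beta_bounds gamma_gt0 h).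
    by rewrite lee_fin ltW.
  by rewrite /interior_freq lte_fin om0 ltry.
- exact: scalar_negative c0 fc sS qs.
- by move/eqP: qs; rewrite -c0 rmorph0 mul0r eq_sym oppr_eq0 oner_eq0.
Qed.

End NecessaryScalar.

(** * The two implications combined *)

Lemma robust_stability_necessary (R : realType) m N (k : 'I_N)
    (Pk : 'M[{fraction {poly R}}]_m) (beta gamma : 'I_N -> R) (w : \bar R) :
  (0 < m)%N -> (1 < N)%N -> RHinf Pk ->
  (forall i, i != k -> 0 <= beta i <= pi / 2) ->
  (forall i, i != k -> 0 < gamma i) -> (0 <= w)%E ->
  mul_set (SRG 0 (freqresp Pk w))
    (prod_set (fun i => i != k) (fun i => region (beta i) (gamma i))) (-1) ->
  exists P : 'I_N -> 'M[{fraction {poly R}}]_m, [/\ P k = Pk,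
    forall i, i != k -> uncertain_class (beta i) (gamma i) (P i) &
    ~ feedback_stable P].
Proof.
move=> m0 N1 PkRH bb g0 w0 h.
have [wi|/negP wi] := boolP (interior_freq w).
  exact: necessary_interior w0 wi PkRH bb g0 h.
have wb := interior_freqPn w0 wi.
move: m0; rewrite leq_eqVlt => /predU1P[m1|m1].
  by move: Pk PkRH h; rewrite -m1 => Pk1 PkRH h; exact: necessary_boundary_scalar h.
exact: necessary_boundary_gt1 h.
Qed.

Theorem theorem7 (R : realType) (m N : nat) (k : 'I_N)
    (Pk : 'M[{fraction {poly R}}]_m) (beta gamma : 'I_N -> R)
    (m_gt0 : (0 < m)%N) (N_gt1 : (1 < N)%N) (Pk_RHinf : RHinf Pk)
    (beta_bounds : forall i, i != k -> 0 <= beta i <= pi / 2)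
    (gamma_gt0 : forall i, i != k -> 0 < gamma i) :
  (forall P : 'I_N -> 'M[{fraction {poly R}}]_m,
      P k = Pk ->
      (forall i, i != k -> uncertain_class (beta i) (gamma i) (P i)) ->
      feedback_stable P)
  <->
  (exists theta : \bar R -> R, forall w : \bar R, (0 <= w)%E ->
      ~ mul_set (SRG (theta w) (freqresp Pk w))
                (prod_set (fun i => i != k)
                          (fun i => region (beta i) (gamma i)))
                (-1)).
Proof.
split=> [stab|[theta noSRG] P Pk_eq Pi].
  exists (fun=> 0) => w w0 h.
  have [P [Pk_eq Pi]] := robust_stability_necessary m_gt0 N_gt1 Pk_RHinf
    beta_bounds gamma_gt0 w0 h.
  by apply; exact: stab.
apply: (robust_stability_sufficient N_gt1 _ beta_bounds gamma_gt0 Pi (theta := theta)).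
  by rewrite Pk_eq.
by rewrite Pk_eq.
Qed.
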